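(* Let $n\in\{1,2,3\}$, let $p\ge 1$ be an odd integer and let $m>0$. There is a constant $c_0>0$, depending only on $n,p,m$, such that the following holds. Let $\sigma>0$ and let $(u_0,u_1)\in H^{\sigma,2}(\mathbb{R}^n)\times H^{\sigma,0}(\mathbb{R}^n)$ be real-valued and not both zero, and set $$\delta=c_0\big(\|u_0\|_{H^{\sigma,2}}+\|u_1\|_{H^{\sigma,0}}\big)^{-(p-1)}>0 .$$ Then there exists a unique solution $u$ with $$(u,u_t)\in C\big([0,\delta];H^{\sigma,2}(\mathbb{R}^n)\big)\times C\big([0,\delta];H^{\sigma,0}(\mathbb{R}^n)\big)$$ of the Cauchy problem $$u_{tt}+(m+\Delta^2)u+|u|^{p-1}u=0,\qquad (u,u_t)|_{t=0}=(u_0,u_1)$$ on $\mathbb{R}^n\times[0,\delta]$.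
   Context: For $\sigma\ge 0$ and $s\in\mathbb{R}$, $H^{\sigma,s}(\mathbb{R}^n)$ is the space of functions with finite norm $$\|f\|_{H^{\sigma,s}(\mathbb{R}^n)}=\big\|\cosh(\sigma|\xi|)\,\langle\xi\rangle^{s}\,\hat f(\xi)\big\|_{L^2_\xi(\mathbb{R}^n)},\qquad \langle\xi\rangle=\sqrt{1+|\xi|^2},$$ where $\hat f$ is the Fourier transform. Solutions are real-valued and understood in the mild (Duhamel) sense: with $A=\sqrt{m+\Delta^2}$ (the Fourier multiplier with symbol $\sqrt{m+|\xi|^4}$), $$u(t)=\cos(tA)u_0+A^{-1}\sin(tA)u_1-\int_0^tA^{-1}\sin((t-s)A)\,\big(|u|^{p-1}u\big)(s)\,ds .$$ *)

(* Defs.v *)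
From HB Require Import structures.
From mathcomp Require Import all_boot all_order all_algebra.
From mathcomp Require Import all_classical all_reals all_analysis.
From mathcomp Require Import complex.

Set Implicit Arguments.
Unset Strict Implicit.
Unset Printing Implicit Defensive.
Import Order.TTheory GRing.Theory Num.Theory.
Import numFieldNormedType.Exports.

Local Open Scope classical_set_scope.
Local Open Scope ring_scope.
Local Open Scope complex_scope.

(* Tuples carry the product sigma-algebra, here of the Borel sets of R. *)
Notation Rn R n := (n.-tuple (measurableTypeR R)).

Section lebesgue_measure_Rn.
Variable R : realType.

Definition consRn n (p : measurableTypeR R * Rn R n) : Rn R n.+1 :=
  [tuple of p.1 :: p.2].

Lemma measurable_consRn n : measurable_fun setT (@consRn n).
Proof. exact: measurable_cons. Qed.

Section step.
Variables (n : nat) (mu : {sigma_finite_measure set (Rn R n) -> \bar R}).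

Definition lebesgueS : set (Rn R n.+1) -> \bar R :=
  pushforward (lebesgue_measure \x mu)%E (@consRn n).

Let lebesgueS0 : lebesgueS set0 = 0%E.
Proof. by rewrite /lebesgueS /pushforward preimage_set0 measure0. Qed.

Let lebesgueS_ge0 A : (0 <= lebesgueS A)%E.
Proof. exact: (measure_ge0 (lebesgue_measure \x mu)%E). Qed.

Let lebesgueS_sigma_additive : semi_sigma_additive lebesgueS.
Proof.
exact: (@measure_semi_sigma_additive _ _ _
 (measure_function_pushforward__canonical__measure_function_Measure
  (lebesgue_measure \x mu)%E (@measurable_consRn n))).
Qed.

HB.instance Definition _ := isMeasure.Build _ _ _
  lebesgueS lebesgueS0 lebesgueS_ge0 lebesgueS_sigma_additive.

Let lebesgueS_sigma_finite : sigma_finite setT lebesgueS.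
Proof.
have /sigma_finiteP[F [FT ndF Foo]] := sigma_finiteT (@lebesgue_measure R).
have /sigma_finiteP[G [GT ndG Goo]] := sigma_finiteT mu.
pose hd (x : Rn R n.+1) : measurableTypeR R := thead x.
pose tl (x : Rn R n.+1) : Rn R n := [tuple of behead x].
exists (fun k => hd @^-1` F k `&` tl @^-1` G k).
  rewrite predeqE => x; split=> // _.
  have [i _ Fi] : (\bigcup_i F i) (hd x) by rewrite -FT.
  have [j _ Gj] : (\bigcup_i G i) (tl x) by rewrite -GT.
  exists (maxn i j) => //; split.
    by apply: (_ : F i `<=` F (maxn i j)) Fi; exact/subsetPset/ndF/leq_maxl.
  by apply: (_ : G j `<=` G (maxn i j)) Gj; exact/subsetPset/ndG/leq_maxr.
move=> k; have [mF Fk] := Foo k; have [mG Gk] := Goo k; split.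
  apply: measurableI; rewrite -[X in measurable X]setTI.
    exact: measurable_tnth.
  exact: measurable_behead.
rewrite /lebesgueS /pushforward.
have hdK p : hd (consRn p) = p.1 by rewrite /hd /consRn theadE.
have tlK p : tl (consRn p) = p.2 by exact/val_inj.
rewrite (_ : _ @^-1` _ = F k `*` G k); last first.
  by apply/seteqP; split=> p /=; rewrite hdK tlK.
by rewrite product_measure1E// lte_mul_pinfty// ge0_fin_numE.
Qed.

HB.instance Definition _ := @Measure_isSigmaFinite.Build _ _ _
  lebesgueS lebesgueS_sigma_finite.

End step.

Fixpoint lebesgueRn n : {sigma_finite_measure set (Rn R n) -> \bar R} :=
  if n is n'.+1 then lebesgueS (lebesgueRn n') else dirac [tuple].

End lebesgue_measure_Rn.

Lemma lebesgueRn_box (R : realType) n (A : 'I_n -> set (measurableTypeR R)) :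
  (forall i, measurable (A i)) ->
  lebesgueRn R n [set x | forall i, A i (tnth x i)] =
  (\prod_(i < n) lebesgue_measure (A i))%E.
Proof.
elim: n A => [|n IHn] A mA.
  by rewrite big_ord0 /= diracE mem_set// => -[].
rewrite big_ord_recl /= /lebesgueS /pushforward.
have -> : @consRn R n @^-1` [set x | forall i, A i (tnth x i)] =
    A ord0 `*` [set y | forall i : 'I_n, A (lift ord0 i) (tnth y i)].
  apply/seteqP; split=> -[a b] /=.
    move=> Ax; split=> [|i]; first by have := Ax ord0; rewrite tnth0.
    by have := Ax (lift ord0 i); rewrite tnthS.
  move=> [Aa Ab] i; have [j ->|->] := unliftP ord0 i; first by rewrite tnthS.
  by rewrite tnth0.
rewrite product_measure1E//; first by rewrite (IHn (fun i => A (lift ord0 i))).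
rewrite (_ : [set y | _] =
  \bigcap_(i in [set: 'I_n]) ((fun y : Rn R n => tnth y i) @^-1` A (lift ord0 i))).
  apply: fin_bigcap_measurable => [|i _]; first exact: finite_finset.
  by rewrite -[X in measurable X]setTI; exact: measurable_tnth.
by apply/seteqP; split=> y /= Ay i => [_|]; exact: Ay.
Qed.

Section sobolev_gevrey.
Variables (R : realType) (n : nat).
Local Notation mu := (lebesgueRn R n).
Implicit Types (f g : Rn R n -> R[i]) (x xi : Rn R n).

Definition dot x xi : R := \sum_(i < n) (tnth x i : R) * tnth xi i.
Definition enorm xi : R := Num.sqrt (dot xi xi).
Definition japanese xi : R := Num.sqrt (1 + enorm xi ^+ 2).
Definition cosh (t : R) : R := (expR t + expR (- t)) / 2.

Definition in_Lp (p : R) f :=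
  (fun x => complex.Re (f x)) \in Lfun mu p%:E /\
  (fun x => complex.Im (f x)) \in Lfun mu p%:E.

Definition normL2 f : \bar R := Lnorm mu 2%:E (fun x => (Normc.normc (f x))%:E).

(* No normalizing constant; the integral is taken componentwise. *)
Definition fourierL1 f xi : R[i] :=
  let h x := (cos (dot x xi) -i* sin (dot x xi)) * f x in
  (\int[mu]_x complex.Re (h x)) +i* (\int[mu]_x complex.Im (h x)).

(* The L^2 Fourier transform: the extension by continuity of fourierL1 from
   L^1 `&` L^2, i.e. the closure of its graph in L^2 x L^2. *)
Definition is_fourier f g :=
  [/\ in_Lp 2 f, in_Lp 2 g &
      exists phi : nat -> Rn R n -> R[i],
        [/\ forall k, in_Lp 1 (phi k) /\ in_Lp 2 (phi k),
            normL2 (phi k \- f) @[k --> \oo] --> 0%E &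
            normL2 (fourierL1 (phi k) \- g) @[k --> \oo] --> 0%E]].

(* Representatives; both are determined up to a null set. *)
Definition fourier f : Rn R n -> R[i] := xget (cst 0) [set g | is_fourier f g].
Definition inv_fourier g : Rn R n -> R[i] :=
  xget (cst 0) [set f | is_fourier f g].

Definition multiplier (a : Rn R n -> R) f : Rn R n -> R[i] :=
  inv_fourier (fun xi => (a xi)%:C * fourier f xi).

Definition normH (sigma s : R) f : \bar R :=
  normL2 (fun xi =>
    (cosh (sigma * enorm xi) * japanese xi `^ s)%:C * fourier f xi).

(* For sigma > 0, as for sigma = 0 <= s, the elements are square-integrable
   functions, and their transform is the L^2 one; the distributions that occur
   for sigma = 0 > s are left out. *)
Definition in_H (sigma s : R) f :=
  (exists g, is_fourier f g) /\ (normH sigma s f < +oo)%E.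

Definition continuous_H (sigma s T : R) (U : R -> Rn R n -> R[i]) :=
  forall t : R, t \in `[0, T] ->
    in_H sigma s (U t) /\
    normH sigma s (U r \- U t) @[r --> within `[0, T] (nbhs t)] --> 0%E.

(* V is the time derivative of U on [0, T], one-sided at the end points. *)
Definition derivative_H (sigma s T : R) (U V : R -> Rn R n -> R[i]) :=
  forall t : R, t \in `[0, T] ->
    normH sigma s (fun x => ((r - t)^-1)%:C * (U r x - U t x) - V t x)
      @[r --> within (`[0, T] `\ t) (nbhs t)] --> 0%E.

(* W is the Riemann integral of F over [a, b] in H^{sigma,s}: the limit of the
   sums over tagged partitions tau with tags theta, as the mesh tends to 0. *)
Definition is_integral_H (sigma s a b : R) (F : R -> Rn R n -> R[i])
    (W : Rn R n -> R[i]) :=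
  [/\ forall r : R, r \in `[a, b] -> in_H sigma s (F r),
      in_H sigma s W &
      forall e : R, 0 < e -> exists2 eta : R, 0 < eta &
        forall (N : nat) (tau theta : nat -> R),
          tau 0%N = a -> tau N = b ->
          (forall i, (i < N)%N ->
             tau i <= theta i <= tau i.+1 /\ tau i.+1 - tau i < eta) ->
          let S x : R[i] := \sum_(i < N) (tau i.+1 - tau i)%:C * F (theta i) x in
          (normH sigma s (S \- W)%R < e%:E)%E].

End sobolev_gevrey.

Section beam_equation.
Variables (R : realType) (n : nat).
Implicit Types (v : Rn R n -> R) (u : R -> Rn R n -> R).

Definition cplx v : Rn R n -> R[i] := fun x => (v x)%:C.

(* The symbol of A = sqrt (m + Delta^2). *)
Definition beam_symbol (m : R) (xi : Rn R n) : R := Num.sqrt (m + enorm xi ^+ 4).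

Definition nonlinearity (p : nat) v : Rn R n -> R :=
  fun x => `|v x| ^+ p.-1 * v x.

Definition cosA (m t : R) (f : Rn R n -> R[i]) :=
  multiplier (fun xi => cos (t * beam_symbol m xi)) f.
Definition sinA_over_A (m t : R) (f : Rn R n -> R[i]) :=
  multiplier (fun xi => (beam_symbol m xi)^-1 * sin (t * beam_symbol m xi)) f.

Definition duhamel (m : R) (p : nat) (sigma T : R) (u0 u1 : Rn R n -> R) u :=
  forall t : R, t \in `[0, T] ->
    exists2 W : Rn R n -> R[i],
      is_integral_H sigma 2 0 t
        (fun s => sinA_over_A m (t - s) (cplx (nonlinearity p (u s)))) W &
      {ae lebesgueRn R n, forall x, cplx (u t) x =
        cosA m t (cplx u0) x + sinA_over_A m t (cplx u1) x - W x}.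

Definition solution (m : R) (p : nat) (sigma T : R) (u0 u1 : Rn R n -> R) u :=
  exists ut : R -> Rn R n -> R,
    [/\ continuous_H sigma 2 T (cplx \o u),
        continuous_H sigma 0 T (cplx \o ut),
        derivative_H sigma 0 T (cplx \o u) (cplx \o ut),
        {ae lebesgueRn R n, forall x, u 0 x = u0 x /\ ut 0 x = u1 x} &
        duhamel m p sigma T u0 u1 u].

End beam_equation.

(* Main.v *)
From HB Require Import structures.
Require Import Defs.
From mathcomp Require Import all_boot all_order all_algebra.
From mathcomp Require Import all_classical all_reals all_analysis.
From mathcomp Require Import measurable_realfun complex ring lra.

Set Implicit Arguments.
Unset Strict Implicit.
Unset Printing Implicit Defensive.
Import Order.TTheory GRing.Theory Num.Theory.
Import numFieldNormedType.Exports.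

Local Open Scope classical_set_scope.
Local Open Scope ring_scope.

(** In dimension at most 3 the nonlinearity is locally Lipschitz from
    H^{sigma,2} to H^{sigma,0}, so that the equation is an ordinary
    differential equation perturbing a unitary flow; existence is Picard
    iteration and uniqueness a Gronwall argument. The points that need care are
    the L2 Fourier transform and the independence of the constant from sigma.

    _The transform._ Solutions are real, so the Fourier transform is replaced
    by the Hartley transform, with kernel cas = cos + sin. It is real, symmetric
    and, up to (2 pi)^n, an involution. Its L2 theory is built from Poisson
    kernels: damping the inversion formula by exp (- e |xi|_1) turns it into
    a convolution with an explicit approximate identity. Schur's test then gives
    the Plancherel bound ([hart_bound]) and hence the extension to L2
    ([is_hart_exists]). Inversion ([is_hartK]) is checked on indicators of
    boxes, where everything is a product of arctangents, and extended by
    symmetry, since boxes determine a function ([box_ae0]). The even and odd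
    parts of Hartley transforms give back the Fourier transform
    ([fourier_ae]), the norms ([normHE]) and the Fourier multipliers
    ([multiplier_hart]).

    _The nonlinearity._ The weight w = cosh (sigma |xi|) satisfies
    w (x + y) <= 2 w x w y, with the same constant 2 for every sigma. By Young's
    inequalities, the functions whose transform is in L1 and in L2 for the
    weight w form an algebra ([YM]) with a constant that does not depend on
    sigma. The symbol o = sqrt (m + |xi|^4) is comparable with 1 + |xi|^2, so
    1 / o is square-integrable in dimension at most 3 ([L2_om_inv]); by the
    Cauchy-Schwarz inequality, H^{sigma,2} is contained in that algebra
    ([Gv_unweight]). Hence u |-> u^p is bounded and locally Lipschitz from
    H^{sigma,2} to H^{sigma,0} ([pow_bound], [pow_lip]); as p is odd,
    |u|^(p - 1) u = u^p.

    _Existence._ With b = w o u^ and a = w (u_t)^, where ^ is the transform, the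
    linear flow is a rotation of (b, a) by the angle t o. Undoing this rotation
    removes the unbounded operator: the rotated pair solves z' = Phi t z, with
    Phi continuous in t and Lipschitz in z on balls. Picard iteration ([picard])
    applies for a time of the order of the norm of the data to the power
    - (p - 1). Rotating back gives the continuity of u, its derivative in time,
    by dominated convergence in xi ([strong_cvg0]), and Duhamel's formula,
    whose Riemann sums are those of z' ([duhamel_sum]).

    _Uniqueness._ A solution in the sense of Duhamel is not assumed to come
    from the rotated system. The difference of two solutions is estimated with the
    Riemann sums of their Duhamel integrals, which gives a discrete Gronwall
    inequality ([gronwall]). *)

(** * Lebesgue measure on n-space *)

Section Rn_maps.
Variables (R : realType) (n : nat).
Implicit Types x y : Rn R n.

Definition tneg x : Rn R n := [tuple - (tnth x i : R) | i < n].
Definition tadd x y : Rn R n := [tuple (tnth x i : R) + tnth y i | i < n].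
Definition tsub x y : Rn R n := [tuple (tnth x i : R) - tnth y i | i < n].

Lemma tnegK : involutive tneg.
Proof. by move=> x; apply: eq_from_tnth => i; rewrite !tnth_mktuple opprK. Qed.

Lemma measurable_coord (i : 'I_n) : measurable_fun setT (fun x => tnth x i : R).
Proof. exact: measurable_tnth. Qed.

Lemma measurable_tneg : measurable_fun setT tneg.
Proof.
apply/measurable_fun_tnthP => i.
rewrite (_ : _ \o _ = fun x => - (tnth x i : R)); last first.
  by apply/funext => x; rewrite /= tnth_mktuple.
by apply: measurable_funN; exact: measurable_coord.
Qed.

Lemma measurable_tadd : measurable_fun setT (fun z : Rn R n * Rn R n => tadd z.1 z.2).
Proof.
apply/measurable_fun_tnthP => i.
rewrite (_ : _ \o _ = fun z : Rn R n * Rn R n => (tnth z.1 i : R) + tnth z.2 i).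
  by apply: measurable_funD; [exact: measurableT_comp (measurable_coord i) measurable_fst|
    exact: measurableT_comp (measurable_coord i) measurable_snd].
by apply/funext => x; rewrite /= tnth_mktuple.
Qed.

Lemma tsubE x y : tsub x y = tadd x (tneg y).
Proof. by apply: eq_from_tnth => i; rewrite !tnth_mktuple. Qed.

Lemma measurable_tsub : measurable_fun setT (fun z : Rn R n * Rn R n => tsub z.1 z.2).
Proof.
rewrite (_ : (fun z => _) = (fun z : Rn R n * Rn R n => tadd z.1 z.2) \o
    (fun z : Rn R n * Rn R n => (z.1, tneg z.2))); last first.
  by apply/funext => z; rewrite /= tsubE.
apply: (measurableT_comp measurable_tadd).
apply: measurable_fun_pair => //.
exact: (measurableT_comp measurable_tneg).
Qed.

End Rn_maps.

Section consRn.
Variables (R : realType) (n : nat).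

Lemma tnth_consRn0 (p : measurableTypeR R * Rn R n) : tnth (consRn p) ord0 = p.1.
Proof. by rewrite /consRn tnth0. Qed.

Lemma tnth_consRnS (p : measurableTypeR R * Rn R n) i :
  tnth (consRn p) (lift ord0 i) = tnth p.2 i.
Proof. by rewrite /consRn tnthS. Qed.

Lemma tneg_cons (a : R) (y : Rn R n) : tneg (consRn (a, y)) = consRn (- a, tneg y).
Proof.
apply: eq_from_tnth => i; rewrite tnth_mktuple; have [j ->|->] := unliftP ord0 i.
  by rewrite !tnth_consRnS tnth_mktuple.
by rewrite !tnth_consRn0.
Qed.

Lemma tadd_cons (a b : R) (x y : Rn R n) :
  tadd (consRn (a, x)) (consRn (b, y)) = consRn (a + b, tadd x y).
Proof.
apply: eq_from_tnth => i; rewrite tnth_mktuple; have [j ->|->] := unliftP ord0 i.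
  by rewrite !tnth_consRnS tnth_mktuple.
by rewrite !tnth_consRn0.
Qed.

Lemma consRnP (x : Rn R n.+1) : exists p, x = consRn p.
Proof. by exists (thead x, [tuple of behead x]); rewrite /consRn -tuple_eta. Qed.

End consRn.

Section Rn_integral.
Variable R : realType.
Local Open Scope ereal_scope.

Lemma integralRn0 (f : Rn R 0 -> \bar R) : measurable_fun setT f ->
  \int[lebesgueRn R 0]_x f x = f [tuple].
Proof. by move=> mf; rewrite /= integral_dirac// diracT mul1e. Qed.

(** The measure in dimension n + 1 is the image of a product measure;
    Tonelli's theorem then reduces statements about n-space to the line by
    induction. *)
Lemma ge0_integralRnS n (f : Rn R n.+1 -> \bar R) : measurable_fun setT f ->
  (forall x, 0 <= f x) ->
  \int[lebesgueRn R n.+1]_x f x =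
  \int[lebesgue_measure]_a \int[lebesgueRn R n]_y f (consRn (a, y)).
Proof.
move=> mf f0.
have -> : \int[lebesgueRn R n.+1]_x f x =
    \int[pushforward (lebesgue_measure \x lebesgueRn R n) (@consRn R n)]_x f x.
  by apply: (@eq_measure_integral _ _ _ _
    (measure_function_pushforward__canonical__measure_function_Measure
      (lebesgue_measure \x lebesgueRn R n) (@measurable_consRn R n))).
rewrite ge0_integral_pushforward//; last exact: measurable_consRn.
rewrite preimage_setT -(fubini_tonelli1 (f \o @consRn R n))//=.
by apply: measurableT_comp => //; exact: measurable_consRn.
Qed.

(** A translate of the Lebesgue measure agrees with it on half-open intervals,
    which determine it. *)
Lemma ge0_integral1D (f : measurableTypeR R -> \bar R) (a : R) : measurable_fun setT f ->
  (forall x, 0 <= f x) ->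
  \int[lebesgue_measure]_x f (a + x)%R = \int[@lebesgue_measure R]_x f x.
Proof.
move=> mf f0; pose g (x : measurableTypeR R) : measurableTypeR R := (a + x)%R.
have mg : measurable_fun setT g by exact: measurable_funD.
transitivity (\int[pushforward (@lebesgue_measure R) g]_x f x).
  have := @ge0_integral_pushforward _ _ _ _ _ g mg (@lebesgue_measure R) setT f
    measurableT mf (fun y _ => f0 y).
  by rewrite preimage_setT => ->.
apply: (@eq_measure_integral _ _ _ _ (@lebesgue_measure R)
  (measure_function_pushforward__canonical__measure_function_Measure
    (@lebesgue_measure R) mg)) => A mA _.
apply/esym; apply: (@lebesgue_measure_unique _ (measure_function_pushforward__canonical__measure_function_Measure
  (@lebesgue_measure R) mg)) => // _ [[b c]] _ <- /=.
rewrite /pushforward (_ : g @^-1` _ = `](b - a)%R, (c - a)%R]%classic).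
  by rewrite !lebesgue_measure_itv/= !lte_fin ltrD2r -!EFinB opprB addrA subrK.
apply/seteqP; split => x; rewrite /= /g !in_itv/= => /andP[h1 h2]; apply/andP; split; lra.
Qed.

Lemma ge0_integral1N (f : measurableTypeR R -> \bar R) : measurable_fun setT f ->
  (forall x, 0 <= f x) ->
  \int[lebesgue_measure]_x f (- x)%R = \int[@lebesgue_measure R]_x f x.
Proof.
move=> mf f0; pose g (x : measurableTypeR R) : measurableTypeR R := (- x)%R.
have mg : measurable_fun setT g by exact: oppr_measurable.
transitivity (\int[pushforward (@lebesgue_measure R) g]_x f x).
  have := @ge0_integral_pushforward _ _ _ _ _ g mg (@lebesgue_measure R) setT f
    measurableT mf (fun y _ => f0 y).
  by rewrite preimage_setT => ->.
apply: (@eq_measure_integral _ _ _ _ (@lebesgue_measure R)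
  (measure_function_pushforward__canonical__measure_function_Measure
    (@lebesgue_measure R) mg)) => A mA _.
exact: lebesgue_measureN.
Qed.

Lemma ge0_integralRnN n (f : Rn R n -> \bar R) : measurable_fun setT f ->
  (forall x, 0 <= f x) ->
  \int[lebesgueRn R n]_x f (tneg x) = \int[lebesgueRn R n]_x f x.
Proof.
elim: n f => [|n IHn] f mf f0.
  rewrite !integralRn0//; last by apply: measurableT_comp => //; exact: measurable_tneg.
  by congr f; rewrite tuple0.
have mfN := measurableT_comp mf (@measurable_tneg R n.+1).
rewrite [LHS](ge0_integralRnS mfN (fun=> f0 _)) [RHS](ge0_integralRnS mf f0).
pose g (a : measurableTypeR R) := \int[lebesgueRn R n]_y f (consRn (a, y)).
have mfc := measurableT_comp mf (@measurable_consRn R n).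
rewrite -[RHS](ge0_integral1N (f := g)); last 2 first.
- exact: (measurable_fun_fubini_tonelli_F (m2 := lebesgueRn R n) (f \o @consRn R n) mfc (fun=> f0 _)).
- by move=> a; exact: integral_ge0.
apply: eq_integral => a _; rewrite /g -[RHS]IHn//; last first.
  exact: (measurableT_comp mfc (pair1_measurable _)).
by apply: eq_integral => y _; rewrite /= tneg_cons.
Qed.

Lemma measurable_tadd1 n (v : Rn R n) : measurable_fun setT (tadd v).
Proof. exact: (measurableT_comp (@measurable_tadd R n) (pair1_measurable v)). Qed.

Lemma ge0_integralRnD n (f : Rn R n -> \bar R) (v : Rn R n) : measurable_fun setT f ->
  (forall x, 0 <= f x) ->
  \int[lebesgueRn R n]_x f (tadd v x) = \int[lebesgueRn R n]_x f x.
Proof.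
elim: n f v => [|n IHn] f v mf f0.
  rewrite !integralRn0//; last by apply: measurableT_comp => //; exact: measurable_tadd1.
  by congr f; rewrite tuple0.
have [[b w] ->] := consRnP v.
have mfD := measurableT_comp mf (measurable_tadd1 (consRn (b, w))).
rewrite [LHS](ge0_integralRnS mfD (fun=> f0 _)) [RHS](ge0_integralRnS mf f0).
pose g (a : measurableTypeR R) := \int[lebesgueRn R n]_y f (consRn (a, y)).
have mfc := measurableT_comp mf (@measurable_consRn R n).
rewrite -[RHS](ge0_integral1D (f := g) b); last 2 first.
- exact: (measurable_fun_fubini_tonelli_F (m2 := lebesgueRn R n) (f \o @consRn R n) mfc (fun=> f0 _)).
- by move=> a; exact: integral_ge0.
apply: eq_integral => a _; rewrite /g -[RHS](IHn _ w)//; last first.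
  exact: (measurableT_comp mfc (pair1_measurable _)).
by apply: eq_integral => y _; rewrite /= tadd_cons.
Qed.

Lemma integralRnN n (f : Rn R n -> \bar R) : measurable_fun setT f ->
  \int[lebesgueRn R n]_x f (tneg x) = \int[lebesgueRn R n]_x f x.
Proof.
move=> mf; rewrite integralE [RHS]integralE.
rewrite (funepos_comp f (@tneg R n)) (funeneg_comp f (@tneg R n)); congr (_ - _).
  by rewrite -[RHS]ge0_integralRnN//; exact: measurable_funepos.
by rewrite -[RHS]ge0_integralRnN//; exact: measurable_funeneg.
Qed.

Lemma integralRnD n (f : Rn R n -> \bar R) v : measurable_fun setT f ->
  \int[lebesgueRn R n]_x f (tadd v x) = \int[lebesgueRn R n]_x f x.
Proof.
move=> mf; rewrite integralE [RHS]integralE.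
rewrite (funepos_comp f (tadd v)) (funeneg_comp f (tadd v)); congr (_ - _).
  by rewrite -[RHS](ge0_integralRnD v)//; exact: measurable_funepos.
by rewrite -[RHS](ge0_integralRnD v)//; exact: measurable_funeneg.
Qed.

End Rn_integral.

(** * Poisson kernels *)

Lemma mEFin d (T : measurableType d) (R : realType) (D : set T) (f : T -> R) :
  measurable_fun D f -> measurable_fun D (fun x => (f x)%:E).
Proof. by move=> mf; apply/measurable_EFinP. Qed.

Section poisson1.
Variable R : realType.
Implicit Types (e z x : R).

(** By parity an antiderivative is required on the half-line only; [g] is the
    formula that [f] has there, where absolute values disappear. *)
Lemma ge0_integral_even (f g F : R -> R) (l : R) :
  (forall x, 0 <= f x) -> continuous f -> (forall x, f (- x) = f x) ->
  (forall x, 0 <= x -> f x = g x) ->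
  (forall x, derivable F x (1 : R)) -> (forall x, derive1 F x = g x) -> F x @[x --> +oo] --> l ->
  (\int[lebesgue_measure]_x (f x)%:E = (2 * (l - F 0))%:E)%E.
Proof.
move=> f0 cf fN fg dF F' Fl.
rewrite ge0_symfun_integralT//; last by move=> x /=; rewrite fN.
rewrite EFinM; congr (_ * _)%E.
rewrite -set_itvcy EFinB (@ge0_continuous_FTC2y R f F 0 l)//.
- exact: continuous_subspaceT.
- by apply/cvg_at_right_filter/differentiable_continuous/derivable1_diffP.
- by move=> x; rewrite in_itv/= andbT => x0; rewrite F' fg// ltW.
Qed.

Lemma is_derive_scale (c x : R) (f : R -> R) df : is_derive (c * x) (1 : R) f df ->
  is_derive x (1 : R) (fun y : R => f (c * y)) (c * df).
Proof.
move=> h; rewrite mulrC; apply: (@is_derive1_comp R f ( *%R c) x df c h).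
have -> : *%R c = c \*: (@id R) by [].
by apply: is_derive_eq; rewrite /GRing.scale/= mulr1.
Qed.

(** The Fourier transform of [exp (- e |x|)]. The summand 1 makes the
    integrand nonnegative, so that the fundamental theorem of calculus on a
    half-line applies; it is subtracted in [integral_exp_cos1]. *)
Lemma integral_exp_cos e z : 0 < e ->
  (\int[lebesgue_measure]_x (expR (- (e * `|x|)) * (1 + cos (z * x)))%:E =
   (2 / e + 2 * e / (e ^+ 2 + z ^+ 2))%:E)%E.
Proof.
move=> e0; have ez0 : e ^+ 2 + z ^+ 2 != 0.
  by rewrite gt_eqF// ltr_pwDl ?sqr_ge0// exprn_gt0.
pose c := (e ^+ 2 + z ^+ 2)^-1.
pose E (x : R) := expR (- e * x).
pose S (x : R) := sin (z * x).
pose C (x : R) := cos (z * x).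
pose F : R -> R := E * (((z * c) \*: S) - ((e * c) \*: C) - cst (e^-1)).
have dF x : is_derive x (1 : R) F (expR (- e * x) * (1 + cos (z * x))).
  have d1 : is_derive x (1 : R) E _ := is_derive_scale (is_derive_expR (- e * x)).
  have d2 : is_derive x (1 : R) S _ := is_derive_scale (is_derive_sin (z * x)).
  have d3 : is_derive x (1 : R) C _ := is_derive_scale (is_derive_cos (z * x)).
  rewrite /F; apply: is_derive_eq.
  rewrite -[LHS]/(expR (- e * x) * (z * c * (z * cos (z * x)) -
    e * c * (z * - sin (z * x)) - 0) + (z * c * sin (z * x) - e * c * cos (z * x) -
    e^-1) * (- e * expR (- e * x))) /c; field.
  by rewrite ez0 gt_eqF.
have Fl : F x @[x --> +oo] --> 0.
  pose M := (`|z| + e) * c + e^-1.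
  have c0 : 0 < c by rewrite invr_gt0 ltr_pwDl ?sqr_ge0// exprn_gt0.
  have cE : expR (- (e * x)) * M @[x --> +oo] --> 0.
    rewrite -(mul0r M); apply: cvgM; last exact: cvg_cst.
    apply: (@cvg_comp _ _ _ (fun x => e * x) (fun x => expR (- x)) _ +oo); last exact: cvgr_expR.
    by apply: gt0_cvgMry => //; exact: cvg_id.
  have cE' : - (expR (- (e * x)) * M) @[x --> +oo] --> 0.
    by rewrite -oppr0; exact: cvgN.
  apply: squeeze_cvgr cE' cE; apply: nearW => x.
  rewrite -ler_norml /F.
  rewrite -[X in `|X|]/(expR (- e * x) * (z * c * sin (z * x) - e * c * cos (z * x) - e^-1)).
  rewrite normrM ger0_norm ?expR_ge0// mulNr ler_wpM2l ?expR_ge0//.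
  rewrite (le_trans (ler_normB _ _))// /M lerD//; last by rewrite ger0_norm// invr_ge0 ltW.
  rewrite (le_trans (ler_normB _ _))// mulrDl lerD// normrM.
    by rewrite normrM (gtr0_norm c0) ler_piMr// ?sin_max// mulr_ge0// ltW.
  by rewrite gtr0_norm ?mulr_gt0// ler_piMr// ?cos_max// mulr_ge0// ltW.
rewrite (@ge0_integral_even _ (fun x => expR (- e * x) * (1 + cos (z * x))) F 0).
- congr EFin; rewrite /F !fctE /cst /= /E /S /C /c !mulr0 expR0 sin0 cos0 /GRing.scale/=; field.
  by rewrite ez0 gt_eqF.
- move=> x; rewrite mulr_ge0 ?expR_ge0//; have := cos_geN1 (z * x); lra.
- move=> x; apply: cvgM.
    apply: continuous_comp; last exact: continuous_expR.
    apply: cvgN; apply: cvgMr; exact: norm_continuous.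
  apply: cvgD; first exact: cvg_cst.
  apply: continuous_comp; last exact: continuous_cos.
  by apply: cvgMr; exact: cvg_id.
- by move=> x; rewrite normrN mulrN cosN.
- by move=> x x0; rewrite ger0_norm// mulNr.
- by move=> x; exact: ex_derive.
- by move=> x; rewrite derive1E derive_val.
- by [].
Qed.

Lemma measurable_exp_abs e : measurable_fun setT (fun a : measurableTypeR R => expR (- (e * `|a : R|))).
Proof.
apply: continuous_measurable_fun => x.
apply: continuous_comp; last exact: continuous_expR.
by apply: cvgN; apply: cvgM; [exact: cvg_cst|exact: norm_continuous].
Qed.

Lemma integral_exp_cos0 e : 0 < e ->
  (\int[lebesgue_measure]_x (expR (- (e * `|x|)))%:E = (2 / e)%:E)%E.
Proof.
move=> e0; have := integral_exp_cos 0 e0.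
under eq_integral do rewrite mul0r cos0 mulrC EFinM.
rewrite ge0_integralZl//.
rewrite (_ : 2 / e + _ = 2 * (2 / e)); last by field; rewrite gt_eqF.
rewrite EFinM => /(congr1 (fun y => (2^-1)%:E * y)%E).
rewrite -[(1 + 1)%R]/(2 : R) !muleA -!EFinM.
by rewrite mulVf// mul1e mul1r.
exact: mEFin (measurable_exp_abs e).
Qed.

Lemma integral_cauchy e : 0 < e ->
  (\int[lebesgue_measure]_x (2 * e / (e ^+ 2 + x ^+ 2))%:E = (2 * pi)%:E)%E.
Proof.
move=> e0.
have ez0 x : e ^+ 2 + x ^+ 2 != 0.
  by rewrite gt_eqF// ltr_pwDl ?sqr_ge0// exprn_gt0.
have dF x : is_derive x (1 : R) (2 \*: (fun y => atan (e^-1 * y))) (2 * e / (e ^+ 2 + x ^+ 2)).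
  have d1 := is_derive_scale (is_derive1_atan (e^-1 * x)).
  apply: is_derive_eq; rewrite /GRing.scale/=; field.
  by rewrite ez0 gt_eqF//= addrC -exprMn addrC ez0.
rewrite (@ge0_integral_even _ (fun x => 2 * e / (e ^+ 2 + x ^+ 2)) (2 \*: (fun y => atan (e^-1 * y))) pi).
- by congr EFin; rewrite -[X in _ - X]/(2 * atan (e^-1 * 0)) mulr0 atan0 mulr0 subr0.
- by move=> x; rewrite divr_ge0 ?mulr_ge0 ?addr_ge0 ?sqr_ge0// ltW.
- move=> x; apply: cvgM; first exact: cvg_cst.
  apply: cvgV => //; apply: cvgD; first exact: cvg_cst.
  exact: exprn_continuous.
- by move=> x; rewrite sqrrN.
- by [].
- by move=> x; exact: ex_derive.
- by move=> x; rewrite derive1E derive_val.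
- rewrite (_ : pi = 2 * (pi / 2) :> R); last by field.
  apply: cvgM; first exact: cvg_cst.
  apply: (@cvg_comp _ _ _ (fun x => e^-1 * x) (@atan R) _ +oo); last exact: cvgy_atan.
  by apply: gt0_cvgMry; [rewrite invr_gt0|exact: cvg_id].
Qed.

(** The Poisson integral of an interval is explicit, and so is its limit as
    [e] tends to 0; inversion on boxes rests on this. *)
Lemma integral_cauchy_itv e x a b : 0 < e -> a < b ->
  (\int[lebesgue_measure]_(y in `]a, b]) (2 * e / (e ^+ 2 + (x - y) ^+ 2))%:E =
   (2 * (atan ((b - x) / e) - atan ((a - x) / e)))%:E)%E.
Proof.
move=> e0 ab.
have ez0 y : e ^+ 2 + (x - y) ^+ 2 != 0.
  by rewrite gt_eqF// ltr_pwDl ?sqr_ge0// exprn_gt0.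
pose G (y : R) := (e^-1) * (y - x).
have dF y : is_derive y (1 : R) (2 \*: (@atan R \o G)) (2 * e / (e ^+ 2 + (x - y) ^+ 2)).
  have dG : is_derive y (1 : R) G (e^-1).
    have -> : G = e^-1 \*: (@id R - cst x) by [].
    by apply: is_derive_eq; rewrite /GRing.scale/= subr0 mulr1.
  have d1 := @is_derive1_comp R atan G y _ _ (is_derive1_atan (G y)) dG.
  have en0 : e != 0 by rewrite gt_eqF.
  have -> : 2 * e / (e ^+ 2 + (x - y) ^+ 2) = 2 * ((1 + G y ^+ 2)^-1 / e).
    rewrite (_ : 1 + G y ^+ 2 = (e ^+ 2 + (x - y) ^+ 2) / e ^+ 2); last by rewrite /G; field.
    by field; rewrite en0 ez0.
  by apply: is_derive_eq.
have cf : continuous (fun y => 2 * e / (e ^+ 2 + (x - y) ^+ 2)).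
  move=> y; apply: cvgM; first exact: cvg_cst.
  apply: cvgV => //; apply: cvgD; first exact: cvg_cst.
  apply: (@continuous_comp _ _ _ (fun y => x - y) (fun y => y ^+ 2)).
    by apply: cvgB; [exact: cvg_cst|exact: cvg_id].
  exact: exprn_continuous.
rewrite integral_itv_obnd_cbnd; last first.
  by apply: mEFin; apply: measurable_funTS; exact: continuous_measurable_fun.
rewrite (@continuous_FTC2 _ _ (2 \*: (@atan R \o G)))//.
- by rewrite -EFinB -[X in X%:E = _]/(2 * atan (e^-1 * (b - x)) - 2 * atan (e^-1 * (a - x)))
    -mulrBr ![e^-1 * _]mulrC.
- exact: continuous_subspaceT.
- have cF : continuous (2 \*: (@atan R \o G)).
    by move=> y; apply/differentiable_continuous/derivable1_diffP.
  by split; [move=> y _; exact: ex_derive|exact/cvg_at_right_filter/cF|exact/cvg_at_left_filter/cF].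
- by move=> y _; rewrite derive1E derive_val.
Qed.

End poisson1.

Section tensor.
Variable R : realType.
Local Open Scope ereal_scope.

Lemma dot_cons n (a b : R) (x y : Rn R n) :
  dot (consRn (a, x)) (consRn (b, y)) = (a * b + dot x y)%R.
Proof.
rewrite /dot big_ord_recl !tnth_consRn0; congr (_ + _)%R.
by apply: eq_bigr => i _; rewrite !tnth_consRnS.
Qed.

Lemma measurable_prod_coord n (f : 'I_n -> measurableTypeR R -> R) :
  (forall i, measurable_fun setT (f i)) ->
  measurable_fun setT (fun x : Rn R n => (\prod_(i < n) f i (tnth x i))%R).
Proof.
move=> mf; apply: measurable_prod => i _.
exact: (measurableT_comp (mf i) (@measurable_tnth _ _ n i)).
Qed.

Lemma ge0_integral_prod_coord n (f : 'I_n -> measurableTypeR R -> R) :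
  (forall i x, (0 <= f i x)%R) -> (forall i, measurable_fun setT (f i)) ->
  \int[lebesgueRn R n]_x (\prod_(i < n) f i (tnth x i))%:E =
  \prod_(i < n) \int[lebesgue_measure]_x (f i x)%:E.
Proof.
elim: n f => [|n IHn] f f0 mf.
  by rewrite integralRn0 ?big_ord0//; apply/measurable_EFinP; exact: measurable_prod_coord.
have m1 : measurable_fun setT (fun x : Rn R n => (\prod_(i < n) f (lift ord0 i) (tnth x i))%:E).
  by apply/measurable_EFinP; exact: (@measurable_prod_coord n (fun i => f (lift ord0 i))).
have p0 (y : Rn R n) : 0 <= (\prod_(i < n) f (lift ord0 i) (tnth y i))%:E.
  by rewrite lee_fin prodr_ge0.
rewrite ge0_integralRnS; last 2 first.
- by apply/measurable_EFinP; exact: measurable_prod_coord.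
- by move=> x; rewrite lee_fin prodr_ge0.
rewrite big_ord_recl -(IHn (fun i => f (lift ord0 i)))//.
rewrite -ge0_integralZr//; last 3 first.
- by apply: mEFin; exact: mf.
- by move=> x _; rewrite lee_fin.
- exact: integral_ge0.
apply: eq_integral => a _.
rewrite -ge0_integralZl//; last by rewrite lee_fin.
apply: eq_integral => y _; rewrite big_ord_recl tnth_consRn0 -EFinM; congr (_ * _)%:E.
by apply: eq_bigr => i _; rewrite tnth_consRnS.
Qed.

Lemma integralRnS n (f : Rn R n.+1 -> \bar R) :
  (lebesgueRn R n.+1).-integrable setT f ->
  \int[lebesgueRn R n.+1]_x f x =
  \int[lebesgue_measure]_a \int[lebesgueRn R n]_y f (consRn (a, y)).
Proof.
move=> fi; have mf := measurable_int _ fi.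
have mfc := measurableT_comp mf (@measurable_consRn R n).
have fi' : (lebesgue_measure \x lebesgueRn R n).-integrable setT (f \o @consRn R n).
  apply/integrableP; split => //.
  move/integrableP : fi => [_]; rewrite ge0_integralRnS//; last exact: measurableT_comp.
  rewrite (fubini_tonelli1 (abse \o (f \o @consRn R n)))//.
    exact: measurableT_comp.
  by move=> z; exact: abse_ge0.
have -> : \int[lebesgueRn R n.+1]_x f x =
    \int[pushforward (lebesgue_measure \x lebesgueRn R n) (@consRn R n)]_x f x.
  by apply: (@eq_measure_integral _ _ _ _
    (measure_function_pushforward__canonical__measure_function_Measure
      (lebesgue_measure \x lebesgueRn R n) (@measurable_consRn R n))).
rewrite integral_pushforward ?preimage_setT//; last exact: measurable_consRn.
by rewrite -(integral12_prod_meas1 fi').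
Qed.

Lemma integrable_bound d (T : measurableType d) (mu : {measure set T -> \bar R}) (f g : T -> R) :
  measurable_fun setT f -> mu.-integrable setT (EFin \o g) ->
  (forall x, `|f x| <= g x)%R -> mu.-integrable setT (EFin \o f).
Proof.
move=> mf gi fg; apply: le_integrable gi => //; first exact/measurable_EFinP.
by move=> x _ /=; rewrite lee_fin (le_trans (fg x))// ler_norm.
Qed.

Lemma integral_odd n (f : Rn R n -> R) : (lebesgueRn R n).-integrable setT (EFin \o f) ->
  (forall x, f (tneg x) = - f x)%R -> \int[lebesgueRn R n]_x (f x)%:E = 0.
Proof.
move=> fi fN.
have ffin := integrable_fin_num measurableT fi.
have : \int[lebesgueRn R n]_x (f x)%:E = - \int[lebesgueRn R n]_x (f x)%:E.
  rewrite -{1}(integralRnN (measurable_int _ fi)) -integralN//=.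
    by apply: eq_integral => x _ /=; rewrite fN.
  exact: integrable_add_def.
rewrite /= -(fineK ffin) -EFinN => -[] h; congr EFin; move: h.
move: (fine _) => w; lra.
Qed.

End tensor.

Section poissonn.
Variables (R : realType) (n : nat).
Implicit Types (e : R) (x y z xi : Rn R n).
Local Notation mu := (lebesgueRn R n).

(** A product over the coordinates, that is [exp (- e |xi|_1)]: its transform
    [KP e] is again a product, obtained from one-dimensional integrals, and
    both are nonnegative with a known mass. *)
Definition kP e xi : R := \prod_(i < n) expR (- (e * `|tnth xi i : R|)).
Definition KP e z : R := \prod_(i < n) (2 * e / (e ^+ 2 + (tnth z i : R) ^+ 2)).

Lemma kP_ge0 e xi : 0 <= kP e xi.
Proof. by apply: prodr_ge0 => i _; exact: expR_ge0. Qed.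

Lemma KP_ge0 e z : 0 <= e -> 0 <= KP e z.
Proof. by move=> e0; apply: prodr_ge0 => i _; rewrite divr_ge0 ?mulr_ge0 ?addr_ge0 ?sqr_ge0. Qed.

Lemma kPN e xi : kP e (tneg xi) = kP e xi.
Proof. by apply: eq_bigr => i _; rewrite tnth_mktuple normrN. Qed.

Lemma kP_le1 e xi : 0 <= e -> kP e xi <= 1.
Proof.
by move=> e0; apply: prodr_ile1 => i _; rewrite expR_ge0 expR_le1 oppr_le0 mulr_ge0.
Qed.

Lemma measurable_kP e : measurable_fun setT (kP e).
Proof.
apply: (@measurable_prod_coord _ n (fun _ a => expR (- (e * `|a|)))) => i.
apply: continuous_measurable_fun => x.
apply: continuous_comp; last exact: continuous_expR.
by apply: cvgN; apply: cvgM; [exact: cvg_cst|exact: norm_continuous].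
Qed.

Lemma measurable_KP1 e : 0 < e ->
  measurable_fun setT (fun a : measurableTypeR R => 2 * e / (e ^+ 2 + (a : R) ^+ 2)).
Proof.
move=> e0; apply: continuous_measurable_fun => x.
apply: cvgM; first exact: cvg_cst.
apply: cvgV; first by rewrite gt_eqF// ltr_pwDl ?sqr_ge0// exprn_gt0.
apply: cvgD; first exact: cvg_cst.
exact: exprn_continuous.
Qed.

Lemma measurable_KP e : 0 < e -> measurable_fun setT (KP e).
Proof.
move=> e0; apply: (@measurable_prod_coord _ n (fun _ a => 2 * e / (e ^+ 2 + a ^+ 2))) => i.
exact: measurable_KP1.
Qed.

Lemma prod_EFin (f : 'I_n -> R) :
  (\prod_(i < n) (f i)%:E)%E = (\prod_(i < n) f i)%:E.
Proof. by apply/esym/(big_morph _ EFinM). Qed.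

Lemma integral_kP e : 0 < e -> (\int[mu]_x (kP e x)%:E = ((2 / e) ^+ n)%:E)%E.
Proof.
move=> e0; rewrite (ge0_integral_prod_coord (f := fun _ a => expR (- (e * `|a|)))).
- under eq_bigr do rewrite integral_exp_cos0//.
  by rewrite prod_EFin prodr_const card_ord.
- by move=> i x; exact: expR_ge0.
move=> i; apply: continuous_measurable_fun => x.
apply: continuous_comp; last exact: continuous_expR.
by apply: cvgN; apply: cvgM; [exact: cvg_cst|exact: norm_continuous].
Qed.

Lemma integral_KP e : 0 < e -> (\int[mu]_x (KP e x)%:E = ((2 * pi) ^+ n)%:E)%E.
Proof.
move=> e0; rewrite (ge0_integral_prod_coord (f := fun _ a => 2 * e / (e ^+ 2 + a ^+ 2))).
- under eq_bigr do rewrite integral_cauchy//.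
  by rewrite prod_EFin prodr_const card_ord.
- by move=> i x; rewrite divr_ge0 ?mulr_ge0 ?addr_ge0 ?sqr_ge0// ltW.
by move=> i; exact: measurable_KP1.
Qed.

Lemma integrable_kP e : 0 < e -> mu.-integrable setT (EFin \o kP e).
Proof.
move=> e0; apply/integrableP; split; first by apply/measurable_EFinP; exact: measurable_kP.
under eq_integral do rewrite /= ger0_norm ?kP_ge0//.
by rewrite integral_kP// ltry.
Qed.

Lemma measurable_dot x : measurable_fun setT (fun xi => dot x xi).
Proof.
rewrite /dot; apply: measurable_sum => i.
by apply: measurable_funM => //; exact: measurable_coord.
Qed.

Lemma measurable_dot2 : measurable_fun setT (fun p : Rn R n * Rn R n => dot p.1 p.2).
Proof.
rewrite /dot; apply: measurable_sum => i.
apply: measurable_funM.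
  exact: (measurableT_comp (@measurable_coord R n i) measurable_fst).
exact: (measurableT_comp (@measurable_coord R n i) measurable_snd).
Qed.

Lemma dotNr x y : dot x (tneg y) = - dot x y.
Proof. by rewrite /dot -sumrN; apply: eq_bigr => i _; rewrite tnth_mktuple mulrN. Qed.

Lemma dotC x y : dot x y = dot y x.
Proof. by apply: eq_bigr => i _; rewrite mulrC. Qed.

Lemma dotNl x y : dot (tneg x) y = - dot x y.
Proof. by rewrite dotC dotNr dotC. Qed.

Lemma dotDr x y z : dot x (tadd y z) = dot x y + dot x z.
Proof. by rewrite /dot -big_split; apply: eq_bigr => i _; rewrite tnth_mktuple mulrDr. Qed.

Lemma dotDl x y z : dot (tadd y z) x = dot y x + dot z x.
Proof. by rewrite dotC dotDr !(dotC x). Qed.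

Lemma measurable_cos : measurable_fun setT (@cos R).
Proof. apply: continuous_measurable_fun; exact: continuous_cos. Qed.

Lemma measurable_sin : measurable_fun setT (@sin R).
Proof. apply: continuous_measurable_fun; exact: continuous_sin. Qed.

Lemma integrable_kP_cos e z : 0 < e ->
  mu.-integrable setT (EFin \o (fun xi => kP e xi * cos (dot z xi))).
Proof.
move=> e0; apply: integrable_bound (integrable_kP e0) _.
  apply: measurable_funM; first exact: measurable_kP.
  exact: (measurableT_comp measurable_cos (measurable_dot z)).
by move=> x; rewrite normrM ger0_norm ?kP_ge0// ler_piMr ?kP_ge0// cos_max.
Qed.

Lemma integrable_kP_sin e z : 0 < e ->
  mu.-integrable setT (EFin \o (fun xi => kP e xi * sin (dot z xi))).
Proof.
move=> e0; apply: integrable_bound (integrable_kP e0) _.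
  apply: measurable_funM; first exact: measurable_kP.
  exact: (measurableT_comp measurable_sin (measurable_dot z)).
by move=> x; rewrite normrM ger0_norm ?kP_ge0// ler_piMr ?kP_ge0// sin_max.
Qed.

Lemma integral_kP_sin e z : 0 < e ->
  (\int[mu]_xi (kP e xi * sin (dot z xi))%:E = 0)%E.
Proof.
move=> e0; apply: integral_odd; first exact: integrable_kP_sin.
by move=> x; rewrite kPN dotNr sinN mulrN.
Qed.

End poissonn.

Section poisson_cos.
Variable R : realType.
Implicit Types e : R.

Lemma kP_cons n e (a : R) (x : Rn R n) :
  kP e (consRn (a, x)) = expR (- (e * `|a|)) * kP e x.
Proof.
rewrite /kP big_ord_recl tnth_consRn0; congr (_ * _).
by apply: eq_bigr => i _; rewrite tnth_consRnS.
Qed.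

Lemma KP_cons n e (a : R) (x : Rn R n) :
  KP e (consRn (a, x)) = 2 * e / (e ^+ 2 + a ^+ 2) * KP e x.
Proof.
rewrite /KP big_ord_recl tnth_consRn0; congr (_ * _).
by apply: eq_bigr => i _; rewrite tnth_consRnS.
Qed.

Lemma integrable_exp_abs e : 0 < e ->
  (@lebesgue_measure R).-integrable setT (EFin \o (fun a => expR (- (e * `|a|)))).
Proof.
move=> e0; apply/integrableP; split; first exact: mEFin (measurable_exp_abs e).
under eq_integral do rewrite /= ger0_norm ?expR_ge0//.
by rewrite integral_exp_cos0// ltry.
Qed.

Lemma integrable_exp_cos e z : 0 < e ->
  (@lebesgue_measure R).-integrable setT (EFin \o (fun a => expR (- (e * `|a|)) * cos (z * a))).
Proof.
move=> e0; apply: integrable_bound (integrable_exp_abs e0) _.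
  apply: measurable_funM; first exact: measurable_exp_abs.
  apply: continuous_measurable_fun => x.
  apply: continuous_comp; last exact: continuous_cos.
  by apply: cvgM; [exact: cvg_cst|exact: cvg_id].
by move=> x; rewrite normrM ger0_norm ?expR_ge0// ler_piMr ?expR_ge0// cos_max.
Qed.

Lemma integral_exp_cos1 e z : 0 < e ->
  (\int[lebesgue_measure]_x (expR (- (e * `|x|)) * cos (z * x))%:E =
   (2 * e / (e ^+ 2 + z ^+ 2))%:E)%E.
Proof.
move=> e0.
have i1 := integrable_exp_abs e0.
have i2 := integrable_exp_cos z e0.
have := integral_exp_cos z e0.
under eq_integral do rewrite mulrDr mulr1 EFinD.
rewrite integralD// integral_exp_cos0// => h.
have f2 := integrable_fin_num measurableT i2.
move: h; rewrite -(fineK f2) -EFinD => -[] /addrI h.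
by rewrite -h.
Qed.

(** By induction on the dimension, with the addition formula for the cosine;
    the sine terms vanish by oddness. *)
Lemma integral_kP_cos n e (z : Rn R n) : 0 < e ->
  (\int[lebesgueRn R n]_xi (kP e xi * cos (dot z xi))%:E = (KP e z)%:E)%E.
Proof.
move=> e0; elim: n z => [|n IHn] z.
  rewrite integralRn0; last exact: measurable_int (integrable_kP_cos z e0).
  by rewrite /kP /KP /dot !big_ord0 cos0 mulr1.
have [[b w] ->] := consRnP z.
rewrite integralRnS; last exact: integrable_kP_cos.
rewrite KP_cons EFinM -(integral_exp_cos1 b e0) -(IHn w).
rewrite IHn -(integralZr measurableT (integrable_exp_cos b e0)) -IHn.
apply: eq_integral => a _.
have ic := integrable_kP_cos w e0.
have isn := integrable_kP_sin w e0.
transitivity (\int[lebesgueRn R n]_y ((expR (- (e * `|a|)) * cos (b * a))%:E * (kP e y * cos (dot w y))%:E -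
  (expR (- (e * `|a|)) * sin (b * a))%:E * (kP e y * sin (dot w y))%:E)%E)%E.
  apply: eq_integral => y _; rewrite dot_cons cosD kP_cons -!EFinM -EFinB; congr EFin.
  ring.
rewrite integralB//=; last 2 first.
- exact: integrableZl.
- exact: integrableZl.
by rewrite !integralZl//= integral_kP_sin// mule0 sube0.
Qed.

End poisson_cos.

(** * The space of square-integrable functions *)

Section L2.
Context d (T : measurableType d) (R : realType) (mu : {measure set T -> \bar R}).
Implicit Types (f g : T -> R).

(** The squared norm in the extended reals, available before
    square-integrability is known; [norm2] is meant for square-integrable
    functions. *)
Definition sqnorm f : \bar R := (\int[mu]_x (f x ^+ 2)%:E)%E.
Definition norm2 f : R := fine ('N[mu]_2%:E[EFin \o f])%E.

Lemma sqn_ge0 f : (0 <= sqnorm f)%E.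
Proof. by apply: integral_ge0 => x _; rewrite lee_fin sqr_ge0. Qed.

Lemma Lnorm2E f : ('N[mu]_2%:E[EFin \o f] = sqnorm f `^ 2^-1)%E.
Proof.
rewrite unlock /sqnorm; congr (_ `^ _)%E; apply: eq_integral => x _.
by rewrite /= powR_mulrn ?normr_ge0// real_normK ?num_real.
Qed.

Lemma L2_measurable f : f \in Lfun mu 2%:E -> measurable_fun setT f.
Proof. by rewrite inE => /andP[]; rewrite inE. Qed.

Lemma L2P f : f \in Lfun mu 2%:E <-> measurable_fun setT f /\ (sqnorm f < +oo)%E.
Proof.
split=> [fL|[mf fo]].
  split; first exact: L2_measurable.
  move/Lfun2_integrable_sqr/integrableP : fL => [_].
  by under eq_integral do rewrite /= ger0_norm ?sqr_ge0//.
rewrite inE; apply/andP; split; rewrite inE//=.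
by rewrite /finite_norm Lnorm2E poweR_lty.
Qed.

Lemma n2_ge0 f : 0 <= norm2 f.
Proof. by rewrite fine_ge0// Lnorm_ge0. Qed.

Lemma n2K f : f \in Lfun mu 2%:E -> ('N[mu]_2%:E[EFin \o f] = (norm2 f)%:E)%E.
Proof.
rewrite inE => /andP[_]; rewrite inE /= /finite_norm => h.
by rewrite /norm2 fineK// ge0_fin_numE ?Lnorm_ge0.
Qed.

Lemma sqnE f : f \in Lfun mu 2%:E -> sqnorm f = (norm2 f ^+ 2)%:E.
Proof.
move=> fL; have := n2K fL; rewrite Lnorm2E => h.
have /(congr1 (fun y => (y `^ 2)%E)) := h.
rewrite -poweRrM mulVf// poweRe1 ?sqn_ge0// => ->.
by rewrite poweR_EFin powR_mulrn ?n2_ge0.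
Qed.

Lemma n2_sqrt f : norm2 f = Num.sqrt (fine (sqnorm f)).
Proof.
rewrite /norm2 Lnorm2E; have := sqn_ge0 f; case: (sqnorm f) => [r||]//= r0.
  by rewrite powR12_sqrt.
by rewrite invr_eq0 pnatr_eq0/= sqrtr0.
Qed.

Lemma L2_lin (a : R) f g : f \in Lfun mu 2%:E -> g \in Lfun mu 2%:E ->
  (fun x => a * f x + g x) \in Lfun mu 2%:E.
Proof.
have /Lfun_submod_closed h : (1 <= 2%:E :> \bar R)%E by rewrite lee1n.
by have [_ {}h] := h _ _ mu; exact: h.
Qed.

Lemma L2_0 : (fun=> 0) \in Lfun mu 2%:E.
Proof.
have /Lfun_submod_closed h : (1 <= 2%:E :> \bar R)%E by rewrite lee1n.
by have [] := h _ _ mu.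
Qed.

Lemma L2D f g : f \in Lfun mu 2%:E -> g \in Lfun mu 2%:E ->
  (fun x => f x + g x) \in Lfun mu 2%:E.
Proof. by move=> fL gL; have := L2_lin 1 fL gL; under eq_fun do rewrite mul1r. Qed.

Lemma L2Z (a : R) f : f \in Lfun mu 2%:E -> (fun x => a * f x) \in Lfun mu 2%:E.
Proof. by move=> fL; have := L2_lin a fL L2_0; under eq_fun do rewrite addr0. Qed.

Lemma L2N f : f \in Lfun mu 2%:E -> (fun x => - f x) \in Lfun mu 2%:E.
Proof. by move/(L2Z (-1)); under eq_fun do rewrite mulN1r. Qed.

Lemma L2B f g : f \in Lfun mu 2%:E -> g \in Lfun mu 2%:E ->
  (fun x => f x - g x) \in Lfun mu 2%:E.
Proof. by move=> fL gL; exact: L2D fL (L2N gL). Qed.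

Lemma n2D f g : f \in Lfun mu 2%:E -> g \in Lfun mu 2%:E ->
  norm2 (fun x => f x + g x) <= norm2 f + norm2 g.
Proof.
move=> fL gL; rewrite -lee_fin EFinD -(n2K (L2D fL gL)) -!n2K//.
by apply: minkowski_EFin; [exact: L2_measurable|exact: L2_measurable|rewrite ler1n].
Qed.

Lemma n2Z (a : R) f : f \in Lfun mu 2%:E -> norm2 (fun x => a * f x) = `|a| * norm2 f.
Proof.
move=> fL; apply/eqP; rewrite -(@eqrXn2 _ 2)// ?mulr_ge0 ?n2_ge0//.
apply/eqP/EFin_inj; rewrite -sqnE; last exact: L2Z.
rewrite exprMn EFinM -(sqnE fL) /sqnorm -ge0_integralZl//.
- by apply: eq_integral => x _; rewrite exprMn EFinM real_normK ?num_real.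
- by apply: mEFin; apply: measurable_funX; exact: L2_measurable.
by move=> x _; rewrite lee_fin sqr_ge0.
Qed.

Lemma n2N f : norm2 (fun x => - f x) = norm2 f.
Proof. by rewrite !n2_sqrt /sqnorm; under eq_integral do rewrite sqrrN. Qed.

Lemma n2B f g : f \in Lfun mu 2%:E -> g \in Lfun mu 2%:E ->
  norm2 (fun x => f x - g x) <= norm2 f + norm2 g.
Proof. by move=> fL gL; rewrite -(n2N g); exact: n2D fL (L2N gL). Qed.

Lemma n2BC f g : norm2 (fun x => f x - g x) = norm2 (fun x => g x - f x).
Proof. by rewrite -n2N; congr norm2; apply/funext => x; rewrite opprB. Qed.

Lemma n2_triangle f g h : f \in Lfun mu 2%:E -> g \in Lfun mu 2%:E ->
  h \in Lfun mu 2%:E ->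
  norm2 (fun x => f x - h x) <= norm2 (fun x => f x - g x) + norm2 (fun x => g x - h x).
Proof.
move=> fL gL hL; have := n2D (L2B fL gL) (L2B gL hL).
by under [X in norm2 X <= _ -> _]eq_fun do rewrite addrA subrK.
Qed.

Lemma n2_0 : norm2 (fun=> 0) = 0.
Proof. by rewrite n2_sqrt /sqnorm; under eq_integral do rewrite expr0n; rewrite integral0 sqrtr0. Qed.

Lemma sqn_ae0 f : measurable_fun setT f -> sqnorm f = 0%E -> {ae mu, forall x, f x = 0}.
Proof.
move=> mf f0.
have mf2 : measurable_fun setT (fun x => (f x ^+ 2)%:E).
  by apply: mEFin; exact: measurable_funX.
have /(ae_eq_integral_abs mu measurableT mf2) : (\int[mu]_x `|(f x ^+ 2)%:E| = 0)%E.
  by rewrite -[RHS]f0; apply: eq_integral => x _; rewrite /= ger0_norm ?sqr_ge0.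
by apply: filterS => x /(_ I) [] /eqP; rewrite sqrf_eq0 => /eqP.
Qed.

Lemma n2_eq0 f : f \in Lfun mu 2%:E -> norm2 f = 0 -> {ae mu, forall x, f x = 0}.
Proof.
move=> fL f0; apply: sqn_ae0; first exact: L2_measurable.
by rewrite sqnE// f0 expr0n.
Qed.

Lemma sqn_ae f g : measurable_fun setT f -> measurable_fun setT g ->
  {ae mu, forall x, f x = g x} -> sqnorm f = sqnorm g.
Proof.
move=> mf mg fg; apply: ge0_ae_eq_integral => //.
- by apply: mEFin; exact: measurable_funX.
- by apply: mEFin; exact: measurable_funX.
- by move=> x _; rewrite lee_fin sqr_ge0.
- by move=> x _; rewrite lee_fin sqr_ge0.
by apply: filterS fg => x -> _.
Qed.

Lemma n2_ae f g : measurable_fun setT f -> measurable_fun setT g ->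
  {ae mu, forall x, f x = g x} -> norm2 f = norm2 g.
Proof. by move=> mf mg fg; rewrite !n2_sqrt (sqn_ae mf mg fg). Qed.

Lemma L2_ae f g : f \in Lfun mu 2%:E -> measurable_fun setT g ->
  {ae mu, forall x, f x = g x} -> g \in Lfun mu 2%:E.
Proof.
move=> /L2P[mf fo] mg fg; apply/L2P; split => //.
by rewrite -(sqn_ae mf mg fg).
Qed.

Lemma n2_ae0 f : measurable_fun setT f -> {ae mu, forall x, f x = 0} -> norm2 f = 0.
Proof. by move=> mf f0; rewrite (n2_ae mf _ f0) ?n2_0. Qed.

Lemma le_sqn f g : measurable_fun setT f -> measurable_fun setT g ->
  {ae mu, forall x, `|f x| <= `|g x|} -> (sqnorm f <= sqnorm g)%E.
Proof.
move=> mf mg fg; apply: ae_ge0_le_integral => //.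
- by move=> x _; rewrite lee_fin sqr_ge0.
- by apply: mEFin; exact: measurable_funX.
- by move=> x _; rewrite lee_fin sqr_ge0.
- by apply: mEFin; exact: measurable_funX.
apply: filterS fg => x h _; rewrite lee_fin.
by rewrite -[f x ^+ 2]real_normK ?num_real// -[g x ^+ 2]real_normK ?num_real// lerXn2r ?nnegrE.
Qed.

Lemma L2_le_ae f g : measurable_fun setT f -> g \in Lfun mu 2%:E ->
  {ae mu, forall x, `|f x| <= `|g x|} -> f \in Lfun mu 2%:E.
Proof.
move=> mf /L2P[mg go] fg; apply/L2P; split => //.
exact: le_lt_trans (le_sqn mf mg fg) go.
Qed.

Lemma n2_le_ae f g : measurable_fun setT f -> g \in Lfun mu 2%:E ->
  {ae mu, forall x, `|f x| <= `|g x|} -> norm2 f <= norm2 g.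
Proof.
move=> mf gL fg; have fL := L2_le_ae mf gL fg.
rewrite -(@ler_pXn2r _ 2) ?nnegrE ?n2_ge0// -lee_fin -!sqnE//.
exact: le_sqn mf (L2_measurable gL) fg.
Qed.

Lemma L2_le f g : measurable_fun setT f -> g \in Lfun mu 2%:E ->
  (forall x, `|f x| <= `|g x|) -> f \in Lfun mu 2%:E.
Proof. by move=> mf gL fg; apply: L2_le_ae gL _ => //; exact: aeW. Qed.

Lemma n2_le f g : measurable_fun setT f -> g \in Lfun mu 2%:E ->
  (forall x, `|f x| <= `|g x|) -> norm2 f <= norm2 g.
Proof. by move=> mf gL fg; apply: n2_le_ae gL _ => //; exact: aeW. Qed.

Lemma L2_mul_integrable f g : f \in Lfun mu 2%:E -> g \in Lfun mu 2%:E ->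
  mu.-integrable setT (EFin \o (fun x => f x * g x)).
Proof. by move=> fL gL; apply/Lfun1_integrable; exact: Lfun2_mul_Lfun1. Qed.

Lemma cauchy_schwarz f g : f \in Lfun mu 2%:E -> g \in Lfun mu 2%:E ->
  (\int[mu]_x `|f x * g x|%:E <= (norm2 f * norm2 g)%:E)%E.
Proof.
move=> fL gL; rewrite EFinM -!n2K//.
have := hoelder mu (L2_measurable fL) (L2_measurable gL) (ltr0n R 2) (ltr0n R 2).
rewrite Lnorm1; apply.
by rewrite [RHS]splitr !div1r.
Qed.

End L2.

Section riesz_fischer.
Context d (T : measurableType d) (R : realType) (mu : {measure set T -> \bar R}).
Implicit Types (f g : T -> R).
Local Notation L2 f := (f \in Lfun mu 2%:E).
Local Notation n2 := (norm2 mu).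

(** Bounds on norms pass to pointwise limits; completeness and the Plancherel
    bound are both obtained in this way. *)
Lemma fatou_sqn (u : nat -> T -> R) f : (forall k, measurable_fun setT (u k)) ->
  measurable_fun setT f -> {ae mu, forall x, u k x @[k --> \oo] --> f x} ->
  (sqnorm mu f <= limn_einf (fun k => sqnorm mu (u k)))%E.
Proof.
move=> mu_ mf uf.
have m2 k : measurable_fun setT (fun x => (u k x ^+ 2)%:E).
  by apply: mEFin; exact: measurable_funX.
have := @fatou _ _ _ mu setT measurableT (fun k x => (u k x ^+ 2)%:E) m2.
move=> /(_ (fun k x _ => _)) h; apply: le_trans (h _); last first.
  by move=> k x; rewrite lee_fin sqr_ge0.
apply: ae_ge0_le_integral => //.
- by move=> x _; rewrite lee_fin sqr_ge0.
- by apply: mEFin; exact: measurable_funX.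
- move=> x _; rewrite limn_einf_lim; apply: lime_ge.
    exact: is_cvg_einfs.
  by apply: nearW => k; apply: le_ereal_inf_tmp => _ [l _ <-]; rewrite lee_fin sqr_ge0.
- rewrite (_ : (fun x => _) = fun x => (- limn_esup (fun k => - (u k x ^+ 2)%:E))%E).
    apply: measurableT_comp => //; apply: measurable_fun_limn_esup => k.
    exact: measurableT_comp.
  by apply/funext => x; rewrite -[in RHS](@limn_einfN _ (fun k => - (u k x ^+ 2)%:E)%E);
    congr limn_einf; apply/funext => k; exact: esym (oppeK _).
apply: filterS uf => x ux _.
suff -> : limn_einf (fun k => (u k x ^+ 2)%:E) = (f x ^+ 2)%:E by [].
have c2 : (u k x ^+ 2)%:E @[k --> \oo] --> (f x ^+ 2)%:E.
  by apply: cvg_EFin; [exact: nearW|apply: cvgM].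
rewrite is_cvg_limn_einfE; first exact/cvg_lim.
by apply/cvg_ex; eexists; exact: c2.
Qed.

(** A sequence whose increments are summable in norm converges almost
    everywhere, because the sum of the absolute increments is square-integrable
    and therefore finite almost everywhere. *)
Lemma ae_cvg_geometric (v : nat -> T -> R) : (forall k, L2 (v k)) ->
  (forall k, n2 (fun x => v k.+1 x - v k x) <= 2^-1 ^+ k) ->
  {ae mu, forall x, cvgn (fun k => v k x)}.
Proof.
move=> vL v2.
pose a k x : R := `|v k.+1 x - v k x|.
have aL k : L2 (a k).
  have dL := L2B (vL k.+1) (vL k).
  apply: (L2_le _ dL) => [|x]; last by rewrite normr_id.
  by apply: measurableT_comp => //; exact: L2_measurable dL.
have an k : n2 (a k) <= 2^-1 ^+ k.
  apply: le_trans (v2 k); apply: n2_le; last by move=> x; rewrite normr_id.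
    exact: L2_measurable (aL k).
  exact: L2B.
pose s m x : R := \sum_(i < m) a i x.
have sL m : L2 (s m) /\ n2 (s m) <= 2 - 2 * 2^-1 ^+ m.
  elim: m => [|m [IH1 IH2]].
    rewrite (_ : s 0%N = fun=> 0); last by apply/funext => x; rewrite /s big_ord0.
    by split; [exact: L2_0|rewrite n2_0 expr0 mulr1 subrr].
  have -> : s m.+1 = fun x => s m x + a m x.
    by apply/funext => x; rewrite /s big_ord_recr.
  split; first exact: L2D.
  apply: le_trans (n2D IH1 (aL m)) _.
  have := an m; move: IH2; rewrite exprS; set t := 2^-1 ^+ m => IH2 h.
  have -> : 2 * (2^-1 * t) = t by rewrite mulrA mulfV ?mul1r.
  lra.
have a0 k x : 0 <= a k x by exact: normr_ge0.
have s0 m x : 0 <= s m x by exact: sumr_ge0.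
pose G x := limn (fun m => (s m x ^+ 2)%:E).
have m2 k : measurable_fun setT (fun x => (s k x ^+ 2)%:E).
  by apply: mEFin; apply: measurable_funX; exact: L2_measurable (sL k).1.
have ndG x : nondecreasing_seq (fun m => (s m x ^+ 2)%:E).
  apply/nondecreasing_seqP => m; rewrite lee_fin lerXn2r ?nnegrE//.
  by rewrite /s big_ord_recr /= lerDl.
have Goo : (\int[mu]_x G x <= 4%:E)%E.
  have p2 k x : setT x -> (0 <= (s k x ^+ 2)%:E)%E by rewrite lee_fin sqr_ge0.
  rewrite (monotone_convergence mu measurableT m2 p2 (fun x _ => ndG x)).
  apply: lime_le.
    apply: ereal_nondecreasing_is_cvgn => i j ij; apply: ge0_le_integral => //; first exact: p2.
    by move=> x _; exact: ndG.
  apply: nearW => m; rewrite -/(sqnorm mu (s m)) sqnE; last exact: (sL m).1.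
  rewrite lee_fin (_ : 4 = 2 ^+ 2); last by rewrite -natrX.
  rewrite lerXn2r ?nnegrE ?n2_ge0//.
  apply: le_trans (sL m).2 _; rewrite gerBl mulr_ge0// exprn_ge0// invr_ge0//.
have G0 x : (0 <= G x)%E.
  apply: lime_ge; first exact: ereal_nondecreasing_is_cvgn.
  by apply: nearW => m; rewrite lee_fin sqr_ge0.
have mG : measurable_fun setT G.
  apply: emeasurable_fun_cvg m2 _ => x _.
  exact: ereal_nondecreasing_is_cvgn.
have Gi : mu.-integrable setT G.
  apply/integrableP; split => //; under eq_integral do rewrite gee0_abs//.
  exact: le_lt_trans Goo (ltry _).
have := integrable_ae measurableT Gi; apply: filterS => x /(_ I) Gx.
have cs : cvgn (fun m => s m x).
  apply: nondecreasing_is_cvgn.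
    by apply/nondecreasing_seqP => m; rewrite /s big_ord_recr /= lerDl.
  exists (1 + fine (G x)) => _ [m _ <-].
  have : s m x ^+ 2 <= fine (G x).
    rewrite -lee_fin fineK//.
    rewrite /G (cvg_lim _ (ereal_nondecreasing_cvgn (ndG x)))//.
    by apply: ereal_sup_ubound; exists m.
  have := s0 m x.
  move: (s m x) (fine _) => y z y0 yz; nra.
have cd : cvgn (series (telescope (fun k => v k x))).
  apply: normed_cvg; rewrite (_ : [normed series _] = fun m => s m x)//.
  by apply/funext => m; rewrite /normed_series_of /series/= big_mkord.
move: cd; rewrite telescopeK => cd.
have -> : (fun k => v k x) = (fun k => (v k x - v 0%N x) + v 0%N x).
  by apply/funext => k; rewrite subrK.
by apply: is_cvgD => //; exact: is_cvg_cst.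
Qed.

(** The limit is taken pointwise almost everywhere, and Fatou's lemma bounds
    the distance to it. Picard iteration uses this quantitative form. *)
Lemma L2_complete_geometric (v : nat -> T -> R) : (forall k, L2 (v k)) ->
  (forall k, n2 (fun x => v k.+1 x - v k x) <= 2^-1 ^+ k) ->
  exists f, [/\ L2 f, {ae mu, forall x, v k x @[k --> \oo] --> f x} &
    forall k, n2 (fun x => v k x - f x) <= 2 * 2^-1 ^+ k].
Proof.
move=> vL v2.
have [N [mN N0 vN]] := ae_cvg_geometric vL v2.
pose w k x := v k x * \1_(~` N) x.
have mv k := L2_measurable (vL k).
have mw k : measurable_fun setT (w k).
  by apply: measurable_funM => //; apply: measurable_indic; exact: measurableC.
have wv k x : ~ N x -> w k x = v k x.
  by move=> Nx; rewrite /w indicE mem_set// mulr1.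
have cw x : cvgn (fun k => w k x).
  have [Nx|Nx] := pselect (N x).
    rewrite (_ : (fun k => _) = fun=> 0); first exact: is_cvg_cst.
    by apply/funext => k; rewrite /w indicE memNset ?mulr0//= => /(_ Nx).
  rewrite (_ : (fun k => _) = fun k => v k x); last by apply/funext => k; exact: wv.
  by apply: contrapT => h; apply: Nx; exact: vN.
pose f x := limn (fun k => w k x).
have mf : measurable_fun setT f by apply: measurable_fun_cvg mw _ => x _; exact: cw.
have vf : {ae mu, forall x, v k x @[k --> \oo] --> f x}.
  exists N; split => // x /= h; apply: contrapT => Nx; apply: h.
  rewrite (_ : (fun k => v k x) = fun k => w k x); first exact: cw.
  by apply/funext => k; rewrite wv.
have inc k l : (k <= l)%N -> n2 (fun x => v l x - v k x) <= 2 * 2^-1 ^+ k.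
  move=> kl; suff : n2 (fun x => v l x - v k x) <= 2 * (2^-1 ^+ k - 2^-1 ^+ l).
    have : 0 <= 2^-1 ^+ l :> R by rewrite exprn_ge0// invr_ge0.
    move: (_ ^+ k) (_ ^+ l) => y z; lra.
  elim: l kl => [|l IH]; first by rewrite leqn0 => /eqP ->; under eq_fun do rewrite subrr; rewrite n2_0 subrr mulr0.
  rewrite leq_eqVlt => /predU1P[->|kl].
    by under eq_fun do rewrite subrr; rewrite n2_0 subrr mulr0.
  apply: le_trans (n2_triangle (vL l.+1) (vL l) (vL k)) _.
  apply: le_trans (lerD (v2 l) (IH kl)) _.
  rewrite (exprS _ l); move: (_ ^+ k) (_ ^+ l) => y z; lra.
have key k : (sqnorm mu (fun x => v k x - f x)%R <= ((2 * 2^-1 ^+ k) ^+ 2)%:E)%E.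
  have mB l : measurable_fun setT (fun x => v k x - v l x) by exact: measurable_funB.
  apply: (le_trans (fatou_sqn mB _ _)); first exact: measurable_funB.
    by apply: filterS vf => x vx; apply: cvgB => //; exact: cvg_cst.
  rewrite limn_einf_lim; apply: lime_le; first exact: is_cvg_einfs.
  apply: nearW => j; apply: (@le_trans _ _ (sqnorm mu (fun x => v k x - v (maxn j k) x)%R)).
    by apply: ereal_inf_lbound; exists (maxn j k) => //=; exact: leq_maxl.
  rewrite sqnE; last exact: L2B.
  by rewrite lee_fin lerXn2r ?nnegrE ?n2_ge0 ?mulr_ge0 ?exprn_ge0 ?invr_ge0// n2BC inc// leq_maxr.
have dL k : L2 (fun x => v k x - f x).
  by apply/L2P; split; [exact: measurable_funB|exact: le_lt_trans (key k) (ltry _)].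
exists f; split => //.
  have := L2B (vL 0%N) (dL 0%N).
  by rewrite (_ : (fun x => _) = f)//; apply/funext => x; ring.
move=> k; rewrite -(@ler_pXn2r _ 2) ?nnegrE ?n2_ge0 ?mulr_ge0 ?exprn_ge0 ?invr_ge0//.
by rewrite -lee_fin -sqnE.
Qed.

Theorem L2_complete (u : nat -> T -> R) : (forall k, L2 (u k)) ->
  (forall e, 0 < e -> exists N, forall k l, (N <= k)%N -> (N <= l)%N ->
     n2 (fun x => u k x - u l x) <= e) ->
  exists2 f, L2 f & n2 (fun x => u k x - f x) @[k --> \oo] --> 0.
Proof.
move=> uL uC.
have /choice[N uN] j : exists N, forall k l, (N <= k)%N -> (N <= l)%N ->
    n2 (fun x => u k x - u l x) <= 2^-1 ^+ j.
  by apply: uC; rewrite exprn_gt0// invr_gt0.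
pose M := fix M j := if j is i.+1 then maxn (M i) (N j) else N 0%N.
have NM j : (N j <= M j)%N by case: j => //= j; exact: leq_maxr.
have MS j : (M j <= M j.+1)%N by exact: leq_maxl.
have [f [fL _ fv]] := @L2_complete_geometric (fun j => u (M j)) (fun j => uL _)
  (fun j => uN j _ _ (leq_trans (NM j) (MS j)) (NM j)).
exists f => //; apply/cvgr0Pnorm_le => e e0.
have [j je] : exists j, 3 * 2^-1 ^+ j <= e.
  have : 3 * 2^-1 ^+ j @[j --> \oo] --> (3 * 0 : R).
    by apply: cvgM; [exact: cvg_cst|apply: cvg_expr; rewrite ger0_norm ?invr_ge0// invf_lt1// ltr1n].
  rewrite mulr0 => /cvgr0Pnorm_le /(_ _ e0) [j _ /(_ j (leqnn j)) h].
  by exists j; apply: le_trans (ler_norm _) h.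
exists (M j) => // k /= Mk; rewrite ger0_norm ?n2_ge0//.
apply: le_trans (n2_triangle (uL k) (uL (M j)) fL) _.
apply: le_trans (lerD (uN j _ _ (leq_trans (NM j) Mk) (NM j)) (fv j)) _.
move: je; move: (_ ^+ j) => t; lra.
Qed.

End riesz_fischer.

(** * Boxes *)

Section boxes.
Variables (R : realType) (n : nat).
Implicit Types (a b : 'I_n -> R) (f g : Rn R n -> R).
Local Notation mu := (lebesgueRn R n).
Local Notation L2 f := (f \in Lfun mu 2%:E).

Definition box a b : set (Rn R n) := [set x | forall i, (tnth x i : R) \in `]a i, b i]].

Lemma boxE a b : box a b =
  \bigcap_(i in [set: 'I_n]) ((fun y : Rn R n => tnth y i) @^-1` `]a i, b i]%classic).
Proof. by apply/seteqP; split=> y /= Ay i => [_|]; exact: Ay. Qed.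

Lemma measurable_box a b : measurable (box a b).
Proof.
rewrite boxE; apply: fin_bigcap_measurable => [|i _]; first exact: finite_finset.
rewrite -[X in measurable X]setTI; exact: (@measurable_tnth _ (measurableTypeR R)).
Qed.

Lemma box_measure_lty a b : (mu (box a b) < +oo)%E.
Proof.
have -> : mu (box a b) = (\prod_(i < n) lebesgue_measure (`]a i, b i]%classic : set (measurableTypeR R)))%E.
  by rewrite -lebesgueRn_box// => i; exact: measurable_itv.
under eq_bigr do rewrite lebesgue_measure_itv/=.
rewrite (eq_bigr (fun i => (if a i < b i then b i - a i else 0)%:E)) ?prod_EFin ?ltry//.
by move=> i _; rewrite lte_fin; case: ifP.
Qed.

Definition boxes : set (set (Rn R n)) := [set A | exists a b, A = box a b].

Lemma setI_closed_boxes : setI_closed boxes.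
Proof.
move=> _ _ [a [b ->]] [c [e ->]].
exists (fun i => Num.max (a i) (c i)), (fun i => Num.min (b i) (e i)).
apply/seteqP; split => x /=.
  move=> [h1 h2] i; have := h1 i; have := h2 i; rewrite !in_itv/= gt_max le_min.
  by move=> /andP[-> ->] /andP[-> ->].
move=> h; split => i; have := h i; rewrite !in_itv/= gt_max le_min => /andP[/andP[h1 h2] /andP[h3 h4]];
by apply/andP.
Qed.

Definition cube (k : nat) := box (fun=> - k%:R) (fun=> k%:R).

Lemma bigcup_box : \bigcup_k cube k = setT.
Proof.
apply/seteqP; split => // x _.
pose m := \max_(i < n) `|Num.floor (`|tnth x i : R|)|%N.
exists m.+1 => // i; rewrite in_itv/=.
have : `|tnth x i : R| < m.+1%:R.
  have h : (`|Num.floor `|tnth x i : R| |%N <= m)%N by exact: leq_bigmax.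
  have h2 : `|tnth x i : R| < (Num.floor `|tnth x i : R|)%:~R + 1 by rewrite -[1]/(1%:~R) -intrD; exact: floorD1_gt.
  apply: lt_le_trans h2 _.
  rewrite -natr1 lerD2r; apply: le_trans (_ : (`|Num.floor `|tnth x i : R| |%N)%:R <= _); last by rewrite ler_nat.
  by rewrite natr_absz ler_int ler_norm.
by rewrite ltr_norml => /andP[-> /ltW ->].
Qed.

(** A strip in one coordinate is a countable union of boxes. *)
Lemma measurable_boxes : measurable = <<s boxes >>.
Proof.
apply/seteqP; split; last first.
  apply: smallest_sub; first exact: sigma_algebra_measurable.
  by move=> _ [a [b ->]]; exact: measurable_box.
have hS : sigma_algebra setT <<s boxes >> by exact: smallest_sigma_algebra.
have coord (i : 'I_n) (A : set (measurableTypeR R)) : measurable A ->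
    <<s boxes >> ((fun y : Rn R n => tnth y i) @^-1` A).
  have hI := @sigma_algebra_image _ _ _ (fun y : Rn R n => tnth y i : measurableTypeR R) _ hS.
  move=> mA; rewrite -[X in <<s _ >> X]setTI.
  apply: (smallest_sub hI _ mA) => _ [[c e] _ <-].
  rewrite /image_set_system /= setTI.
  pose F (k : nat) := box (fun j => if j == i then c else - k%:R)
    (fun j => if j == i then e else k%:R).
  have -> : (fun y : Rn R n => tnth y i) @^-1` `]c, e]%classic = \bigcup_k F k.
    apply/seteqP; split => y /=.
      move=> yce; have : (\bigcup_k cube k) y by rewrite bigcup_box.
      by move=> [k _ ky]; exists k => // j; case: eqP => [->//|_]; exact: ky.
    by move=> [k _ /(_ i)]; rewrite eqxx.
  have [_ _ hU] := hS; apply: hU => k; apply: sub_sigma_algebra.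
  by exists (fun j => if j == i then c else - k%:R), (fun j => if j == i then e else k%:R).
apply: smallest_sub => //; elim/big_ind: _ => [//|A B hA hB|i _].
  by rewrite subUset.
by move=> _ [A mA <-]; rewrite setTI; exact: coord.
Qed.

Lemma L2_indic (A : set (Rn R n)) : measurable A -> (mu A < +oo)%E -> L2 (\1_A).
Proof.
move=> mA Ao; apply/L2P; split; first exact: measurable_indic.
rewrite /sqnorm (eq_integral (fun x => (\1_A x)%:E)); first by rewrite integral_indic// setIT.
by move=> x _; rewrite indicE; case: (x \in A); rewrite ?expr1n ?expr0n.
Qed.

Lemma restrict_indic (A : set (Rn R n)) f :
  (fun x => (f x)%:E) \_ A = (fun x => (f x * \1_A x)%:E).
Proof.
apply/funext => x; rewrite /patch indicE; case: (x \in A); first by rewrite mulr1.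
by rewrite mulr0.
Qed.

(** The positive and negative parts of [f] are densities of two measures that
    agree on boxes, hence everywhere. *)
Lemma box_ae0 f : L2 f -> (forall a b, (\int[mu]_x (f x * \1_(box a b) x)%:E = 0)%E) ->
  {ae mu, forall x, f x = 0}.
Proof.
move=> fL f0; have mf := L2_measurable fL.
have mf' := mEFin mf.
pose g1 := (fun x => (f x)%:E)^\+%E; pose g2 := (fun x => (f x)%:E)^\-%E.
have mg1 : measurable_fun setT g1 by exact: measurable_funepos.
have mg2 : measurable_fun setT g2 by exact: measurable_funeneg.
have g10 x : (0 <= g1 x)%E by exact: funepos_ge0.
have g20 x : (0 <= g2 x)%E by exact: funeneg_ge0.
pose m1 (A : set (Rn R n)) := (\int[mu]_(x in A) g1 x)%E.
pose m2 (A : set (Rn R n)) := (\int[mu]_(x in A) g2 x)%E.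
have m1_0 : m1 set0 = 0%E by rewrite /m1 integral_set0.
have m2_0 : m2 set0 = 0%E by rewrite /m2 integral_set0.
have m1_ge0 A : (0 <= m1 A)%E by apply: integral_ge0.
have m2_ge0 A : (0 <= m2 A)%E by apply: integral_ge0.
have m1_s : semi_sigma_additive m1 by exact: semi_sigma_additive_nng_induced.
have m2_s : semi_sigma_additive m2 by exact: semi_sigma_additive_nng_induced.
pose M1 : {measure set (Rn R n) -> \bar R} := HB.pack m1 (isMeasure.Build _ _ _ m1 m1_0 m1_ge0 m1_s).
pose M2 : {measure set (Rn R n) -> \bar R} := HB.pack m2 (isMeasure.Build _ _ _ m2 m2_0 m2_ge0 m2_s).
have fi a b : mu.-integrable (box a b) (fun x => (f x)%:E).
  apply/(integrable_mkcond _ (measurable_box a b)); rewrite restrict_indic.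
  apply: (L2_mul_integrable fL).
  by apply: L2_indic; [exact: measurable_box|exact: box_measure_lty].
have gi1 a b : mu.-integrable (box a b) g1 by apply: integrable_funepos => //; exact: measurable_box.
have gi2 a b : mu.-integrable (box a b) g2 by apply: integrable_funeneg => //; exact: measurable_box.
have mb a b := measurable_box a b.
have m1fin a b : m1 (box a b) \is a fin_num by exact: integrable_fin_num.
have m2fin a b : m2 (box a b) \is a fin_num by exact: integrable_fin_num.
have m12 A : boxes A -> M1 A = M2 A.
  move=> [a [b ->]]; rewrite -[LHS]/(m1 _) -[RHS]/(m2 _).
  have := f0 a b; rewrite -(restrict_indic (box a b)) -integral_mkcond integralE -/g1 -/g2.
  rewrite -/(m1 _) -/(m2 _) -(fineK (m1fin a b)) -(fineK (m2fin a b)) => -[] /eqP.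
  by rewrite subr_eq0 => /eqP ->.
have m1o (k : nat) : (M1 (cube k) < +oo)%E.
  by rewrite -[M1 _]/(m1 _) ltey_eq m1fin.
have eqA A : measurable A -> m1 A = m2 A.
  apply: (measure_unique boxes (fun k : nat => cube k) measurable_boxes setI_closed_boxes _ _ M1 M2 m12 m1o).
    by move=> k; exists (fun=> - k%:R), (fun=> k%:R).
  exact: bigcup_box.
have aek (k : nat) : {ae mu, forall x, cube k x -> (f x)%:E = 0%E}.
  pose D := cube k.
  apply: (@integral_ae_eq _ _ _ mu D (mb _ _) (cst 0%E) (fun x => (f x)%:E) (fi _ _)) => //.
  move=> E ED mE; rewrite integral0 integralE -/g1 -/g2 -/(m1 E) -/(m2 E) (eqA E mE).
  apply: subee; apply: (@integrable_fin_num _ _ _ mu E mE).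
  exact: (integrableS (mb _ _) mE ED (gi2 _ _)).
have := ae_foralln aek; apply: filterS => x h.
have : (\bigcup_k cube k) x by rewrite bigcup_box.
by move=> [k _ /h [->]].
Qed.

End boxes.

(** * The Hartley transform of integrable functions *)

Section hartley_L1.
Variables (R : realType) (n : nat).
Local Notation T := (Rn R n).
Local Notation mu := (lebesgueRn R n).
Local Notation L1 f := (mu.-integrable setT (EFin \o f)).
Local Notation L2 f := (f \in Lfun mu 2%:E).
Implicit Types (f g : T -> R) (x y xi : T).

(** The Hartley kernel: for real functions, its transform carries the same
    information as the Fourier transform, while it is real and an involution
    up to a constant. *)
Definition cas x xi : R := cos (dot x xi) + sin (dot x xi).
Definition hart f xi : R := fine (\int[mu]_x (f x * cas x xi)%:E)%E.

Lemma casC x y : cas x y = cas y x.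
Proof. by rewrite /cas dotC. Qed.

Lemma norm_cas x y : `|cas x y| <= 2.
Proof.
rewrite /cas (le_trans (ler_normD _ _))// (_ : 2 = 1 + 1) ?lerD//.
- exact: cos_max.
- exact: sin_max.
Qed.

Lemma measurable_cas : measurable_fun setT (fun p : T * T => cas p.1 p.2).
Proof.
apply: measurable_funD.
  exact: (measurableT_comp (@measurable_cos R) (@measurable_dot2 R n)).
exact: (measurableT_comp (@measurable_sin R) (@measurable_dot2 R n)).
Qed.

Lemma measurable_cas1 x : measurable_fun setT (cas x).
Proof. exact: (measurableT_comp measurable_cas (pair1_measurable x)). Qed.

Lemma measurable_cas2 y : measurable_fun setT (cas ^~ y).
Proof. by under eq_fun do rewrite casC; exact: measurable_cas1. Qed.

Lemma L1_measurable f : L1 f -> measurable_fun setT f.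
Proof. by move=> /measurable_int/measurable_EFinP. Qed.

Lemma L1Z (a : R) f : L1 f -> L1 (fun x => a * f x).
Proof. by move=> fL; exact: (integrableZl measurableT a fL). Qed.

Lemma L1D f g : L1 f -> L1 g -> L1 (fun x => f x + g x).
Proof. by move=> fL gL; exact: (integrableD measurableT fL gL). Qed.

Lemma L1_abs f : L1 f -> L1 (fun x => `|f x|).
Proof. by move=> fL; exact: (integrable_abse fL). Qed.

Lemma L1_bounded_mul f g (M : R) : L1 f -> measurable_fun setT g ->
  (forall x, `|g x| <= M) -> L1 (fun x => f x * g x).
Proof.
move=> fL mg gM; have mf := L1_measurable fL.
have i1 : L1 (fun x => M * `|f x|).
  by apply: L1Z; exact: L1_abs.
apply: integrable_bound i1 _; first exact: measurable_funM.
by move=> x; rewrite normrM mulrC ler_wpM2r.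
Qed.

Lemma measurable_cos_dot xi : measurable_fun setT (fun x => cos (dot x xi)).
Proof.
under eq_fun do rewrite dotC.
exact: (measurableT_comp (@measurable_cos R) (@measurable_dot R n xi)).
Qed.

Lemma measurable_sin_dot xi : measurable_fun setT (fun x => sin (dot x xi)).
Proof.
under eq_fun do rewrite dotC.
exact: (measurableT_comp (@measurable_sin R) (@measurable_dot R n xi)).
Qed.

Lemma L1_cos f xi : L1 f -> L1 (fun x => f x * cos (dot x xi)).
Proof.
move=> fL; apply: (L1_bounded_mul (M := 1)) => //; first exact: measurable_cos_dot.
by move=> x; exact: cos_max.
Qed.

Lemma L1_sin f xi : L1 f -> L1 (fun x => f x * sin (dot x xi)).
Proof.
move=> fL; apply: (L1_bounded_mul (M := 1)) => //; first exact: measurable_sin_dot.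
by move=> x; exact: sin_max.
Qed.

Lemma L1_cas f xi : L1 f -> L1 (fun x => f x * cas x xi).
Proof. by move=> fL; apply: L1_bounded_mul fL (measurable_cas2 xi) _ => x; exact: norm_cas. Qed.

Lemma hartE f xi : L1 f -> (\int[mu]_x (f x * cas x xi)%:E = (hart f xi)%:E)%E.
Proof. by move=> fL; rewrite /hart fineK//; exact: integrable_fin_num (L1_cas xi fL). Qed.

Lemma measurable_integral_param d (S : measurableType d) (F : S * T -> \bar R) :
  measurable_fun setT F -> measurable_fun setT (fun s => \int[mu]_x F (s, x))%E.
Proof.
move=> mF.
rewrite (_ : (fun s => _) = fun s => (\int[mu]_x (F^\+)%E (s, x) - \int[mu]_x (F^\-)%E (s, x))%E).
  apply: emeasurable_funB.
    exact: (measurable_fun_fubini_tonelli_F (m2 := mu) (F^\+)%E (measurable_funepos mF) (fun=> funepos_ge0 _ _)).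
  exact: (measurable_fun_fubini_tonelli_F (m2 := mu) (F^\-)%E (measurable_funeneg mF) (fun=> funeneg_ge0 _ _)).
apply/funext => s; rewrite integralE.
by rewrite (funepos_comp F (pair s)) (funeneg_comp F (pair s)).
Qed.

Lemma measurable_hart f : measurable_fun setT f -> measurable_fun setT (hart f).
Proof.
move=> mf; apply: (@measurableT_comp _ _ _ _ _ _ (@fine R)) => //.
apply: (@measurable_integral_param _ _ (fun p => (f p.2 * cas p.2 p.1)%:E)).
apply: mEFin; apply: measurable_funM; first exact: (measurableT_comp mf measurable_snd).
by under eq_fun do rewrite casC; exact: measurable_cas.
Qed.

Lemma hartD f g xi : L1 f -> L1 g -> hart (fun x => f x + g x) xi = hart f xi + hart g xi.
Proof.
move=> fL gL; apply/EFin_inj; rewrite EFinD -!hartE//; last exact: L1D.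
rewrite -integralD//; [|exact: L1_cas|exact: L1_cas].
by apply: eq_integral => x _; rewrite mulrDl EFinD.
Qed.

Lemma hartZ (a : R) f xi : L1 f -> hart (fun x => a * f x) xi = a * hart f xi.
Proof.
move=> fL; apply/EFin_inj; rewrite EFinM -!hartE//; last exact: L1Z.
rewrite -integralZl//; last exact: L1_cas.
by apply: eq_integral => x _; rewrite -mulrA EFinM.
Qed.

Definition norm1 f : R := fine (\int[mu]_x `|f x|%:E)%E.

Lemma n1E f : L1 f -> (\int[mu]_x `|f x|%:E = (norm1 f)%:E)%E.
Proof. by move=> fL; rewrite /norm1 fineK//; exact: integrable_fin_num (integrable_abse fL). Qed.

Lemma n1_ge0 f : 0 <= norm1 f.
Proof. by apply: fine_ge0; apply: integral_ge0 => x _; rewrite lee_fin. Qed.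

Lemma le_integral_bound f g : L1 f -> measurable_fun setT g ->
  (forall x, `|g x| <= 2) ->
  (\int[mu]_x `|f x * g x|%:E <= (2 * norm1 f)%:E)%E.
Proof.
move=> fL mg g2; have mf := L1_measurable fL.
have ma : measurable_fun setT (fun x => `|f x|%:E).
  by apply: mEFin; exact: measurableT_comp.
rewrite EFinM -(n1E fL) -ge0_integralZl//.
apply: ge0_le_integral => //.
- by apply: mEFin; apply: measurableT_comp => //; exact: measurable_funM.
- exact: emeasurable_funM.
by move=> x _; rewrite -EFinM lee_fin normrM mulrC ler_wpM2r.
Qed.

Lemma hart_bounded f xi : L1 f -> `|hart f xi| <= 2 * norm1 f.
Proof.
move=> fL; rewrite -lee_fin -abse_EFin -hartE//.
apply: le_trans (le_abse_integral _ _ _) _ => //.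
  exact: measurable_int (L1_cas xi fL).
apply: le_integral_bound => //; first exact: measurable_cas2.
by move=> x; exact: norm_cas.
Qed.

Lemma L1_hart_mul f g : L1 f -> L1 g -> L1 (fun x => f x * hart g x).
Proof.
move=> fL gL; apply: (L1_bounded_mul (M := 2 * norm1 g)) => //.
  by apply: measurable_hart; exact: L1_measurable.
by move=> x; exact: hart_bounded.
Qed.

(** The kernel is symmetric, so this is Fubini's theorem. *)
Lemma hart_symmetric f g : L1 f -> L1 g ->
  (\int[mu]_xi (hart f xi * g xi)%:E = \int[mu]_x (f x * hart g x)%:E)%E.
Proof.
move=> fL gL; have mf := L1_measurable fL; have mg := L1_measurable gL.
pose F (p : T * T) := (f p.1 * g p.2 * cas p.1 p.2)%:E.
have mF : measurable_fun setT F.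
  apply: mEFin; apply: measurable_funM; last exact: measurable_cas.
  apply: measurable_funM; first exact: (measurableT_comp mf measurable_fst).
  exact: (measurableT_comp mg measurable_snd).
have maF : measurable_fun setT (abse \o F) by exact: measurableT_comp.
have Fi : (mu \x mu)%E.-integrable setT F.
  apply/integrable12ltyP => //.
  apply: (@le_lt_trans _ _ (\int[mu]_x (`|f x| * (2 * norm1 g))%:E)%E); last first.
    rewrite -(fineK (integrable_fin_num measurableT _)) ?ltry//.
    under eq_fun do rewrite mulrC.
    by apply: L1Z; exact: L1_abs.
  apply: ge0_le_integral => //.
  - by move=> x _; apply: integral_ge0.
  - exact: (measurable_fun_fubini_tonelli_F (m2 := mu) (abse \o F) maF (fun=> abse_ge0 _)).
  - by apply: mEFin; apply: measurable_funM => //; exact: measurableT_comp.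
  move=> x _; rewrite EFinM.
  apply: le_trans (lee_wpmul2l _ (le_integral_bound gL (measurable_cas1 x) (norm_cas x))); last by rewrite lee_fin.
  have mgc : measurable_fun setT (fun y => `|g y * cas x y|%:E).
    apply: mEFin; apply: measurableT_comp => //.
    by apply: measurable_funM => //; exact: measurable_cas1.
  rewrite -ge0_integralZl// le_eqVlt; apply/orP; left; apply/eqP.
  by apply: eq_integral => y _; rewrite /F/= -EFinM -mulrA normrM.
have := @Fubini _ _ _ _ _ mu mu F Fi.
rewrite (_ : (\int[mu]_x fubini_F _ _ x)%E = (\int[mu]_x (f x * hart g x)%:E)%E); last first.
  apply: eq_integral => x _; rewrite /fubini_F /F/=.
  under eq_integral do rewrite -mulrA EFinM.
  rewrite integralZl//; last by under eq_fun do rewrite casC; exact: L1_cas.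
  by under eq_integral do rewrite casC; rewrite hartE.
move=> ->; apply: eq_integral => xi _; rewrite /fubini_G /F/=.
under [in RHS]eq_integral do rewrite mulrAC mulrC EFinM.
by rewrite integralZl//; [rewrite hartE// -EFinM mulrC|exact: L1_cas].
Qed.

End hartley_L1.

(** * Regularization by the Poisson kernel and the Plancherel bound *)

Section poisson_hartley.
Variables (R : realType) (n : nat).
Local Notation T := (Rn R n).
Local Notation mu := (lebesgueRn R n).
Local Notation L1 f := (mu.-integrable setT (EFin \o f)).
Local Notation L2 f := (f \in Lfun mu 2%:E).
Implicit Types (f g : T -> R) (x y xi : T) (e : R).

Lemma dot_tsub x y z : dot (tsub x y) z = dot x z - dot y z.
Proof. by rewrite tsubE dotDl dotNl. Qed.

(** [cas x xi * cas y xi] is [cos ((x - y) . xi) + sin ((x + y) . xi)], and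
    the sine is odd in [xi]. *)
Lemma hart_kP_cas e x y : 0 < e ->
  hart (fun xi => kP e xi * cas x xi) y = KP e (tsub x y).
Proof.
move=> e0.
have mc z : measurable_fun setT (fun xi : T => cos (dot z xi)).
  exact: (measurableT_comp (@measurable_cos R) (@measurable_dot R n z)).
have ms z : measurable_fun setT (fun xi : T => sin (dot z xi)).
  exact: (measurableT_comp (@measurable_sin R) (@measurable_dot R n z)).
have fL : L1 (fun xi => kP e xi * cas x xi).
  apply: L1_bounded_mul (integrable_kP n e0) (measurable_cas1 x) (norm_cas x).
apply/EFin_inj; rewrite -hartE// -integral_kP_cos//.
transitivity (\int[mu]_xi ((kP e xi * cos (dot (tsub x y) xi))%:E +
   (kP e xi * sin (dot (tadd x y) xi))%:E))%E.
  apply: eq_integral => xi _; rewrite -EFinD -mulrA -mulrDr; congr (_ * _)%:E.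
  rewrite casC /cas !(dotC xi) dot_tsub dotDl cosB sinD; ring.
rewrite integralD//; [|exact: integrable_kP_cos|exact: integrable_kP_sin].
by rewrite integral_kP_sin// adde0.
Qed.

(** The inversion formula damped by a Poisson kernel: the transform of
    [kP e * hart f] is [f] convolved with the approximate identity [KP e]. *)
Lemma hart_kP_hart e f x : 0 < e -> L1 f ->
  (hart (fun xi => kP e xi * hart f xi)%R x)%:E = (\int[mu]_y (f y * KP e (tsub x y))%:E)%E.
Proof.
move=> e0 fL.
have gL : L1 (fun xi => kP e xi * cas x xi).
  apply: L1_bounded_mul (integrable_kP n e0) (measurable_cas1 x) (norm_cas x).
rewrite -hartE; last exact: L1_hart_mul (integrable_kP n e0) fL.
have := hart_symmetric fL gL.
under [in RHS]eq_integral do rewrite hart_kP_cas//.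
by move=> <-; apply: eq_integral => xi _; congr EFin; rewrite casC mulrAC mulrC.
Qed.

Lemma measurable_KP_tsub e : 0 < e -> measurable_fun setT (fun p : T * T => KP e (tsub p.1 p.2)).
Proof.
by move=> e0; exact: (measurableT_comp (@measurable_KP R n e e0) (@measurable_tsub R n)).
Qed.

Lemma integral_KP_tsub e x : 0 < e -> (\int[mu]_y (KP e (tsub x y))%:E = ((2 * pi) ^+ n)%:E)%E.
Proof.
move=> e0; rewrite -(integral_KP n e0).
have mK : measurable_fun setT (fun z : T => (KP e z)%:E) by apply: mEFin; exact: measurable_KP.
have K0 (z : T) : (0 <= (KP e z)%:E)%E by rewrite lee_fin KP_ge0// ltW.
have mK' : measurable_fun setT (fun z : T => (KP e (tadd x z))%:E).
  by apply: (measurableT_comp mK); exact: measurable_tadd1.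
rewrite -(ge0_integralRnD x mK K0) -(ge0_integralRnN mK')//.
by apply: eq_integral => y _; rewrite tsubE.
Qed.

Lemma KP_tsubC e x y : KP e (tsub x y) = KP e (tsub y x).
Proof. by rewrite /KP; apply: eq_bigr => i _; rewrite !tnth_mktuple; congr (_ / (_ + _)); rewrite -sqrrN opprB. Qed.

(** The left-hand side is the quadratic form of the kernel [KP e (x - y)] at
    [f]; the bound is Schur's test, as the kernel has mass (2 pi)^n in either
    variable. *)
Lemma sqn_kP_hart e f : 0 < e -> L1 f -> L2 f ->
  (\int[mu]_xi (kP e xi * hart f xi ^+ 2)%:E <= ((2 * pi) ^+ n)%:E * sqnorm mu f)%E.
Proof.
move=> e0 fL fL2; have mf := L1_measurable fL.
have gL : L1 (fun xi => kP e xi * hart f xi) := L1_hart_mul (integrable_kP n e0) fL.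
have -> : (\int[mu]_xi (kP e xi * hart f xi ^+ 2)%:E =
    \int[mu]_x ((f x)%:E * \int[mu]_y (f y * KP e (tsub x y))%:E))%E.
  transitivity (\int[mu]_xi (hart f xi * (kP e xi * hart f xi))%:E)%E.
    by apply: eq_integral => xi _; congr EFin; ring.
  by rewrite hart_symmetric//; apply: eq_integral => x _; rewrite EFinM hart_kP_hart.
pose a (p : T * T) := ((f p.1 ^+ 2 / 2) * KP e (tsub p.1 p.2))%:E.
pose b (p : T * T) := ((f p.2 ^+ 2 / 2) * KP e (tsub p.1 p.2))%:E.
have KP0 (z : T) : 0 <= KP e z by rewrite KP_ge0// ltW.
have mK := measurable_KP_tsub e0.
have mh : measurable_fun setT (fun x => f x ^+ 2 / 2).
  by apply: measurable_funM => //; exact: measurable_funX.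
have ma : measurable_fun setT a.
  by apply: mEFin; apply: measurable_funM => //; exact: (measurableT_comp mh measurable_fst).
have mb : measurable_fun setT b.
  by apply: mEFin; apply: measurable_funM => //; exact: (measurableT_comp mh measurable_snd).
have a0 p : (0 <= a p)%E by rewrite lee_fin mulr_ge0// divr_ge0// sqr_ge0.
have b0 p : (0 <= b p)%E by rewrite lee_fin mulr_ge0// divr_ge0// sqr_ge0.
have half : (\int[mu]_x (f x ^+ 2 / 2)%:E = (2^-1)%:E * sqnorm mu f)%E.
  rewrite /sqnorm -ge0_integralZl//.
  - by apply: eq_integral => x _; rewrite -EFinM mulrC.
  - by apply: mEFin; exact: measurable_funX.
  by move=> x _; rewrite lee_fin sqr_ge0.
have mhE := mEFin mh.
have Ia : (\int[mu]_x \int[mu]_y a (x, y) = (2^-1)%:E * (((2 * pi) ^+ n)%:E * sqnorm mu f))%E.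
  rewrite muleCA -half -ge0_integralZl//; last 2 first.
  - by move=> x _; rewrite lee_fin divr_ge0// sqr_ge0.
  - by rewrite lee_fin exprn_ge0// mulr_ge0// pi_ge0.
  apply: eq_integral => x _; rewrite /a /=.
  under eq_integral do rewrite EFinM.
  rewrite ge0_integralZl//; last 3 first.
  - by apply: mEFin; exact: (measurableT_comp mK (pair1_measurable x)).
  - by move=> y _; rewrite lee_fin.
  - by rewrite lee_fin divr_ge0// sqr_ge0.
  by rewrite integral_KP_tsub// muleC.
have Ib : (\int[mu]_x \int[mu]_y b (x, y) = (2^-1)%:E * (((2 * pi) ^+ n)%:E * sqnorm mu f))%E.
  rewrite -Ia; transitivity (\int[mu]_y \int[mu]_x b (x, y))%E.
    exact: (fubini_tonelli (m1 := mu) (m2 := mu) b mb b0).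
  apply: eq_integral => y _; apply: eq_integral => x _.
  by rewrite /a /b /= KP_tsubC.
have mIa := measurable_fun_fubini_tonelli_F (m2 := mu) a ma a0.
have mIb := measurable_fun_fubini_tonelli_F (m2 := mu) b mb b0.
have Ia0 x : (0 <= \int[mu]_y a (x, y))%E by exact: integral_ge0.
have Ib0 x : (0 <= \int[mu]_y b (x, y))%E by exact: integral_ge0.
apply: (@le_trans _ _ (\int[mu]_x (\int[mu]_y a (x, y) + \int[mu]_y b (x, y)))%E); last first.
  rewrite ge0_integralD// Ia Ib sqnE// -!EFinM -EFinD lee_fin.
  by move: ((2 * pi) ^+ n * _) => A; lra.
have mKx x : measurable_fun setT (fun y => KP e (tsub x y)).
  exact: (measurableT_comp mK (pair1_measurable x)).
have mfK x : measurable_fun setT (fun y => (f y * KP e (tsub x y))%:E).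
  by apply: mEFin; exact: measurable_funM.
have pt x : (`|(f x)%:E * \int[mu]_y (f y * KP e (tsub x y))%:E| <=
    \int[mu]_y a (x, y) + \int[mu]_y b (x, y))%E.
  have max1 : measurable_fun setT (fun y => a (x, y)).
    exact: (measurableT_comp ma (pair1_measurable x)).
  have mbx1 : measurable_fun setT (fun y => b (x, y)).
    exact: (measurableT_comp mb (pair1_measurable x)).
  rewrite -ge0_integralD// abseM.
  apply: (@le_trans _ _ (`|f x|%:E * \int[mu]_y `|(f y * KP e (tsub x y))%:E|)%E).
    by apply: lee_wpmul2l => //; exact: le_abse_integral.
  rewrite -ge0_integralZl//; last exact: measurableT_comp.
  apply: ge0_le_integral => //.
  - by apply: emeasurable_funM => //; exact: measurableT_comp.
  - exact: emeasurable_funD.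
  move=> y _; rewrite /a /b /= -EFinM lee_fin normrM mulrA (ger0_norm (KP0 _)) -mulrDl.
  rewrite ler_wpM2r// -[f x ^+ 2]real_normK ?num_real// -[f y ^+ 2]real_normK ?num_real//.
  have := sqr_ge0 (`|f x| - `|f y|); rewrite sqrrB.
  move: (`|f x|) (`|f y|) => s t; lra.
have mP : measurable_fun setT (fun x => (f x)%:E * \int[mu]_y (f y * KP e (tsub x y))%:E)%E.
  apply: emeasurable_funM; first exact: mEFin.
  apply: (@measurable_integral_param R n _ T (fun p => (f p.2 * KP e (tsub p.1 p.2))%:E)).
  by apply: mEFin; apply: measurable_funM => //; exact: (measurableT_comp mf measurable_snd).
apply: (le_trans (lee_abs _)); apply: (le_trans (le_abse_integral _ _ _)) => //.
apply: ge0_le_integral => //.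
- exact: measurableT_comp.
- exact: emeasurable_funD.
Qed.

Lemma kP_sqr e xi : kP e xi ^+ 2 = kP (2 * e) xi.
Proof.
rewrite /kP -prodrXl; apply: eq_bigr => i _.
by rewrite -expRM_natl; congr expR; ring.
Qed.

Definition eps (k : nat) : R := k.+1%:R^-1.

Lemma eps_gt0 k : 0 < eps k. Proof. by rewrite invr_gt0. Qed.

Lemma eps_cvg0 : eps k @[k --> \oo] --> 0.
Proof. exact: cvg_harmonic. Qed.

Lemma kPE e xi : kP e xi = expR (- (e * \sum_(i < n) `|tnth xi i : R|)).
Proof. by rewrite mulr_sumr -sumrN expR_sum. Qed.

Lemma kP_cvg1 (c : R) xi : kP (c * eps k) xi @[k --> \oo] --> (1 : R).
Proof.
under eq_fun do rewrite kPE.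
rewrite -expR0; apply: continuous_cvg; first exact: continuous_expR.
rewrite -[X in _ --> X]oppr0; apply: cvgN.
have h : c * eps k @[k --> \oo] --> 0.
  by rewrite -[X in _ --> X](mulr0 c); apply: cvgM; [exact: cvg_cst|exact: eps_cvg0].
have h2 := cvgM h (cvg_cst (\sum_(i < n) `|tnth xi i : R|)).
by rewrite mul0r in h2; exact: h2.
Qed.

(** The Plancherel bound: the damping in [sqn_kP_hart] is removed by Fatou's
    lemma. *)
Theorem hart_bound f : L1 f -> L2 f ->
  L2 (hart f) /\ norm2 mu (hart f) ^+ 2 <= (2 * pi) ^+ n * norm2 mu f ^+ 2.
Proof.
move=> fL fL2.
have mh := measurable_hart (L1_measurable fL).
have mk k : measurable_fun setT (fun xi : T => kP (1 * eps k) xi * hart f xi).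
  by apply: measurable_funM => //; exact: measurable_kP.
have bd : (sqnorm mu (hart f) <= ((2 * pi) ^+ n)%:E * sqnorm mu f)%E.
  apply: (le_trans (fatou_sqn mk mh _)).
    apply: aeW => xi; rewrite -[X in _ --> X]mul1r.
    by apply: cvgM; [exact: kP_cvg1|exact: cvg_cst].
  rewrite limn_einf_lim; apply: lime_le; first exact: is_cvg_einfs.
  apply: nearW => k; apply: (@le_trans _ _ (sqnorm mu (fun xi => kP (1 * eps k) xi * hart f xi)%R)).
    by apply: ereal_inf_lbound; exists k => //=.
  rewrite /sqnorm; under eq_integral do rewrite exprMn kP_sqr.
  by apply: sqn_kP_hart => //; rewrite mul1r mulr_gt0// eps_gt0.
have hL : L2 (hart f).
  by apply/L2P; split => //; apply: le_lt_trans bd _; rewrite sqnE// -EFinM ltry.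
by split => //; rewrite -lee_fin [X in (_ <= X)%E]EFinM -(sqnE hL) -(sqnE fL2).
Qed.

End poisson_hartley.

(** * The Hartley transform on square-integrable functions *)

Section hartley_L2.
Variables (R : realType) (n : nat).
Local Notation T := (Rn R n).
Local Notation mu := (lebesgueRn R n).
Local Notation L1 f := (mu.-integrable setT (EFin \o f)).
Local Notation L2 f := (f \in Lfun mu 2%:E).
Local Notation n2 := (norm2 mu).
Implicit Types (f g h : T -> R) (x y xi : T) (e : R).

(** The closure of the graph of [hart] in L2 x L2, as for the L2 Fourier
    transform. *)
Definition is_hart f h := [/\ L2 f, L2 h & exists phi : nat -> T -> R,
  [/\ forall k, L1 (phi k) /\ L2 (phi k),
      n2 (fun x => phi k x - f x) @[k --> \oo] --> 0 &
      n2 (fun x => hart (phi k) x - h x) @[k --> \oo] --> 0]].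

Let C : R := Num.sqrt ((2 * pi) ^+ n).

Lemma hart_n2_le f : L1 f -> L2 f -> n2 (hart f) <= C * n2 f.
Proof.
move=> fL fL2; have [_ h] := hart_bound fL fL2.
have p0 : 0 <= (2 * pi : R) ^+ n by rewrite exprn_ge0// mulr_ge0// pi_ge0.
rewrite -(@ler_pXn2r _ 2) ?nnegrE ?mulr_ge0 ?sqrtr_ge0 ?n2_ge0//.
by rewrite exprMn sqr_sqrtr.
Qed.

Lemma hartB f g xi : L1 f -> L1 g -> hart (fun x => f x - g x) xi = hart f xi - hart g xi.
Proof.
move=> fL gL; have gL' : L1 (fun x => -1 * g x) by exact: L1Z.
have := hartD xi fL gL'; rewrite hartZ// mulN1r => <-.
by congr hart; apply/funext => x; rewrite mulN1r.
Qed.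

Lemma L1B f g : L1 f -> L1 g -> L1 (fun x => f x - g x).
Proof. by move=> fL gL; exact: (integrableB measurableT fL gL). Qed.

Lemma is_hart_L1 f : L1 f -> L2 f -> is_hart f (hart f).
Proof.
move=> fL fL2; have [hL _] := hart_bound fL fL2.
split=> //; exists (fun=> f); split => //.
- by under eq_fun do (under eq_fun do rewrite subrr); rewrite n2_0; exact: cvg_cst.
- by under eq_fun do (under eq_fun do rewrite subrr); rewrite n2_0; exact: cvg_cst.
Qed.

Lemma is_hartD f g h k : is_hart f h -> is_hart g k ->
  is_hart (fun x => f x + g x) (fun x => h x + k x).
Proof.
move=> [fL hL [u [uL uf uh]]] [gL kL [v [vL vg vk]]].
split; [exact: L2D|exact: L2D|exists (fun j x => u j x + v j x); split].
- by move=> j; have [? ?] := uL j; have [? ?] := vL j; split; [exact: L1D|exact: L2D].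
- have c0 : n2 (fun x => u j x - f x) + n2 (fun x => v j x - g x) @[j --> \oo] --> 0.
    by rewrite -(addr0 0); exact: cvgD.
  apply: (squeeze_cvgr _ (cvg_cst 0) c0); apply: nearW => j; rewrite n2_ge0/=.
  have := n2D (L2B (uL j).2 fL) (L2B (vL j).2 gL).
  by under [X in n2 X <= _ -> _]eq_fun do rewrite addrACA -opprD.
- have c0 : n2 (fun x => hart (u j) x - h x) + n2 (fun x => hart (v j) x - k x) @[j --> \oo] --> 0.
    by rewrite -(addr0 0); exact: cvgD.
  apply: (squeeze_cvgr _ (cvg_cst 0) c0); apply: nearW => j; rewrite n2_ge0/=.
  have [u1 u2] := uL j; have [v1 v2] := vL j.
  have := n2D (L2B (hart_bound u1 u2).1 hL) (L2B (hart_bound v1 v2).1 kL).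
  under [X in n2 X <= _ -> _]eq_fun do rewrite addrACA -opprD.
  rewrite (_ : (fun x => hart (fun y => u j y + v j y) x - _) = fun x => hart (u j) x + hart (v j) x - (h x + k x))//.
  by apply/funext => x; rewrite hartD.
Qed.

Lemma is_hartZ (a : R) f h : is_hart f h -> is_hart (fun x => a * f x) (fun x => a * h x).
Proof.
move=> [fL hL [u [uL uf uh]]].
split; [exact: L2Z|exact: L2Z|exists (fun j x => a * u j x); split].
- by move=> j; have [? ?] := uL j; split; [exact: L1Z|exact: L2Z].
- rewrite (_ : (fun j => _) = fun j => `|a| * n2 (fun x => u j x - f x)).
    by rewrite -(mulr0 `|a|); apply: cvgM => //; exact: cvg_cst.
  apply/funext => j; rewrite -n2Z; last exact: L2B (uL j).2 fL.
  by congr (norm2 mu); apply/funext => x; rewrite mulrBr.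
- rewrite (_ : (fun j => _) = fun j => `|a| * n2 (fun x => hart (u j) x - h x)).
    by rewrite -(mulr0 `|a|); apply: cvgM => //; exact: cvg_cst.
  apply/funext => j; have [u1 u2] := uL j.
  rewrite -n2Z; last exact: L2B (hart_bound u1 u2).1 hL.
  by congr (norm2 mu); apply/funext => x; rewrite hartZ// mulrBr.
Qed.

Lemma is_hartB f g h k : is_hart f h -> is_hart g k ->
  is_hart (fun x => f x - g x) (fun x => h x - k x).
Proof.
move=> fh /(is_hartZ (-1)) gk; have := is_hartD fh gk.
under [X in is_hart X]eq_fun do rewrite mulN1r.
by under [X in is_hart _ X]eq_fun do rewrite mulN1r.
Qed.

Lemma is_hart_bound f h : is_hart f h -> n2 h <= C * n2 f.
Proof.
move=> [fL hL [u [uL uf uh]]].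
have C0 : 0 <= C by exact: sqrtr_ge0.
have lim0 : n2 (fun x => hart (u j) x - h x) + C * n2 (fun x => u j x - f x) + C * n2 f
    @[j --> \oo] --> 0 + C * 0 + C * n2 f.
  apply: cvgD; last exact: cvg_cst.
  by apply: cvgD => //; apply: cvgM => //; exact: cvg_cst.
rewrite mulr0 !add0r in lim0.
rewrite -(cvg_lim (@Rhausdorff R) lim0).
apply: limr_ge; first by apply: cvgP lim0.
apply: nearW => j; have [u1 u2] := uL j; have hu := (hart_bound u1 u2).1.
have h1 : n2 h <= n2 (fun x => hart (u j) x - h x) + n2 (hart (u j)).
  have := n2B hu (L2B hu hL); rewrite addrC.
  by under [X in n2 X <= _ -> _]eq_fun do rewrite opprB addrC subrK.
have h2 : n2 (u j) <= n2 (fun x => u j x - f x) + n2 f.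
  have := n2D (L2B u2 fL) fL.
  by under [X in n2 X <= _ -> _]eq_fun do rewrite subrK.
apply: le_trans h1 _; rewrite -addrA lerD2l -mulrDr.
apply: le_trans (hart_n2_le u1 u2) _.
by rewrite ler_wpM2l.
Qed.

Lemma is_hart_unique f g h k : is_hart f h -> is_hart g k ->
  {ae mu, forall x, f x = g x} -> {ae mu, forall x, h x = k x}.
Proof.
move=> fh gk fg; have d := is_hartB fh gk.
have [fL hL _] := fh; have [gL kL _] := gk.
have : n2 (fun x => h x - k x) = 0.
  apply/eqP; rewrite eq_le n2_ge0 andbT; apply: le_trans (is_hart_bound d) _.
  rewrite (_ : n2 _ = 0) ?mulr0//; apply: n2_ae0; first exact: L2_measurable (L2B fL gL).
  by apply: filterS fg => x ->; rewrite subrr.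
move/(n2_eq0 (L2B hL kL)); apply: filterS => x /eqP; rewrite subr_eq0 => /eqP //.
Qed.

Lemma is_hart_ae f g h k : is_hart f h -> measurable_fun setT g -> measurable_fun setT k ->
  {ae mu, forall x, f x = g x} -> {ae mu, forall x, h x = k x} -> is_hart g k.
Proof.
move=> [fL hL [u [uL uf uh]]] mg mk fg hk.
split; [exact: L2_ae fg|exact: L2_ae hk|exists u; split => //].
- rewrite (_ : (fun j => _) = fun j => n2 (fun x => u j x - f x))//.
  apply/funext => j; apply: n2_ae.
  + by apply: measurable_funB => //; exact: L2_measurable (uL j).2.
  + exact: L2_measurable (L2B (uL j).2 fL).
  + by apply: filterS fg => x ->.
- rewrite (_ : (fun j => _) = fun j => n2 (fun x => hart (u j) x - h x))//.
  apply/funext => j; apply: n2_ae.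
  + by apply: measurable_funB => //; apply: measurable_hart; exact: L2_measurable (uL j).2.
  + by apply: measurable_funB; [apply: measurable_hart; exact: L2_measurable (uL j).2|exact: L2_measurable hL].
  + by apply: filterS hk => x ->.
Qed.

Lemma sub_cube (k l : nat) : (k <= l)%N -> @cube R n k `<=` cube l.
Proof.
move=> kl x h i; have := h i; rewrite !in_itv/= => /andP[h1 h2].
by rewrite (le_lt_trans _ h1) ?lerN2 ?ler_nat// (le_trans h2)// ler_nat.
Qed.

Lemma L1_indic_cube f k : L2 f -> L1 (fun x => f x * \1_(cube k) x) /\ L2 (fun x => f x * \1_(cube k) x).
Proof.
move=> fL; have mc : measurable (@cube R n k) by exact: measurable_box.
split; first by apply: L2_mul_integrable => //; apply: L2_indic => //; exact: box_measure_lty.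
apply: (L2_le _ fL); first by apply: measurable_funM; [exact: L2_measurable fL|exact: measurable_indic].
move=> x; rewrite normrM indicE ler_piMr//.
by case: (_ \in _); rewrite ?normr1 ?normr0.
Qed.

Lemma n2_dominated (u : nat -> T -> R) f g : (forall k, measurable_fun setT (u k)) ->
  measurable_fun setT f -> L2 g -> (forall k x, `|u k x - f x| <= `|g x|) ->
  {ae mu, forall x, u k x @[k --> \oo] --> f x} ->
  n2 (fun x => u k x - f x) @[k --> \oo] --> 0.
Proof.
move=> mu_ mf gL ug uf.
have mB k : measurable_fun setT (fun x => u k x - f x) by exact: measurable_funB.
have dL k : L2 (fun x => u k x - f x) by apply: (L2_le _ gL).
have gi : mu.-integrable setT (fun x => (g x ^+ 2)%:E) by exact: Lfun2_integrable_sqr.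
have m2 k : measurable_fun setT (fun x => ((u k x - f x) ^+ 2)%:E).
  by apply: mEFin; exact: measurable_funX.
have [||_ _] := @dominated_convergence _ _ _ mu setT measurableT
  (fun k x => ((u k x - f x) ^+ 2)%:E) (fun=> 0%E) (fun x => (g x ^+ 2)%:E) m2 (measurable_cst _)
  _ gi _.
- apply: filterS uf => x ux _; apply: cvg_EFin; first exact: nearW.
  rewrite -(mulr0 0) -(subrr (f x)); apply: cvgM; apply: cvgB => //; exact: cvg_cst.
- apply: aeW => x k _; rewrite abse_EFin lee_fin ger0_norm ?sqr_ge0//.
  by rewrite -[X in X <= _]real_normK ?num_real// -[X in _ <= X]real_normK ?num_real// lerXn2r ?nnegrE.
rewrite integral0 => h.
have {}h : n2 (fun x => u k x - f x) ^+ 2 @[k --> \oo] --> 0.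
  have /fine_cvgP[_] := h; apply: cvg_trans; apply: near_eq_cvg; apply: nearW => k /=.
  by rewrite -/(sqnorm mu (fun x => u k x - f x)) sqnE.
have : Num.sqrt (n2 (fun x => u k x - f x) ^+ 2) @[k --> \oo] --> Num.sqrt 0.
  by apply: continuous_cvg => //; exact: sqrt_continuous.
rewrite sqrtr0; apply: cvg_trans; apply: near_eq_cvg; apply: nearW => k /=.
by rewrite sqrtr_sqr ger0_norm// n2_ge0.
Qed.

Lemma n2_cube f : L2 f -> n2 (fun x => f x * \1_(cube k) x - f x) @[k --> \oo] --> 0.
Proof.
move=> fL; have mf := L2_measurable fL.
apply: (n2_dominated _ mf fL).
- by move=> k; exact: L2_measurable (L1_indic_cube k fL).2.
- move=> k x; rewrite indicE; case: (x \in _); rewrite ?mulr1 ?mulr0 ?subrr ?normr0// sub0r normrN//.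
apply: aeW => x.
have : (\bigcup_k @cube R n k) x by rewrite bigcup_box.
move=> [N _ Nx]; apply: (cvg_near_cst); exists N => // k /= Nk.
by rewrite indicE mem_set ?mulr1//; exact: sub_cube Nk _ Nx.
Qed.

(** The transforms of the truncations of [f] to cubes form a Cauchy sequence
    by the Plancherel bound. *)
Lemma is_hart_exists f : L2 f -> exists h, is_hart f h.
Proof.
move=> fL; pose u k x := f x * \1_(cube k) x.
have uL k := L1_indic_cube k fL.
have hL k := (hart_bound (uL k).1 (uL k).2).1.
have C0 : 0 <= C by exact: sqrtr_ge0.
have uf := n2_cube fL.
have [h hhL hh] : exists2 h, L2 h & n2 (fun x => hart (u k) x - h x) @[k --> \oo] --> 0.
  apply: L2_complete => // e e0.
  have e1 : 0 < e / (2 * (C + 1)) by rewrite divr_gt0// mulr_gt0// ltr_wpDl.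
  have /cvgr0Pnorm_le /(_ _ e1) [N _ NP] := uf.
  exists N => k l Nk Nl.
  have := hart_n2_le (L1B (uL k).1 (uL l).1) (L2B (uL k).2 (uL l).2).
  rewrite (_ : hart _ = fun x => hart (u k) x - hart (u l) x); last first.
    by apply/funext => x; rewrite hartB//; [exact: (uL k).1|exact: (uL l).1].
  move=> /le_trans; apply.
  have := n2_triangle (uL k).2 fL (uL l).2.
  have := NP k Nk; have := NP l Nl; rewrite /= !ger0_norm ?n2_ge0//.
  rewrite [X in _ -> _ -> _ <= _ + X -> _]n2BC -/(u k) -/(u l).
  set a := n2 _; set b := n2 _; set t := n2 _ => ha hb ht.
  have : t <= e / (C + 1).
    by apply: le_trans ht _; apply: le_trans (lerD hb ha) _; rewrite le_eqVlt; apply/orP; left; apply/eqP; field; rewrite gt_eqF// ltr_wpDl.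
  rewrite ler_pdivlMr; last by rewrite ltr_wpDl.
  have t0 : 0 <= t by exact: n2_ge0.
  rewrite mulrC mulrDl mul1r; lra.
by exists h; split => //; exists u; split.
Qed.

Lemma integral_n2_cvg0 (u : nat -> T -> R) f g : (forall k, L2 (u k)) -> L2 f -> L2 g ->
  n2 (fun x => u k x - f x) @[k --> \oo] --> 0 ->
  fine (\int[mu]_x (u k x * g x)%:E)%E @[k --> \oo] --> fine (\int[mu]_x (f x * g x)%:E)%E.
Proof.
move=> uL fL gL uf.
apply/cvgrPdist_le => /= e e0.
have e1 : 0 < e / (n2 g + 1) by rewrite divr_gt0// ltr_wpDl ?n2_ge0.
have /cvgr0Pnorm_le /(_ _ e1) := uf; apply: filterS => k; rewrite ger0_norm ?n2_ge0// => hk.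
have i1 := L2_mul_integrable fL gL.
have i2 := L2_mul_integrable (uL k) gL.
have i3 := L2_mul_integrable (L2B fL (uL k)) gL.
rewrite -lee_fin -abse_EFin EFinB !fineK ?integrable_fin_num//.
rewrite -integralB//.
have -> : (\int[mu]_x ((EFin \o (fun x => f x * g x)%R) x - (EFin \o (fun x => u k x * g x)%R) x) =
    \int[mu]_x ((f x - u k x) * g x)%:E)%E.
  by apply: eq_integral => x _; rewrite /= -EFinB mulrBl.
apply: (le_trans (le_abse_integral _ measurableT (measurable_int _ i3))).
apply: (le_trans (cauchy_schwarz (L2B fL (uL k)) gL)).
rewrite lee_fin n2BC.
apply: (@le_trans _ _ (e / (n2 g + 1) * n2 g)); first by rewrite ler_wpM2r ?n2_ge0.
rewrite -mulrA ger_pMr//.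
by rewrite mulrC ler_pdivrMr ?ltr_wpDl ?n2_ge0// mul1r lerDl.
Qed.

Lemma cvg_fine_eq (w : nat -> R) (a b : \bar R) : a \is a fin_num -> b \is a fin_num ->
  w k @[k --> \oo] --> fine a -> w k @[k --> \oo] --> fine b -> a = b.
Proof.
move=> fa fb wa wb; rewrite -(fineK fa) -(fineK fb); congr EFin.
by rewrite -(cvg_lim (@Rhausdorff R) wa) -(cvg_lim (@Rhausdorff R) wb).
Qed.

(** Parseval's symmetry, by density from the integrable case. *)
Lemma is_hart_symmetric f g h k : is_hart f h -> is_hart g k ->
  (\int[mu]_x (h x * g x)%:E = \int[mu]_x (f x * k x)%:E)%E.
Proof.
move=> [fL hL [u [uL uf uh]]] [gL kL [v [vL vg vk]]].
have huL j := (hart_bound (uL j).1 (uL j).2).1.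
have hvL j := (hart_bound (vL j).1 (vL j).2).1.
have step j : (\int[mu]_x (h x * v j x)%:E = \int[mu]_x (f x * hart (v j) x)%:E)%E.
  have c1 := integral_n2_cvg0 huL hL (vL j).2 uh.
  have c2 := integral_n2_cvg0 (fun i => (uL i).2) fL (hvL j) uf.
  have e12 : (fun i => fine (\int[mu]_x (hart (u i) x * v j x)%:E)%E) =
      (fun i => fine (\int[mu]_x (u i x * hart (v j) x)%:E)%E).
    by apply/funext => i; rewrite hart_symmetric//; [exact: (uL i).1|exact: (vL j).1].
  rewrite e12 in c1.
  apply: (cvg_fine_eq _ _ c1 c2); apply: integrable_fin_num => //;
    apply: L2_mul_integrable => //; exact: (vL j).2.
have swap a b : (\int[mu]_x (a x * b x)%:E = \int[mu]_x (b x * a x)%:E)%E.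
  by apply: eq_integral => x _; rewrite mulrC.
have c1 := integral_n2_cvg0 (fun i => (vL i).2) gL hL vg.
have c2 := integral_n2_cvg0 hvL kL fL vk.
have e12 : (fun i => fine (\int[mu]_x (v i x * h x)%:E)%E) =
    (fun i => fine (\int[mu]_x (hart (v i) x * f x)%:E)%E).
  by apply/funext => i; rewrite swap step swap.
rewrite e12 in c1.
rewrite [RHS]swap [LHS]swap; apply: (cvg_fine_eq _ _ c1 c2); apply: integrable_fin_num => //;
  exact: L2_mul_integrable.
Qed.

(** Inversion on the indicator of a box, where the convolution with the
    Poisson kernel is a product of differences of arctangents. *)
Lemma integral_box_KP e a b x : 0 < e -> (forall i, a i < b i) ->
  (\int[mu]_y (\1_(box a b) y * KP e (tsub x y))%:E =
   (\prod_(i < n) (2 * (atan ((b i - tnth x i) / e) - atan ((a i - tnth x i) / e))))%:E)%E.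
Proof.
move=> e0 ab.
pose g (i : 'I_n) (y : measurableTypeR R) : R :=
  \1_(`]a i, b i]%classic) y * (2 * e / (e ^+ 2 + ((tnth x i : R) - y) ^+ 2)).
have mg i : measurable_fun setT (g i).
  apply: measurable_funM; first by apply: measurable_indic; exact: measurable_itv.
  apply: (measurableT_comp (measurable_KP1 e0)).
  by apply: measurable_funB.
transitivity (\int[mu]_y (\prod_(i < n) g i (tnth y i))%:E)%E.
  apply: eq_integral => y _; congr EFin; rewrite /g big_split/=; congr (_ * _); last first.
    by apply: eq_bigr => i _; rewrite tnth_mktuple.
  have [yb|yb] := pselect (box a b y).
    rewrite indicE mem_set// big1// => i _; rewrite indicE mem_set//; exact: yb.
  rewrite indicE memNset//; move/existsNP : yb => [i yi].
  rewrite (bigD1 i)//= indicE memNset ?mul0r//.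
rewrite ge0_integral_prod_coord//; last first.
  by move=> i y; rewrite mulr_ge0// divr_ge0 ?mulr_ge0 ?addr_ge0 ?sqr_ge0// ltW.
rewrite -prod_EFin; apply: eq_bigr => i _.
rewrite -(integral_cauchy_itv (tnth x i) e0 (ab i)) [RHS]integral_mkcond.
apply: eq_integral => y _; rewrite /g /patch indicE.
by case: (y \in _); rewrite ?mul1r ?mul0r.
Qed.

Lemma atan_div_cvg (c : R) : c != 0 ->
  atan (c / eps R k) @[k --> \oo] --> Num.sg c * (pi / 2).
Proof.
have pos (z : R) : 0 < z -> atan (z / eps R k) @[k --> \oo] --> pi / 2.
  move=> z0; apply: (@cvg_comp _ _ _ (fun k => z / eps R k) (@atan R) _ +oo); last exact: cvgy_atan.
  have h : z * (k + 1)%:R @[k --> \oo] --> +oo.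
    apply: (@cvg_comp _ _ _ (fun k : nat => (k + 1)%:R : R) (fun y : R => z * y) _ (pinfty_nbhs R)).
      by apply/cvgrnyP; exact: cvg_addnr.
    by apply: gt0_cvgMry => //; exact: cvg_id.
  apply: cvg_trans h; apply: near_eq_cvg; apply: nearW => k.
  by rewrite /eps invrK addn1.
rewrite neq_lt => /orP[c0|c0]; last by rewrite gtr0_sg// mul1r; exact: pos.
have h : atan (- c / eps R k) @[k --> \oo] --> pi / 2 by apply: pos; rewrite oppr_gt0.
have hN : - atan (- c / eps R k) @[k --> \oo] --> - (pi / 2) by exact: cvgN.
rewrite ltr0_sg// mulN1r; apply: cvg_trans hN; apply: near_eq_cvg; apply: nearW => k.
by rewrite /= mulNr atanN opprK.
Qed.

Lemma cvg_prodr (m : nat) (F : nat -> 'I_m -> R) (l : 'I_m -> R) :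
  (forall i, F k i @[k --> \oo] --> l i) ->
  \prod_(i < m) F k i @[k --> \oo] --> \prod_(i < m) l i.
Proof.
elim: m F l => [|m IHm] F l Fl.
  by under eq_fun do rewrite big_ord0; rewrite big_ord0; exact: cvg_cst.
under eq_fun do rewrite big_ord_recl; rewrite big_ord_recl.
by apply: cvgM => //; exact: (IHm (fun k i => F k (lift ord0 i))).
Qed.

Lemma box_KP_cvg a b x : (forall i, a i < b i) ->
  (forall i, (tnth x i : R) != a i) -> (forall i, (tnth x i : R) != b i) ->
  \prod_(i < n) (2 * (atan ((b i - tnth x i) / eps R k) - atan ((a i - tnth x i) / eps R k)))
    @[k --> \oo] --> (2 * pi) ^+ n * \1_(box a b) x.
Proof.
move=> ab xa xb.
have -> : (2 * pi) ^+ n * \1_(box a b) x =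
    \prod_(i < n) (2 * (Num.sg (b i - tnth x i) * (pi / 2) - Num.sg (a i - tnth x i) * (pi / 2))).
  have [yb|yb] := pselect (box a b x).
    rewrite indicE mem_set// mulr1 -[in LHS](card_ord n) -prodr_const; apply: eq_bigr => i _.
    have := yb i; rewrite in_itv/= => /andP[h1 h2].
    have h3 : (tnth x i : R) < b i by rewrite lt_neqAle xb.
    by rewrite gtr0_sg ?subr_gt0// ltr0_sg ?subr_lt0//; field.
  rewrite indicE memNset// mulr0; move/existsNP : yb => [i yi].
  rewrite (bigD1 i)//= -mulrBl; set s := Num.sg _ - Num.sg _.
  suff -> : s = 0 by rewrite mul0r mulr0 mul0r.
  move: yi => /negP; rewrite in_itv/= negb_and -leNgt -ltNge /s => /orP[h|h].
    have xai : (tnth x i : R) < a i by rewrite lt_neqAle xa h.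
    by rewrite !gtr0_sg ?subrr ?subr_gt0// (lt_trans xai).
  by rewrite !ltr0_sg ?subrr ?subr_lt0// (lt_trans (ab i)).
apply: cvg_prodr => i; apply: cvgM; first exact: cvg_cst.
by apply: cvgB; apply: atan_div_cvg; rewrite subr_eq0 eq_sym.
Qed.

Lemma ae_coord_neq (c : 'I_n -> R) : {ae mu, forall x, forall i, (tnth x i : R) != c i}.
Proof.
have h (i : 'I_n) : {ae mu, forall x, (tnth x i : R) != c i}.
  pose A (j : 'I_n) : set (measurableTypeR R) := if j == i then [set c i] else setT.
  have mA j : measurable (A j) by rewrite /A; case: ifP.
  exists [set x | forall j, A j (tnth x j)]; split.
  - rewrite (_ : [set x | _] =
      \bigcap_(j in [set: 'I_n]) ((fun y : T => tnth y j) @^-1` A j)).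
      apply: fin_bigcap_measurable => [|j _]; first exact: finite_finset.
      by rewrite -[X in measurable X]setTI; exact: (@measurable_tnth _ (measurableTypeR R)).
    by apply/seteqP; split=> y /= Ay j => [_|]; exact: Ay.
  - by rewrite lebesgueRn_box// (bigD1 i)//= /A eqxx lebesgue_measure_set1 mul0e.
  - move=> x /= /negP; rewrite negbK => /eqP xi j; rewrite /A; case: eqP => [->|//].
    exact: xi.
have := @ae_foralln _ _ _ mu (fun m x => forall i : 'I_n, i = m :> nat -> (tnth x i : R) != c i) _.
move=> H; apply: filterS (H _) => [x xc i|m]; first exact: xc.
have [mn|nm] := ltnP m n; last first.
  by apply: aeW => x i im; have := ltn_ord i; rewrite im ltnNge nm.
apply: filterS (h (Ordinal mn)) => x hx i im.
by have -> : i = Ordinal mn by exact: val_inj.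
Qed.

Lemma box_ge a b : ~ (forall i, a i < b i) -> box a b = set0 :> set T.
Proof.
move/existsNP => [i /negP]; rewrite -leNgt => ba; apply/seteqP; split => // x /(_ i).
by rewrite in_itv/= => /andP[h1 h2]; have := lt_le_trans h1 (le_trans h2 ba); rewrite ltxx.
Qed.

(** The damped inversion formula at a box is explicit; it tends to the
    indicator away from the faces of the box, and in L2 to the double
    transform [k]. *)
Lemma hart_box a b h k : (forall i, a i < b i) -> is_hart (\1_(box a b)) h -> is_hart h k ->
  {ae mu, forall x, k x = (2 * pi) ^+ n * \1_(box a b) x}.
Proof.
move=> ab fh hk.
have fL2 : L2 (\1_(box a b)) by apply: L2_indic; [exact: measurable_box|exact: box_measure_lty].
have fL1 : L1 (\1_(box a b)).
  have := L2_mul_integrable fL2 fL2.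
  rewrite (_ : (fun x => _ * _) = \1_(box a b))//; apply/funext => x.
  by rewrite indicE; case: (_ \in _); rewrite ?mulr1 ?mulr0.
have [_ hL [phi [phiL _ _]]] := fh; have [_ kL _] := hk.
have hE := is_hart_unique fh (is_hart_L1 fL1 fL2) (aeW _ (fun=> erefl)).
pose H := hart (\1_(box a b) : T -> R).
have HL : L2 H := (hart_bound fL1 fL2).1.
have mH := L2_measurable HL.
have Hk : is_hart H k by apply: (is_hart_ae hk _ _ hE) => //; [exact: L2_measurable kL|exact: aeW].
pose u (j : nat) xi := kP (1 * eps R j) xi * H xi.
have e0 j : 0 < 1 * eps R j by rewrite mul1r eps_gt0.
have uL1 j : L1 (u j) := L1_hart_mul (integrable_kP n (e0 j)) fL1.
have mu_ j := L1_measurable (uL1 j).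
have bu j x : `|u j x| <= `|H x|.
  by rewrite normrM ger0_norm ?kP_ge0// ler_piMl// kP_le1// ltW.
have uL2 j : L2 (u j) by apply: (L2_le _ HL).
have uH : n2 (fun x => u j x - H x) @[j --> \oo] --> 0.
  apply: (n2_dominated _ mH HL) => //.
    move=> j x; rewrite /u -{2}[H x]mul1r -mulrBl normrM ler_piMl//.
    have := kP_le1 x (ltW (e0 j)); have := kP_ge0 (1 * eps R j) x.
    by move: (kP _ _) => t t0 t1; rewrite ler0_norm ?subr_le0// opprB gerBl.
  apply: aeW => x; rewrite -[X in _ --> X]mul1r; apply: cvgM; last exact: cvg_cst.
  exact: kP_cvg1.
have huk : n2 (fun x => hart (u j) x - k x) @[j --> \oo] --> 0.
  have c0 : C * n2 (fun x => u j x - H x) @[j --> \oo] --> 0.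
    by rewrite -(mulr0 C); apply: cvgM => //; exact: cvg_cst.
  apply: (squeeze_cvgr _ (cvg_cst 0) c0); apply: nearW => j; rewrite n2_ge0/=.
  exact: is_hart_bound (is_hartB (is_hart_L1 (uL1 j) (uL2 j)) Hk).
have hux : {ae mu, forall x, hart (u j) x @[j --> \oo] --> (2 * pi) ^+ n * \1_(box a b) x}.
  have := ae_coord_neq a; apply: filterS2 (ae_coord_neq b) => x xb xa.
  have := box_KP_cvg ab xa xb; apply: cvg_trans; apply: near_eq_cvg; apply: nearW => j.
  by apply: EFin_inj; rewrite hart_kP_hart// integral_box_KP// mul1r.
have mh j : measurable_fun setT (hart (u j)) by apply: measurable_hart.
have mB j : measurable_fun setT (fun x => hart (u j) x - k x).
  by apply: measurable_funB => //; exact: L2_measurable kL.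
have mbox : measurable_fun setT (fun x : T => (2 * pi : R) ^+ n * \1_(box a b) x).
  by apply: measurable_funM => //; apply: measurable_indic; exact: measurable_box.
have mB' : measurable_fun setT (fun x => (2 * pi : R) ^+ n * \1_(box a b) x - k x).
  by apply: measurable_funB => //; exact: L2_measurable kL.
suff : sqnorm mu (fun x => (2 * pi) ^+ n * \1_(box a b) x - k x)%R = 0%E.
  by move/(sqn_ae0 mB'); apply: filterS => x /eqP; rewrite subr_eq0 => /eqP.
apply/eqP; rewrite eq_le sqn_ge0 andbT.
apply: (le_trans (fatou_sqn mB mB' _)).
  by apply: filterS hux => x hx; apply: cvgB => //; exact: cvg_cst.
have c2 : sqnorm mu (fun x => hart (u j) x - k x)%R @[j --> \oo] --> 0%E.
  have huL j := (hart_bound (uL1 j) (uL2 j)).1.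
  have -> : (fun j => sqnorm mu (fun x => hart (u j) x - k x)%R) =
      (fun j => (n2 (fun x => hart (u j) x - k x) ^+ 2)%:E).
    by apply/funext => j; rewrite sqnE//; exact: L2B.
  apply: cvg_EFin; first exact: nearW.
  by rewrite -(mulr0 0); apply: cvgM.
rewrite is_cvg_limn_einfE; last by apply/cvg_ex; eexists; exact: c2.
by rewrite (cvg_lim _ c2).
Qed.

(** Tested against the indicator of a box, the double transform moves onto the
    indicator by symmetry, where inversion is [hart_box]; boxes determine a
    square-integrable function. *)
Theorem is_hartK f h : is_hart f h -> is_hart h (fun x => (2 * pi) ^+ n * f x).
Proof.
move=> fh; have [fL hL _] := fh.
have [k hk] := is_hart_exists hL; have [_ kL _] := hk.
have cfL : L2 (fun x => (2 * pi) ^+ n * f x) by exact: L2Z.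
apply: (is_hart_ae hk (L2_measurable hL) (L2_measurable cfL)); first exact: aeW.
have dL := L2B kL cfL.
suff : {ae mu, forall x, k x - (2 * pi) ^+ n * f x = 0}.
  by apply: filterS => x /eqP; rewrite subr_eq0 => /eqP.
apply: box_ae0 => // a b.
have bL : L2 (\1_(box a b)) by apply: L2_indic; [exact: measurable_box|exact: box_measure_lty].
have [g bg] := is_hart_exists bL; have [_ gL _] := bg.
have [g' gg'] := is_hart_exists gL; have [_ gL' _] := gg'.
have [ab|/box_ge nab] := pselect (forall i, a i < b i); last first.
  by rewrite nab; under eq_integral do rewrite indic0 mulr0; rewrite integral0.
have g'E := hart_box ab bg gg'.
have i1 := L2_mul_integrable kL bL.
have i2 := L2_mul_integrable cfL bL.
transitivity (\int[mu]_x ((k x * \1_(box a b) x)%:E - ((2 * pi) ^+ n * f x * \1_(box a b) x)%:E))%E.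
  by apply: eq_integral => x _; rewrite mulrBl.
rewrite integralB// (is_hart_symmetric hk bg) (is_hart_symmetric fh gg').
have i3 := L2_mul_integrable fL gL'.
have -> : (\int[mu]_x (f x * g' x)%:E = \int[mu]_x ((2 * pi) ^+ n * f x * \1_(box a b) x)%:E)%E.
  apply: ae_eq_integral => //; [exact: measurable_int i3|exact: measurable_int i2|].
  by apply: filterS g'E => x -> _; congr EFin; ring.
by apply: subee; exact: integrable_fin_num.
Qed.

End hartley_L2.

(** * The Fourier transform of complex functions in terms of Hartley transforms *)

Section fourier_hartley.
Variables (R : realType) (n : nat).
Local Notation T := (Rn R n).
Local Notation mu := (lebesgueRn R n).
Local Notation L1 f := (mu.-integrable setT (EFin \o f)).
Local Notation L2 f := (f \in Lfun mu 2%:E).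
Local Notation n2 := (norm2 mu).
Local Notation sqn := (sqnorm mu).
Local Open Scope complex_scope.
Implicit Types (f g h : T -> R) (F G : T -> R[i]) (x y xi : T) (e : R).

(** cos and sin are the even and the odd part of cas. Hence the Fourier
    transform of a complex function is [four] of the Hartley transforms of its
    real and imaginary parts. *)
Definition evenp h xi : R := (h xi + h (tneg xi)) / 2.
Definition oddp h xi : R := (h xi - h (tneg xi)) / 2.
Definition four h k xi : R[i] := (evenp h xi + oddp k xi) +i* (evenp k xi - oddp h xi).
Definition Ref F x : R := complex.Re (F x).
Definition Imf F x : R := complex.Im (F x).

Lemma hart_neg f xi : L1 f ->
  [/\ fine (\int[mu]_x (f x * cos (dot x xi))%:E)%E = evenp (hart f) xi &
      fine (\int[mu]_x (f x * sin (dot x xi))%:E)%E = oddp (hart f) xi].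
Proof.
move=> fL.
have cL := L1_cos xi fL; have sL := L1_sin xi fL.
set A := fine _; set B := fine _.
have h1 : hart f xi = A + B.
  apply: EFin_inj; rewrite -hartE// EFinD !fineK; [|exact: integrable_fin_num..].
  rewrite -integralD//.
  by apply: eq_integral => x _; rewrite /cas mulrDr EFinD.
have h2 : hart f (tneg xi) = A - B.
  apply: EFin_inj; rewrite -hartE// EFinB !fineK; [|exact: integrable_fin_num..].
  rewrite -integralB//.
  by apply: eq_integral => x _; rewrite /cas dotNr cosN sinN mulrDr mulrN EFinB.
by rewrite /evenp /oddp h1 h2; split; field.
Qed.

Lemma fourierL1E F xi : L1 (Ref F) -> L1 (Imf F) ->
  fourierL1 F xi = four (hart (Ref F)) (hart (Imf F)) xi.
Proof.
move=> L1r L1i; have [c1 s1] := hart_neg xi L1r; have [c2 s2] := hart_neg xi L1i.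
have cL f := @L1_cos R n f xi; have sL f := @L1_sin R n f xi.
have fin f : L1 f -> (\int[mu]_x (f x)%:E \is a fin_num)%E by move=> ?; exact: integrable_fin_num.
rewrite /fourierL1 /four -c1 -s1 -c2 -s2 /Rintegral; congr (_ +i* _).
- rewrite -fineD; [|exact: fin (cL _ L1r)|exact: fin (sL _ L1i)]; congr fine.
  rewrite -integralD//; [|exact: cL|exact: sL].
  apply: eq_integral => x _; rewrite -EFinD; congr EFin; rewrite /Ref /Imf.
  by case: (F x) => a b /=; ring.
- rewrite -fineB; [|exact: fin (cL _ L1i)|exact: fin (sL _ L1r)]; congr fine.
  rewrite -integralB//; [|exact: cL|exact: sL].
  apply: eq_integral => x _; rewrite -EFinB; congr EFin; rewrite /Ref /Imf.
  by case: (F x) => a b /=; ring.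
Qed.

Lemma measurable_evenp h : measurable_fun setT h -> measurable_fun setT (evenp h).
Proof.
move=> mh; apply: measurable_funM => //; apply: measurable_funD => //.
exact: (measurableT_comp mh (@measurable_tneg R n)).
Qed.

Lemma measurable_oddp h : measurable_fun setT h -> measurable_fun setT (oddp h).
Proof.
move=> mh; apply: measurable_funM => //; apply: measurable_funB => //.
exact: (measurableT_comp mh (@measurable_tneg R n)).
Qed.

Lemma normc_sqr (z : R[i]) : Normc.normc z ^+ 2 = complex.Re z ^+ 2 + complex.Im z ^+ 2.
Proof. by case: z => a b /=; rewrite sqr_sqrtr// addr_ge0// sqr_ge0. Qed.

Definition sqc F : \bar R := (\int[mu]_x (Ref F x ^+ 2 + Imf F x ^+ 2)%:E)%E.

Lemma normL2E F : normL2 F = (sqc F `^ 2^-1)%E.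
Proof.
rewrite /normL2 unlock /sqc; congr (_ `^ _)%E; apply: eq_integral => x _.
by rewrite /= powR_mulrn ?normr_ge0// real_normK ?num_real// normc_sqr.
Qed.

Lemma sqcE F : measurable_fun setT (Ref F) -> measurable_fun setT (Imf F) ->
  sqc F = (sqn (Ref F) + sqn (Imf F))%E.
Proof.
move=> m1 m2; rewrite /sqc /sqnorm -ge0_integralD//.
- by move=> x _; rewrite lee_fin sqr_ge0.
- by apply: mEFin; exact: measurable_funX.
- by move=> x _; rewrite lee_fin sqr_ge0.
- by apply: mEFin; exact: measurable_funX.
Qed.

(** The cross terms are odd, so they disappear against an even weight. *)
Lemma sqc_four (w : T -> R) h k : measurable_fun setT w -> measurable_fun setT h ->
  measurable_fun setT k -> (forall xi, w (tneg xi) = w xi) ->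
  sqc (fun xi => (w xi)%:C * four h k xi) =
  (sqn (fun xi => w xi * h xi)%R + sqn (fun xi => w xi * k xi)%R)%E.
Proof.
move=> mw mh mk wN.
pose G (xi : T) := ((w xi * h xi) ^+ 2 + (w xi * k xi) ^+ 2)%:E.
pose D (xi : T) := (Ref (fun xi => (w xi)%:C * four h k xi) xi ^+ 2 +
  Imf (fun xi => (w xi)%:C * four h k xi) xi ^+ 2)%:E.
have mwh : measurable_fun setT (fun xi => (w xi * h xi) ^+ 2).
  by apply: measurable_funX; exact: measurable_funM.
have mwk : measurable_fun setT (fun xi => (w xi * k xi) ^+ 2).
  by apply: measurable_funX; exact: measurable_funM.
have DE xi : D xi = ((w xi * (evenp h xi + oddp k xi)) ^+ 2 + (w xi * (evenp k xi - oddp h xi)) ^+ 2)%:E.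
  by rewrite /D /Ref /Imf /= !mul0r subr0 addr0.
have mG : measurable_fun setT G by apply: mEFin; exact: measurable_funD.
have mD : measurable_fun setT D.
  rewrite (_ : D = fun xi => ((w xi * (evenp h xi + oddp k xi)) ^+ 2 + (w xi * (evenp k xi - oddp h xi)) ^+ 2)%:E); last exact/funext.
  apply: mEFin.
  apply: measurable_funD; apply: measurable_funX; apply: measurable_funM => //.
    by apply: measurable_funD; [exact: measurable_evenp|exact: measurable_oddp].
  by apply: measurable_funB; [exact: measurable_evenp|exact: measurable_oddp].
have G0 xi : (0 <= G xi)%E by rewrite lee_fin addr_ge0// sqr_ge0.
have D0 xi : (0 <= D xi)%E by rewrite lee_fin addr_ge0// sqr_ge0.
have mGN := measurableT_comp mG (@measurable_tneg R n).
have mDN := measurableT_comp mD (@measurable_tneg R n).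
have dbl (H : T -> \bar R) : measurable_fun setT H -> (forall xi, (0 <= H xi)%E) ->
    measurable_fun setT (H \o @tneg R n) ->
    (\int[mu]_xi (H xi + H (tneg xi)) = 2%:E * \int[mu]_xi H xi)%E.
  move=> mH H0 mHN; rewrite ge0_integralD// ge0_integralRnN//.
  by rewrite mule_natl mule2n.
have GD : (\int[mu]_xi (D xi + D (tneg xi)) = \int[mu]_xi (G xi + G (tneg xi)))%E.
  apply: eq_integral => xi _; rewrite !DE /G -!EFinD; congr EFin.
  by rewrite /evenp /oddp tnegK !wN; field.
have : (\int[mu]_xi D xi = \int[mu]_xi G xi)%E.
  have := congr1 (fun y : \bar R => ((2^-1)%:E * y)%E) GD.
  by rewrite !dbl// !muleA -!EFinM mulVf// !mul1e.
rewrite /sqc -/D => ->; rewrite /G /sqnorm -ge0_integralD//.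
- by move=> x _; rewrite lee_fin sqr_ge0.
- exact: mEFin.
- by move=> x _; rewrite lee_fin sqr_ge0.
- exact: mEFin.
Qed.

Lemma fourB h k h' k' xi :
  four h k xi - four h' k' xi = four (fun x => h x - h' x) (fun x => k x - k' x) xi.
Proof. by rewrite /four /evenp /oddp /= -[LHS]/(Complex _ _) /=; congr (_ +i* _); field. Qed.

Lemma sqn_tneg h : measurable_fun setT h -> sqn (h \o @tneg R n) = sqn h.
Proof.
move=> mh; rewrite /sqnorm -[RHS]ge0_integralRnN//.
- by apply: mEFin; exact: measurable_funX.
- by move=> x; rewrite lee_fin sqr_ge0.
Qed.

Lemma L2_tneg h : L2 h -> L2 (h \o @tneg R n).
Proof.
move=> /L2P[mh ho]; apply/L2P; split; first exact: (measurableT_comp mh (@measurable_tneg R n)).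
by rewrite sqn_tneg.
Qed.

Lemma L2_evenp h : L2 h -> L2 (evenp h).
Proof.
move=> hL; have := L2Z 2^-1 (L2D hL (L2_tneg hL)).
by under eq_fun do rewrite mulrC.
Qed.

Lemma L2_oddp h : L2 h -> L2 (oddp h).
Proof.
move=> hL; have := L2Z 2^-1 (L2B hL (L2_tneg hL)).
by under eq_fun do rewrite mulrC.
Qed.

Lemma in_Lp_four h k : L2 h -> L2 k -> in_Lp 2 (four h k).
Proof.
move=> hL kL; split.
- exact: (L2D (L2_evenp hL) (L2_oddp kL)).
- exact: (L2B (L2_evenp kL) (L2_oddp hL)).
Qed.

Lemma sqc_four1 h k : measurable_fun setT h -> measurable_fun setT k ->
  sqc (four h k) = (sqn h + sqn k)%E.
Proof.
move=> mh mk; have := @sqc_four (fun=> 1) h k (measurable_cst _) mh mk (fun=> erefl).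
under [X in sqn X]eq_fun do rewrite mul1r.
under [X in (_ + sqn X)%E]eq_fun do rewrite mul1r.
by under eq_fun do rewrite mul1r.
Qed.

Lemma normL2_four_cvg0 (h k : nat -> T -> R) : (forall j, L2 (h j)) -> (forall j, L2 (k j)) ->
  n2 (h j) @[j --> \oo] --> 0 -> n2 (k j) @[j --> \oo] --> 0 ->
  normL2 (four (h j) (k j)) @[j --> \oo] --> 0%E.
Proof.
move=> hL kL h0 k0.
have -> : (fun j => normL2 (four (h j) (k j))) =
    fun j => (Num.sqrt (n2 (h j) ^+ 2 + n2 (k j) ^+ 2))%:E.
  apply/funext => j; rewrite normL2E sqc_four1; [|exact: L2_measurable..].
  rewrite !sqnE// -EFinD poweR_EFin powR12_sqrt// addr_ge0// sqr_ge0//.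
apply: cvg_EFin; first exact: nearW.
rewrite -(sqrtr0 R); apply: continuous_cvg; first exact: sqrt_continuous.
by rewrite -(addr0 0) -{1 2}(mulr0 0); apply: cvgD; exact: cvgM.
Qed.

Lemma Ref_sub F G : Ref (F \- G) = fun x => Ref F x - Ref G x.
Proof. by apply/funext => x; rewrite /Ref /=; case: (F x) (G x) => a b [c d]. Qed.

Lemma Imf_sub F G : Imf (F \- G) = fun x => Imf F x - Imf G x.
Proof. by apply/funext => x; rewrite /Imf /=; case: (F x) (G x) => a b [c d]. Qed.

Lemma in_LpB F G : in_Lp 2 F -> in_Lp 2 G -> in_Lp 2 (F \- G)%R.
Proof.
move=> [F1 F2] [G1 G2]; split.
- by rewrite -/(Ref (F \- G)) Ref_sub; exact: L2B.
- by rewrite -/(Imf (F \- G)) Imf_sub; exact: L2B.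
Qed.

Lemma normL2_parts F : in_Lp 2 F ->
  normL2 F = (Num.sqrt (n2 (Ref F) ^+ 2 + n2 (Imf F) ^+ 2))%:E.
Proof.
move=> [F1 F2]; rewrite normL2E sqcE; [|exact: (L2_measurable F1)|exact: (L2_measurable F2)].
by rewrite !sqnE// -EFinD poweR_EFin powR12_sqrt// addr_ge0// sqr_ge0.
Qed.

Lemma normL2_cvg0P (F : nat -> T -> R[i]) : (forall j, in_Lp 2 (F j)) ->
  normL2 (F j) @[j --> \oo] --> 0%E <->
  (n2 (Ref (F j)) @[j --> \oo] --> 0 /\ n2 (Imf (F j)) @[j --> \oo] --> 0).
Proof.
move=> FL.
have -> : (fun j => normL2 (F j)) =
    fun j => (Num.sqrt (n2 (Ref (F j)) ^+ 2 + n2 (Imf (F j)) ^+ 2))%:E.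
  by apply/funext => j; rewrite normL2_parts.
split=> [/fine_cvgP[_ h]|[h1 h2]].
  split; apply: (squeeze_cvgr _ (cvg_cst 0) h); apply: nearW => j /=; rewrite n2_ge0/=.
    rewrite -{1}[n2 _]ger0_norm ?n2_ge0// -sqrtr_sqr ler_wsqrtr// lerDl sqr_ge0//.
  rewrite -{1}[n2 (Imf _)]ger0_norm ?n2_ge0// -sqrtr_sqr ler_wsqrtr// lerDr sqr_ge0//.
apply: cvg_EFin; first exact: nearW.
rewrite -(sqrtr0 R); apply: continuous_cvg; first exact: sqrt_continuous.
by rewrite -(addr0 0) -{1 2}(mulr0 0); apply: cvgD; exact: cvgM.
Qed.

(** An approximating sequence for each part gives one for [F]. *)
Lemma is_fourier_four F h k : is_hart (Ref F) h -> is_hart (Imf F) k ->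
  is_fourier F (four h k).
Proof.
move=> [F1 hL [u [uL uf uh]]] [F2 kL [v [vL vf vk]]].
split; [by []|exact: in_Lp_four|].
exists (fun j x => u j x +i* v j x).
have E j : Ref (fun x => u j x +i* v j x) = u j /\ Imf (fun x => u j x +i* v j x) = v j by [].
split=> [j||].
- have [u1 u2] := uL j; have [v1 v2] := vL j.
  by split; split => //; apply/Lfun1_integrable.
- apply/normL2_cvg0P.
    by move=> j; apply: in_LpB => //; split; [exact: (uL j).2|exact: (vL j).2].
  by split; [under eq_fun do rewrite Ref_sub|under eq_fun do rewrite Imf_sub].
- have huL j := (hart_bound (uL j).1 (uL j).2).1.
  have hvL j := (hart_bound (vL j).1 (vL j).2).1.
  have := normL2_four_cvg0 (fun j => L2B (huL j) hL) (fun j => L2B (hvL j) kL) uh vk.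
  apply: cvg_trans; apply: near_eq_cvg; apply: nearW => j; congr normL2.
  apply/funext => xi /=; rewrite fourierL1E; [|exact: (uL j).1|exact: (vL j).1].
  by rewrite fourB.
Qed.

(** Whichever sequence defines [g], the transforms along it also converge to
    [four h k], by the Plancherel bound. *)
Lemma fourier_ae F (g : T -> R[i]) h k : is_fourier F g -> is_hart (Ref F) h -> is_hart (Imf F) k ->
  {ae mu, forall xi, g xi = four h k xi}.
Proof.
move=> [FL gL [phi [phiL phiF phig]]] Fh Fk.
have [_ hL _] := Fh; have [_ kL _] := Fk.
have pL j : [/\ L1 (Ref (phi j)), L1 (Imf (phi j)), L2 (Ref (phi j)) & L2 (Imf (phi j))].
  by have [[/Lfun1_integrable ? /Lfun1_integrable ?] [? ?]] := phiL j.
have fphi j : fourierL1 (phi j) = four (hart (Ref (phi j))) (hart (Imf (phi j))).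
  by apply/funext => xi; rewrite fourierL1E//; have [] := pL j.
have hpL j : L2 (hart (Ref (phi j))) /\ L2 (hart (Imf (phi j))).
  by have [a b c d] := pL j; split; [exact: (hart_bound a c).1|exact: (hart_bound b d).1].
have fL := in_Lp_four hL kL.
have fpL j : in_Lp 2 (fourierL1 (phi j)).
  by rewrite fphi; apply: in_Lp_four; [exact: (hpL j).1|exact: (hpL j).2].
have [r0 i0] : n2 (Ref (phi j \- F)) @[j --> \oo] --> 0 /\ n2 (Imf (phi j \- F)) @[j --> \oo] --> 0.
  by apply/normL2_cvg0P => // j; apply: in_LpB => //; exact: (phiL j).2.
pose C : R := Num.sqrt ((2 * pi) ^+ n).
have c0 (w : nat -> T -> R) p q : (forall j, L1 (w j) /\ L2 (w j)) -> is_hart p q ->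
    n2 (fun x => w j x - p x) @[j --> \oo] --> 0 ->
    n2 (fun x => hart (w j) x - q x) @[j --> \oo] --> 0.
  move=> wL pq wp.
  have c0 : C * n2 (fun x => w j x - p x) @[j --> \oo] --> 0.
    by rewrite -(mulr0 C); apply: cvgM => //; exact: cvg_cst.
  apply: (squeeze_cvgr _ (cvg_cst 0) c0); apply: nearW => j; rewrite n2_ge0/=.
  exact: is_hart_bound (is_hartB (is_hart_L1 (wL j).1 (wL j).2) pq).
have a1 : n2 (fun x => hart (Ref (phi j)) x - h x) @[j --> \oo] --> 0.
  apply: c0 Fh _; first by move=> j; have [] := pL j.
  by move: r0; under eq_fun do rewrite Ref_sub.
have a2 : n2 (fun x => hart (Imf (phi j)) x - k x) @[j --> \oo] --> 0.
  apply: c0 Fk _; first by move=> j; have [] := pL j.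
  by move: i0; under eq_fun do rewrite Imf_sub.
have a3 : normL2 (fourierL1 (phi j) \- four h k) @[j --> \oo] --> 0%E.
  have := normL2_four_cvg0 (fun j => L2B (hpL j).1 hL) (fun j => L2B (hpL j).2 kL) a1 a2.
  apply: cvg_trans; apply: near_eq_cvg; apply: nearW => j; congr normL2.
  by apply/funext => xi /=; rewrite fphi fourB.
have [g1 g2] : n2 (Ref (fourierL1 (phi j) \- g)) @[j --> \oo] --> 0 /\
    n2 (Imf (fourierL1 (phi j) \- g)) @[j --> \oo] --> 0.
  by apply/normL2_cvg0P => // j; exact: in_LpB.
have [f1 f2] : n2 (Ref (fourierL1 (phi j) \- four h k)) @[j --> \oo] --> 0 /\
    n2 (Imf (fourierL1 (phi j) \- four h k)) @[j --> \oo] --> 0.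
  by apply/normL2_cvg0P => // j; exact: in_LpB.
have uniq (w : nat -> T -> R) p q : (forall j, L2 (w j)) -> L2 p -> L2 q ->
    n2 (fun x => w j x - p x) @[j --> \oo] --> 0 -> n2 (fun x => w j x - q x) @[j --> \oo] --> 0 ->
    {ae mu, forall x, p x = q x}.
  move=> wL pL' qL wp wq.
  have : n2 (fun x => p x - q x) = 0.
    apply/eqP; rewrite eq_le n2_ge0 andbT.
    have h0 : n2 (fun x => w j x - p x) + n2 (fun x => w j x - q x) @[j --> \oo] --> 0.
      by rewrite -(addr0 0); exact: cvgD.
    rewrite -(cvg_lim (@Rhausdorff R) h0); apply: limr_ge; first by apply: cvgP h0.
    apply: nearW => j; rewrite [X in _ <= X + _]n2BC; exact: n2_triangle.
  by move/(n2_eq0 (L2B pL' qL)); apply: filterS => x /eqP; rewrite subr_eq0 => /eqP.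
have r : {ae mu, forall x, Ref g x = Ref (four h k) x}.
  apply: (uniq (fun j => Ref (fourierL1 (phi j)))); [by move=> j; exact: (fpL j).1|exact: gL.1|exact: fL.1| |].
    by move: g1; under eq_fun do rewrite Ref_sub.
  by move: f1; under eq_fun do rewrite Ref_sub.
have i : {ae mu, forall x, Imf g x = Imf (four h k) x}.
  apply: (uniq (fun j => Imf (fourierL1 (phi j)))); [by move=> j; exact: (fpL j).2|exact: gL.2|exact: fL.2| |].
    by move: g2; under eq_fun do rewrite Imf_sub.
  by move: f2; under eq_fun do rewrite Imf_sub.
apply: filterS2 r i => x; rewrite /Ref /Imf; case: (g x) => a b; case: (four h k x) => c d /=.
by move=> -> ->.
Qed.

Lemma is_fourier_ae F (g g' : T -> R[i]) : is_fourier F g -> in_Lp 2 g' ->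
  {ae mu, forall xi, g xi = g' xi} -> is_fourier F g'.
Proof.
move=> [FL gL [phi [phiL phiF phig]]] g'L gg'; split=> //; exists phi; split=> //.
apply: cvg_trans phig; apply: near_eq_cvg; apply: nearW => j.
have [pr pi'] : in_Lp 2 (fourierL1 (phi j)).
  have [[/Lfun1_integrable a /Lfun1_integrable b] [c d]] := phiL j.
  rewrite (_ : fourierL1 (phi j) = four (hart (Ref (phi j))) (hart (Imf (phi j)))); last first.
    by apply/funext => xi; rewrite fourierL1E.
  by apply: in_Lp_four; [exact: (hart_bound a c).1|exact: (hart_bound b d).1].
have pL : in_Lp 2 (fourierL1 (phi j)) by split.
have [a1 a2] := in_LpB pL gL; have [b1 b2] := in_LpB pL g'L.
rewrite !normL2_parts//; [|exact: in_LpB..].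
congr (Num.sqrt (_ ^+ 2 + _ ^+ 2))%:E; apply: n2_ae.
- exact: (L2_measurable a1).
- exact: (L2_measurable b1).
- by apply: filterS gg' => x; rewrite !Ref_sub => gx; rewrite /Ref gx.
- exact: (L2_measurable a2).
- exact: (L2_measurable b2).
- by apply: filterS gg' => x; rewrite !Imf_sub => gx; rewrite /Imf gx.
Qed.

Lemma is_fourier_exists F : in_Lp 2 F -> is_fourier F (fourier F).
Proof.
move=> [F1 F2]; have [h Fh] := is_hart_exists F1; have [k Fk] := is_hart_exists F2.
rewrite /fourier; apply: xgetPex; exists (four h k); exact: is_fourier_four.
Qed.

(** The weight in the norm of H^{s,r}. *)
Definition wt (s r : R) xi : R := cosh (s * enorm xi) * japanese xi `^ r.

Lemma measurable_enorm : measurable_fun setT (@enorm R n).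
Proof.
apply: (measurableT_comp (continuous_measurable_fun (@sqrt_continuous R))).
rewrite /dot; apply: measurable_sum => i.
by apply: measurable_funM; exact: measurable_coord.
Qed.

Lemma measurable_japanese : measurable_fun setT (@japanese R n).
Proof.
apply: (measurableT_comp (continuous_measurable_fun (@sqrt_continuous R))); apply: measurable_funD => //.
by apply: measurable_funX; exact: measurable_enorm.
Qed.

Lemma measurable_cosh : measurable_fun setT (@cosh R).
Proof.
apply: measurable_funM => //; apply: measurable_funD; first exact: measurable_expR.
by apply: (measurableT_comp (@measurable_expR R)); exact: measurable_funN.
Qed.

Lemma measurable_wt s r : measurable_fun setT (wt s r).
Proof.
apply: measurable_funM.
  apply: (measurableT_comp measurable_cosh); apply: measurable_funM => //.
  exact: measurable_enorm.
by apply: (measurableT_comp (measurable_powR _)); exact: measurable_japanese.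
Qed.

Lemma enormN xi : enorm (tneg xi) = enorm xi.
Proof. by rewrite /enorm dotNr dotNl opprK. Qed.

Lemma wtN s r xi : wt s r (tneg xi) = wt s r xi.
Proof. by rewrite /wt /japanese enormN. Qed.

Lemma normL2_ae F G : measurable_fun setT (Ref F) -> measurable_fun setT (Imf F) ->
  measurable_fun setT (Ref G) -> measurable_fun setT (Imf G) ->
  {ae mu, forall xi, F xi = G xi} -> normL2 F = normL2 G.
Proof.
move=> a b c d FG; rewrite !normL2E !sqcE//; congr ((_ + _) `^ _)%E; apply: sqn_ae => //.
- by apply: filterS FG => x; rewrite /Ref => ->.
- by apply: filterS FG => x; rewrite /Imf => ->.
Qed.

(** By [fourier_ae] the representative chosen by [fourier] does not matter,
    and the weight is even, so [sqc_four] applies. *)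
Lemma normHE s r F h k : is_hart (Ref F) h -> is_hart (Imf F) k ->
  normH s r F = ((sqn (fun xi => wt s r xi * h xi)%R + sqn (fun xi => wt s r xi * k xi)%R) `^ 2^-1)%E.
Proof.
move=> Fh Fk; have [F1 hL _] := Fh; have [F2 kL _] := Fk.
have ff := is_fourier_exists (conj F1 F2); have ae := fourier_ae ff Fh Fk.
have mw := measurable_wt s r.
have [_ [f1 f2] _] := ff; have [g1 g2] := in_Lp_four hL kL.
have mR (G : T -> R[i]) : measurable_fun setT (Ref G) -> measurable_fun setT (Ref (fun xi => (wt s r xi)%:C * G xi)).
  move=> mG; rewrite (_ : Ref _ = fun xi => wt s r xi * Ref G xi); first exact: measurable_funM.
  by apply/funext => xi; rewrite /Ref; case: (G xi) => a b /=; rewrite mul0r subr0.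
have mI (G : T -> R[i]) : measurable_fun setT (Imf G) -> measurable_fun setT (Imf (fun xi => (wt s r xi)%:C * G xi)).
  move=> mG; rewrite (_ : Imf _ = fun xi => wt s r xi * Imf G xi); first exact: measurable_funM.
  by apply/funext => xi; rewrite /Imf; case: (G xi) => a b /=; rewrite mul0r addr0.
rewrite -(sqc_four mw (L2_measurable hL) (L2_measurable kL) (wtN s r)) -normL2E.
apply: normL2_ae.
- apply: mR; exact: (L2_measurable f1).
- apply: mI; exact: (L2_measurable f2).
- apply: mR; exact: (L2_measurable g1).
- apply: mI; exact: (L2_measurable g2).
- by apply: filterS ae => xi ->.
Qed.

Lemma is_hart0 : is_hart (fun _ : T => 0 : R) (fun _ : T => 0 : R).
Proof.
have [h h0] := is_hart_exists (L2_0 mu); have := is_hartB h0 h0.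
under eq_fun do rewrite subrr.
by under [X in is_hart _ X]eq_fun do rewrite subrr.
Qed.

(** [four] is isometric. *)
Lemma four_inj h k h' k' : L2 h -> L2 k -> L2 h' -> L2 k' ->
  {ae mu, forall xi, four h k xi = four h' k' xi} ->
  {ae mu, forall xi, h xi = h' xi} /\ {ae mu, forall xi, k xi = k' xi}.
Proof.
move=> hL kL hL' kL' ae.
have d1 := L2B hL hL'; have d2 := L2B kL kL'.
have s0 : (sqn (fun x => h x - h' x)%R + sqn (fun x => k x - k' x)%R = 0)%E.
  rewrite -sqc_four1; [|exact: (L2_measurable d1)|exact: (L2_measurable d2)].
  have [e1 e2] := in_Lp_four d1 d2.
  rewrite sqcE; [|exact: (L2_measurable e1)|exact: (L2_measurable e2)].
  rewrite (sqnE e1) (sqnE e2) !n2_ae0 ?expr0n ?adde0//=.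
  - exact: (L2_measurable e2).
  - by apply: filterS ae => xi e; have := fourB h k h' k' xi; rewrite e subrr => /(congr1 (@complex.Im R)) /= <-.
  - exact: (L2_measurable e1).
  - by apply: filterS ae => xi e; have := fourB h k h' k' xi; rewrite e subrr => /(congr1 (@complex.Re R)) /= <-.
move: s0 => /eqP; rewrite padde_eq0 ?sqn_ge0// => /andP[/eqP z1 /eqP z2].
split.
- apply: filterS (sqn_ae0 (L2_measurable d1) z1) => x /eqP; rewrite subr_eq0 => /eqP//.
- apply: filterS (sqn_ae0 (L2_measurable d2) z2) => x /eqP; rewrite subr_eq0 => /eqP//.
Qed.

Lemma L2_bounded_mul (a : T -> R) h M : measurable_fun setT a -> (forall xi, `|a xi| <= M) ->
  L2 h -> L2 (fun xi => a xi * h xi).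
Proof.
move=> ma aM hL; apply: (L2_le _ (L2Z M hL)).
  by apply: measurable_funM => //; exact: (L2_measurable hL).
by move=> xi; rewrite !normrM ler_wpM2r// (le_trans (aM xi))// ler_norm.
Qed.

Lemma is_hart_surj h : L2 h -> exists f, is_hart f h.
Proof.
move=> hL; have [g hg] := is_hart_exists hL; exists (fun x => ((2 * pi) ^+ n)^-1 * g x).
have := is_hartZ ((2 * pi) ^+ n)^-1 (is_hartK hg).
under [X in is_hart _ X]eq_fun do rewrite mulrA mulVf ?mul1r ?expf_neq0 ?mulf_neq0 ?gt_eqF ?pi_gt0//.
by [].
Qed.

(** An even multiplier commutes with [four]. Since the Hartley transform is
    surjective, the product is the Fourier transform of some function, so the
    choice made by [multiplier] does satisfy its specification. *)
Lemma multiplier_hart (a : T -> R) F h k M : measurable_fun setT a ->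
  (forall xi, `|a xi| <= M) -> (forall xi, a (tneg xi) = a xi) ->
  is_hart (Ref F) h -> is_hart (Imf F) k ->
  is_hart (Ref (multiplier a F)) (fun xi => a xi * h xi) /\
  is_hart (Imf (multiplier a F)) (fun xi => a xi * k xi).
Proof.
move=> ma aM aN Fh Fk; have [F1 hL _] := Fh; have [F2 kL _] := Fk.
have ff := is_fourier_exists (conj F1 F2); have ae := fourier_ae ff Fh Fk.
have ahL := L2_bounded_mul ma aM hL; have akL := L2_bounded_mul ma aM kL.
have [_ [f1 f2] _] := ff.
have afL : in_Lp 2 (fun xi => (a xi)%:C * fourier F xi).
  split.
  - have := L2_bounded_mul ma aM f1; rewrite (_ : (fun xi => _) = (fun x => complex.Re ((a x)%:C * fourier F x)))//.
    by apply/funext => x; case: (fourier F x) => c d /=; rewrite mul0r subr0.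
  - have := L2_bounded_mul ma aM f2; rewrite (_ : (fun xi => _) = (fun x => complex.Im ((a x)%:C * fourier F x)))//.
    by apply/funext => x; case: (fourier F x) => c d /=; rewrite mul0r addr0.
have aeM : {ae mu, forall xi, four (fun xi => a xi * h xi) (fun xi => a xi * k xi) xi = (a xi)%:C * fourier F xi}.
  apply: filterS ae => xi ->; rewrite /four /evenp /oddp aN /=.
  by rewrite -[RHS]/(Complex _ _) /= !mul0r subr0 addr0; congr (_ +i* _); field.
have [f fh] := is_hart_surj ahL; have [g gk] := is_hart_surj akL.
have fM : is_fourier (multiplier a F) (fun xi => (a xi)%:C * fourier F xi).
  rewrite /multiplier /inv_fourier; apply: (@xgetPex _ (cst 0) [set f | is_fourier f _]).
  exists (fun x => f x +i* g x); apply: is_fourier_ae afL aeM.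
  exact: is_fourier_four.
have [[M1 M2] _ _] := fM.
have [h' Mh] := is_hart_exists M1; have [k' Mk] := is_hart_exists M2.
have aeM' := fourier_ae fM Mh Mk; have [_ h'L _] := Mh; have [_ k'L _] := Mk.
have [e1 e2] : {ae mu, forall xi, h' xi = a xi * h xi} /\ {ae mu, forall xi, k' xi = a xi * k xi}.
  apply: four_inj => //; apply: filterS2 aeM aeM' => xi <- //.
split.
- apply: (is_hart_ae Mh) => //; [exact: (L2_measurable M1)|exact: (L2_measurable ahL)|exact: aeW].
- apply: (is_hart_ae Mk) => //; [exact: (L2_measurable M2)|exact: (L2_measurable akL)|exact: aeW].
Qed.

End fourier_hartley.

(** * Convolution *)

Section convolution.
Variables (R : realType) (n : nat).
Local Notation T := (Rn R n).
Local Notation mu := (lebesgueRn R n).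
Local Open Scope ereal_scope.
Implicit Types (A B p q : T -> \bar R) (x y z : T).

Lemma tsubK y z : tsub (tadd y z) y = z.
Proof. by apply: eq_from_tnth => i; rewrite !tnth_mktuple addrC addKr. Qed.

Lemma tsub_tadd z y : tsub z y = tadd (tneg y) z.
Proof. by apply: eq_from_tnth => i; rewrite !tnth_mktuple addrC. Qed.

Lemma measurable_tsubl z : measurable_fun setT (tsub z).
Proof. exact: (measurableT_comp (@measurable_tsub R n) (pair1_measurable z)). Qed.

Lemma measurable_tsubr y : measurable_fun setT ((@tsub R n)^~ y).
Proof. exact: (measurableT_comp (@measurable_tsub R n) (pair2_measurable y)). Qed.

Lemma ge0_integral_tsubl A z : measurable_fun setT A -> (forall x, 0 <= A x) ->
  \int[mu]_y A (tsub z y) = \int[mu]_y A y.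
Proof.
move=> mA A0.
have mA' : measurable_fun setT (fun y => A (tadd z y)).
  exact: (measurableT_comp mA (@measurable_tadd1 R n z)).
rewrite -(ge0_integralRnD z mA A0) -(ge0_integralRnN mA')//.
by apply: eq_integral => y _; rewrite tsubE.
Qed.

Lemma ge0_integral_tsubr A y : measurable_fun setT A -> (forall x, 0 <= A x) ->
  \int[mu]_z A (tsub z y) = \int[mu]_z A z.
Proof.
move=> mA A0; rewrite -(ge0_integralRnD (tneg y) mA A0).
by apply: eq_integral => z _; rewrite tsub_tadd.
Qed.

Lemma half_mulM (a b : \bar R) : 0 <= a -> 0 <= b -> a * b <= (2^-1)%:E * (a * a + b * b).
Proof.
case: a => [a||]//; case: b => [b||]//; rewrite ?lee_fin => a0 b0.
- rewrite -subr_ge0.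
  have := sqr_ge0 (a - b)%R; rewrite sqrrB; move: a0 b0 => _ _; nra.
- by rewrite mulyy addey// [leRHS]gt0_muley ?lte_fin ?invr_gt0// leey.
- by rewrite mulyy addye// [leRHS]gt0_muley ?lte_fin ?invr_gt0// leey.
- by rewrite mulyy addey// [leRHS]gt0_muley ?lte_fin ?invr_gt0// leey.
Qed.

(** The Cauchy-Schwarz inequality for the measure [p mu], proved by
    integrating [q x * q y <= (q x ^ 2 + q y ^ 2) / 2] twice, so that infinite
    integrals are covered too. *)
Lemma sqr_integral_le p q : measurable_fun setT p -> measurable_fun setT q ->
  (forall x, 0 <= p x) -> (forall x, 0 <= q x) ->
  (\int[mu]_x (p x * q x)) * (\int[mu]_x (p x * q x)) <=
  (\int[mu]_x p x) * \int[mu]_x (p x * (q x * q x)).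
Proof.
move=> mp mq p0 q0; set I := integral _ _ _; set P := (X in _ <= X * _); set Q := (X in _ <= _ * X).
have mpq : measurable_fun setT (fun x => p x * q x) by exact: emeasurable_funM.
have mqq : measurable_fun setT (fun x => q x * q x) by exact: emeasurable_funM.
have mpqq : measurable_fun setT (fun x => p x * (q x * q x)) by exact: emeasurable_funM.
have pq0 x : 0 <= p x * q x by exact: mule_ge0.
have qq0 x : 0 <= q x * q x by exact: mule_ge0.
have pqq0 x : 0 <= p x * (q x * q x) by exact: mule_ge0.
have I0 : 0 <= I by exact: integral_ge0.
have P0 : 0 <= P by exact: integral_ge0.
have Q0 : 0 <= Q by exact: integral_ge0.
have h0 : 0 <= (2^-1)%:E :> \bar R by rewrite lee_fin.
have hh (x : \bar R) : 0 <= x -> (2^-1)%:E * (x + x) = x.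
  case: x => [r||]//= _; first by rewrite -EFinD -EFinM; congr EFin; field.
  by rewrite addye// gt0_muley// lte_fin.
have step y : q y * I <= (2^-1)%:E * (q y * q y * P + Q).
  rewrite -ge0_integralZl// -ge0_integralZl// -ge0_integralD//; last 2 first.
  - by move=> x _; exact: mule_ge0.
  - exact: emeasurable_funM.
  rewrite -ge0_integralZl//; last 2 first.
  - by apply: emeasurable_funD => //; exact: emeasurable_funM.
  - by move=> x _; rewrite adde_ge0// mule_ge0.
  apply: ge0_le_integral => //.
  - by move=> x _; rewrite !mule_ge0.
  - exact: emeasurable_funM.
  - by apply: emeasurable_funM => //; apply: emeasurable_funD => //; exact: emeasurable_funM.
  move=> x _; rewrite [q y * q y * p x]muleC -ge0_muleDr// [leLHS]muleCA [leRHS]muleCA.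
  by apply: lee_wpmul2l => //; exact: half_mulM.
rewrite {1}/I muleC -ge0_integralZl//.
have E1 : P * Q = \int[mu]_x ((2^-1)%:E * (p x * (q x * q x) * P + p x * Q)).
  rewrite ge0_integralZl//; last 2 first.
  - by apply: emeasurable_funD; exact: emeasurable_funM.
  - by move=> x _; rewrite adde_ge0// mule_ge0.
  rewrite ge0_integralD//; last 4 first.
  - by move=> x _; exact: mule_ge0.
  - exact: emeasurable_funM.
  - by move=> x _; exact: mule_ge0.
  - exact: emeasurable_funM.
  by rewrite !ge0_integralZr// -/P -/Q [Q * P]muleC hh// mule_ge0.
rewrite E1; apply: ge0_le_integral => //.
- by move=> x _; exact: mule_ge0.
- exact: emeasurable_funM.
- by apply: emeasurable_funM => //; apply: emeasurable_funD; exact: emeasurable_funM.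
move=> x _; rewrite muleC -!muleA -ge0_muleDr ?mule_ge0// [leRHS]muleCA !muleA -!muleA.
by apply: lee_wpmul2l; rewrite // muleA.
Qed.

Definition cv A B z := \int[mu]_y (A (tsub z y) * B y).

Lemma measurable_cv_kernel A B : measurable_fun setT A -> measurable_fun setT B ->
  measurable_fun setT (fun p : T * T => A (tsub p.1 p.2) * B p.2).
Proof.
move=> mA mB; apply: emeasurable_funM; last exact: (measurableT_comp mB measurable_snd).
exact: (measurableT_comp mA (@measurable_tsub R n)).
Qed.

Lemma measurable_cv A B : measurable_fun setT A -> measurable_fun setT B ->
  measurable_fun setT (cv A B).
Proof.
move=> mA mB; exact: (@measurable_integral_param R n _ T _ (measurable_cv_kernel mA mB)).
Qed.

Section nonnegative.
Variables A B : T -> \bar R.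
Hypotheses (mA : measurable_fun setT A) (mB : measurable_fun setT B).
Hypotheses (A0 : forall x, 0 <= A x) (B0 : forall x, 0 <= B x).

Lemma cv_ge0 z : 0 <= cv A B z.
Proof. by apply: integral_ge0 => y _; exact: mule_ge0. Qed.

Lemma integral_cv : \int[mu]_z cv A B z = (\int[mu]_x A x) * \int[mu]_x B x.
Proof.
have K0 (p : T * T) : 0 <= A (tsub p.1 p.2) * B p.2 by exact: mule_ge0.
rewrite /cv; transitivity (\int[mu]_y \int[mu]_z (A (tsub z y) * B y)).
  exact: (fubini_tonelli (m1 := mu) (m2 := mu) _ (measurable_cv_kernel mA mB) K0).
rewrite -ge0_integralZl//; last exact: integral_ge0.
apply: eq_integral => y _; rewrite ge0_integralZr//; last exact: (measurableT_comp mA (measurable_tsubr y)).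
by rewrite ge0_integral_tsubr.
Qed.

End nonnegative.

(** Young's inequality L1 * L2 -> L2: apply [sqr_integral_le] to the reflected
    translates of [A] and to [B], and integrate. *)
Lemma integral_cv_sqr A B : measurable_fun setT A -> measurable_fun setT B ->
  (forall x, 0 <= A x) -> (forall x, 0 <= B x) ->
  \int[mu]_z (cv A B z * cv A B z) <=
  (\int[mu]_x A x) * ((\int[mu]_x A x) * \int[mu]_x (B x * B x)).
Proof.
move=> mA mB A0 B0.
have mBB : measurable_fun setT (fun x => B x * B x) by exact: emeasurable_funM.
have BB0 x : 0 <= B x * B x by exact: mule_ge0.
have mcv := measurable_cv mA mBB.
have P0 : 0 <= \int[mu]_x A x by exact: integral_ge0.
have cv0 z : 0 <= cv A (fun x => B x * B x) z by exact: cv_ge0.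
have E : \int[mu]_z ((\int[mu]_x A x) * cv A (fun x => B x * B x) z) =
  (\int[mu]_x A x) * \int[mu]_z cv A (fun x => B x * B x) z by rewrite ge0_integralZl.
rewrite (integral_cv mA mBB A0 BB0) in E; rewrite -E.
apply: ge0_le_integral => //.
- by move=> z _; rewrite mule_ge0// cv_ge0.
- by apply: emeasurable_funM; exact: measurable_cv.
- exact: emeasurable_funM.
move=> z _; rewrite /cv; apply: le_trans (sqr_integral_le _ mB _ B0) _ => //.
  exact: (measurableT_comp mA (measurable_tsubl z)).
by rewrite ge0_integral_tsubl.
Qed.

End convolution.

Section hartley_convolution.
Variables (R : realType) (n : nat).
Local Notation T := (Rn R n).
Local Notation mu := (lebesgueRn R n).
Local Notation L1 f := (mu.-integrable setT (EFin \o f)).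
Local Notation L2 f := (f \in Lfun mu 2%:E).
Local Notation n2 := (norm2 mu).
Local Notation sqn := (sqnorm mu).
Implicit Types (f g h k : T -> R) (x y z : T).

Definition conv h k z : R := fine (\int[mu]_y (h (tsub z y) * k y)%:E)%E.

Lemma L2_tsubl h z : L2 h -> L2 (fun y => h (tsub z y)).
Proof.
move=> /L2P[mh ho]; apply/L2P; split.
  exact: (measurableT_comp mh (measurable_tsubl z)).
have mh2 : measurable_fun setT (fun y => (h y ^+ 2)%:E) by apply: mEFin; exact: measurable_funX.
rewrite /sqnorm (ge0_integral_tsubl z mh2)//.
by move=> y; rewrite lee_fin sqr_ge0.
Qed.

Lemma convE h k z : L2 h -> L2 k ->
  ((conv h k z)%:E = \int[mu]_y (h (tsub z y) * k y)%:E)%E.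
Proof.
move=> hL kL; rewrite /conv fineK//.
exact: integrable_fin_num (L2_mul_integrable (L2_tsubl z hL) kL).
Qed.

Lemma measurable_conv_kernel h k : measurable_fun setT h -> measurable_fun setT k ->
  measurable_fun setT (fun p : T * T => h (tsub p.1 p.2) * k p.2).
Proof.
move=> mh mk; apply: measurable_funM; last exact: (measurableT_comp mk measurable_snd).
exact: (measurableT_comp mh (@measurable_tsub R n)).
Qed.

Lemma measurable_conv h k : measurable_fun setT h -> measurable_fun setT k ->
  measurable_fun setT (conv h k).
Proof.
move=> mh mk; apply: (@measurableT_comp _ _ _ _ _ _ (@fine R)) => //.
exact: (@measurable_integral_param R n _ T _ (mEFin (measurable_conv_kernel mh mk))).
Qed.

Lemma abse_conv_le h k z : measurable_fun setT h -> measurable_fun setT k ->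
  (`|conv h k z|%:E <= cv (fun x => `|h x|%:E) (fun x => `|k x|%:E) z)%E.
Proof.
move=> mh mk; rewrite /conv /cv.
have m1 : measurable_fun setT (fun y => (h (tsub z y) * k y)%:E).
  by apply: mEFin; apply: measurable_funM => //; exact: (measurableT_comp mh (measurable_tsubl z)).
apply: (@le_trans _ _ `|\int[mu]_y (h (tsub z y) * k y)%:E|)%E.
  by case: (integral _ _ _) => [r||] //=; rewrite normr0 leey.
apply: le_trans (le_abse_integral _ _ _) _ => //.
by under eq_integral do rewrite abse_EFin normrM EFinM.
Qed.

Lemma hart_tneg h x : measurable_fun setT h -> hart (h \o @tneg R n) x = hart h (tneg x).
Proof.
move=> mh; rewrite /hart; congr fine.
have m1 : measurable_fun setT (fun y => (h y * cas y (tneg x))%:E).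
  by apply: mEFin; apply: measurable_funM => //; exact: measurable_cas2.
rewrite -[RHS](integralRnN m1); apply: eq_integral => y _ /=.
by rewrite /cas dotNl dotNr opprK.
Qed.

Lemma integral_cas_tadd h x y : L1 h ->
  (\int[mu]_z (h z * cas (tadd y z) x)%:E =
   (evenp (hart h) x * cas y x + oddp (hart h) x * (cos (dot y x) - sin (dot y x)))%:E)%E.
Proof.
move=> hL; have [<- <-] := hart_neg x hL.
have cL := L1_cos x hL; have sL := L1_sin x hL.
rewrite EFinD !EFinM !fineK; [|exact: integrable_fin_num..].
rewrite ![(_ * (cas _ _)%:E)%E]muleC ![(_ * (_ - _)%:E)%E]muleC.
rewrite -!integralZl// -integralD//; last 2 first.
- by apply: integrableZl.
- by apply: integrableZl.
apply: eq_integral => z _; rewrite -!EFinM -EFinD; congr EFin.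
rewrite /cas dotDl cosD sinD; ring.
Qed.

(** The addition formulas for the cosine and the sine, integrated. *)
Lemma hart_conv h k x : L1 h -> L2 h -> L1 k -> L2 k ->
  hart (conv h k) x = evenp (hart h) x * hart k x +
    oddp (hart h) x * (evenp (hart k) x - oddp (hart k) x).
Proof.
move=> hL hL2 kL kL2; have mh := L1_measurable hL; have mk := L1_measurable kL.
pose F (p : T * T) := (h (tsub p.1 p.2) * k p.2 * cas p.1 x)%:E.
have mF : measurable_fun setT F.
  apply: mEFin; apply: measurable_funM; first exact: measurable_conv_kernel.
  exact: (measurableT_comp (measurable_cas2 x) measurable_fst).
have maF : measurable_fun setT (abse \o F) by exact: measurableT_comp.
have inner y : (\int[mu]_z F (z, y) = (k y)%:E * \int[mu]_z (h z * cas (tadd y z) x)%:E)%E.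
  have m1 : measurable_fun setT (fun z => F (z, y)) by exact: (measurableT_comp mF (pair2_measurable y)).
  rewrite -(integralRnD y m1) -integralZl//; last first.
    apply: (L1_bounded_mul (M := 2)) => //; last by move=> z; exact: norm_cas.
    exact: (measurableT_comp (measurable_cas2 x) (@measurable_tadd1 R n y)).
  by apply: eq_integral => z _; rewrite /F /= tsubK -EFinM; congr EFin; ring.
have Fi : (mu \x mu)%E.-integrable setT F.
  apply/integrable21ltyP => //.
  have mah : measurable_fun setT (fun x => `|h x|%:E) by apply: mEFin; exact: measurableT_comp.
  have mak : measurable_fun setT (fun x => `|k x|%:E) by apply: mEFin; exact: measurableT_comp.
  apply: (@le_lt_trans _ _ (\int[mu]_y (`|k y|%:E * (2%:E * (norm1 h)%:E)))%E); last first.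
    have c0 : (0 <= 2%:E * (norm1 h)%:E)%E by rewrite -EFinM lee_fin mulr_ge0// n1_ge0.
    by rewrite ge0_integralZr// n1E// -!EFinM ltry.
  apply: ge0_le_integral => //.
  - by move=> y _; apply: integral_ge0.
  - exact: (measurable_fun_fubini_tonelli_G (m1 := mu) (abse \o F) maF (fun=> abse_ge0 _)).
  - exact: emeasurable_funM.
  move=> y _; have mhy : measurable_fun setT (fun z => `|h (tsub z y)|%:E) by exact: (measurableT_comp mah (measurable_tsubr y)).
  rewrite -n1E// -(ge0_integral_tsubr y mah)// -!ge0_integralZl//; last first.
    exact: emeasurable_funM.
  apply: ge0_le_integral => //.
  - exact: (measurableT_comp maF (pair2_measurable y)).
  - by apply: emeasurable_funM => //; exact: emeasurable_funM.
  move=> z _; rewrite /F /= lee_fin !normrM mulrAC -mulrA mulrC -mulrA mulrCA [leLHS]mulrCA.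
  by rewrite mulrCA ler_wpM2l// ler_wpM2r// norm_cas.
apply: EFin_inj; rewrite [in LHS]/hart.
transitivity (\int[mu]_y \int[mu]_z F (z, y))%E.
  rewrite -(Fubini Fi) fineK; last first.
    rewrite (_ : integral _ _ _ = \int[mu]_z \int[mu]_y F (z, y))%E; last first.
      apply: eq_integral => z _; rewrite EFinM convE// muleC -integralZl//; last first.
        exact: L2_mul_integrable (L2_tsubl z hL2) kL2.
      by apply: eq_integral => y _; rewrite /F /= -EFinM mulrC.
    by rewrite integral12_prod_meas1//; exact: integrable_fin_num.
  apply: eq_integral => z _; rewrite EFinM convE// muleC -integralZl//; last first.
    exact: L2_mul_integrable (L2_tsubl z hL2) kL2.
  by apply: eq_integral => y _; rewrite /F /= -EFinM mulrC.
under eq_integral do rewrite inner integral_cas_tadd// -EFinM.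
have [Ek Ok] := hart_neg x kL.
have cL := L1_cos x kL; have sL := L1_sin x kL.
have Ic : (\int[mu]_z (k z * cos (dot z x))%:E)%E = (evenp (hart k) x)%:E.
  by rewrite -Ek fineK//; exact: integrable_fin_num cL.
have Is : (\int[mu]_z (k z * sin (dot z x))%:E)%E = (oddp (hart k) x)%:E.
  by rewrite -Ok fineK//; exact: integrable_fin_num sL.
move: Ic Is; move: (evenp (hart k) x) (oddp (hart k) x) (evenp (hart h) x) (oddp (hart h) x).
move=> c s c' s' Ic Is; rewrite EFinD !EFinM EFinB -Ic -Is -(hartE x kL).
have dL : L1 (fun z => k z * cos (dot z x) - k z * sin (dot z x)) by exact: L1B.
rewrite -integralB//; under [X in (_ + _ * X)%E]eq_integral do rewrite -EFinB.
have kL' := L1_cas x kL.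
rewrite -(integralZl measurableT kL') -(integralZl measurableT dL) -integralD//; last 2 first.
- exact: integrableZl.
- exact: integrableZl.
apply: eq_integral => y _; rewrite -!EFinM -EFinD; congr EFin; rewrite /cas; ring.
Qed.

End hartley_convolution.

(** * The algebra of functions with weighted integrable transform *)

Section weighted_algebra.
Variables (R : realType) (n : nat).
Local Notation T := (Rn R n).
Local Notation mu := (lebesgueRn R n).
Local Notation L1 f := (mu.-integrable setT (EFin \o f)).
Local Notation L2 f := (f \in Lfun mu 2%:E).
Local Notation n2 := (norm2 mu).
Local Notation sqn := (sqnorm mu).
Implicit Types (f g h k u v : T -> R) (x y z : T).

Lemma n1D f g : L1 f -> L1 g -> norm1 (fun x => f x + g x) <= norm1 f + norm1 g.
Proof.
move=> fL gL; rewrite -lee_fin EFinD -!n1E//; last exact: L1D.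
have mf := L1_measurable fL; have mg := L1_measurable gL.
rewrite -ge0_integralD//; last 2 first.
- by apply: mEFin; exact: measurableT_comp.
- by apply: mEFin; exact: measurableT_comp.
apply: ge0_le_integral => //.
- by apply: mEFin; apply: measurableT_comp => //; exact: measurable_funD.
- by apply: emeasurable_funD; apply: mEFin; exact: measurableT_comp.
by move=> x _; rewrite -EFinD lee_fin ler_normD.
Qed.

Lemma n1Z (a : R) f : L1 f -> norm1 (fun x => a * f x) = `|a| * norm1 f.
Proof.
move=> fL; apply: EFin_inj; rewrite EFinM -!n1E//; last exact: L1Z.
rewrite -ge0_integralZl//; first by apply: eq_integral => x _; rewrite normrM.
by apply: mEFin; apply: measurableT_comp => //; exact: L1_measurable fL.
Qed.

Variable w : T -> R.
Hypothesis mw : measurable_fun setT w.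
Hypothesis w1 : forall x, 1 <= w x.
Hypothesis wN : forall x, w (tneg x) = w x.
Hypothesis wD : forall x y, w (tadd x y) <= 2 * (w x * w y).

(** The transforms of the algebra. The L1 bound makes it an algebra; the L2
    bound places it in the domain of the L2 theory. *)
Definition Gv h := [/\ measurable_fun setT h, L1 (fun x => w x * h x) & L2 (fun x => w x * h x)].
Definition Nw h : R := norm1 (fun x => w x * h x) + n2 (fun x => w x * h x).

Let w0 x : 0 < w x. Proof. exact: lt_le_trans (w1 x). Qed.

Lemma Nw_ge0 h : 0 <= Nw h.
Proof. by rewrite addr_ge0// ?n1_ge0// n2_ge0. Qed.

Lemma Gv_L1L2 h : Gv h -> L1 h /\ L2 h.
Proof.
move=> [mh h1 h2].
have mi : measurable_fun setT (fun x => (w x)^-1).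
  have -> : (fun x => (w x)^-1) = (fun x => w x `^ (-1)).
    by apply/funext => x; rewrite powR_inv1// ltW.
  exact: (measurableT_comp (measurable_powR _) mw).
have i1 x : `|(w x)^-1| <= 1 by rewrite gtr0_norm ?invr_gt0// invf_le1.
split.
- have := L1_bounded_mul h1 mi i1; congr (mu.-integrable setT (EFin \o _)).
  by apply/funext => x; rewrite mulrAC divff ?mul1r// gt_eqF.
- have := L2_bounded_mul mi i1 h2; congr (_ \in Lfun mu 2%:E).
  by apply/funext => x; rewrite mulrA mulVf ?mul1r// gt_eqF.
Qed.

Lemma Gv0 : Gv (fun=> 0).
Proof.
by split => //; under eq_fun do rewrite mulr0; [exact: integrable0|exact: L2_0].
Qed.

Lemma GvD h k : Gv h -> Gv k -> Gv (fun x => h x + k x).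
Proof.
move=> [mh h1 h2] [mk k1 k2]; split; first exact: measurable_funD.
- by under eq_fun do rewrite mulrDr; exact: L1D.
- by under eq_fun do rewrite mulrDr; exact: L2D.
Qed.

Lemma NwD h k : Gv h -> Gv k -> Nw (fun x => h x + k x) <= Nw h + Nw k.
Proof.
move=> [mh h1 h2] [mk k1 k2]; rewrite /Nw addrACA.
by apply: lerD; under eq_fun do rewrite mulrDr; [exact: n1D|exact: n2D].
Qed.

Lemma GvZ (a : R) h : Gv h -> Gv (fun x => a * h x).
Proof.
move=> [mh h1 h2]; split; first exact: measurable_funM.
- by under eq_fun do rewrite mulrCA; exact: L1Z.
- by under eq_fun do rewrite mulrCA; exact: L2Z.
Qed.

Lemma NwZ (a : R) h : Gv h -> Nw (fun x => a * h x) = `|a| * Nw h.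
Proof.
move=> [mh h1 h2]; rewrite /Nw mulrDr -n1Z// -n2Z//.
by congr (norm1 _ + n2 _); apply/funext => x; rewrite mulrCA.
Qed.

Lemma GvB h k : Gv h -> Gv k -> Gv (fun x => h x - k x).
Proof.
move=> hG /(GvZ (-1)) kG; have := GvD hG kG.
by under eq_fun do rewrite mulN1r.
Qed.

Lemma Gv_tneg h : Gv h -> Gv (h \o @tneg R n).
Proof.
move=> [mh h1 h2]; have mN := @measurable_tneg R n.
have E : (fun x => w x * (h \o @tneg R n) x) = (fun x => w x * h x) \o @tneg R n.
  by apply/funext => x /=; rewrite wN.
split; first exact: (measurableT_comp mh mN).
- rewrite E; apply/integrableP; split.
    exact: (measurableT_comp (measurable_int _ h1) mN).
  have ma : measurable_fun setT (fun x => `|w x * h x|%:E).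
    by apply: mEFin; apply: measurableT_comp => //; exact: measurable_funM.
  rewrite (ge0_integralRnN ma)//; by case/integrableP : h1.
- by rewrite E; exact: L2_tneg.
Qed.

Lemma Nw_tneg h : Gv h -> Nw (h \o @tneg R n) = Nw h.
Proof.
move=> [mh h1 h2]; have mwh : measurable_fun setT (fun x => w x * h x) by exact: measurable_funM.
have E : (fun x => w x * (h \o @tneg R n) x) = (fun x => w x * h x) \o @tneg R n.
  by apply/funext => x /=; rewrite wN.
rewrite /Nw E; congr (_ + _).
  have ma : measurable_fun setT (fun x => `|w x * h x|%:E).
    by apply: mEFin; exact: measurableT_comp.
  by rewrite /norm1 -(ge0_integralRnN ma).
by rewrite !n2_sqrt sqn_tneg.
Qed.

(** Up to the factor 2 the weight is submultiplicative, so that Young's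
    inequalities extend to the weighted norms. *)
Lemma Gv_conv h k : Gv h -> Gv k ->
  Gv (conv h k) /\ Nw (conv h k) <= 2 * (Nw h * Nw k).
Proof.
move=> [mh h1 h2] [mk k1 k2].
have mc := measurable_conv mh mk.
pose A x := `|w x * h x|%:E; pose B x := `|w x * k x|%:E.
have mA : measurable_fun setT A by apply: mEFin; apply: measurableT_comp => //; exact: measurable_funM.
have mB : measurable_fun setT B by apply: mEFin; apply: measurableT_comp => //; exact: measurable_funM.
have A0 x : (0 <= A x)%E by rewrite lee_fin.
have B0 x : (0 <= B x)%E by rewrite lee_fin.
have mwc : measurable_fun setT (fun z => w z * conv h k z) by exact: measurable_funM.
have pt z : (`|w z * conv h k z|%:E <= 2%:E * cv A B z)%E.
  rewrite normrM EFinM; apply: (@le_trans _ _ (`|w z|%:E * cv (fun x => `|h x|%:E) (fun x => `|k x|%:E) z)%E).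
    by apply: lee_wpmul2l; [rewrite lee_fin|exact: abse_conv_le].
  have mK : measurable_fun setT (fun y => `|h (tsub z y)|%:E * `|k y|%:E)%E.
    apply: emeasurable_funM; last by apply: mEFin; exact: measurableT_comp.
    apply: mEFin; apply: measurableT_comp => //.
    exact: (measurableT_comp mh (measurable_tsubl z)).
  have mK' : measurable_fun setT (fun y => A (tsub z y) * B y)%E.
    by apply: emeasurable_funM => //; exact: (measurableT_comp mA (measurable_tsubl z)).
  rewrite /cv -!ge0_integralZl//; last by move=> y _; rewrite mule_ge0// lee_fin.
  apply: ge0_le_integral => //.
  - exact: emeasurable_funM.
  - exact: emeasurable_funM.
  move=> y _; rewrite /A /B -!EFinM lee_fin !normrM !(gtr0_norm (w0 _)).
  have := wD (tsub z y) y; rewrite (_ : tadd _ _ = z); last first.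
    by apply: eq_from_tnth => i; rewrite !tnth_mktuple subrK.
  move=> wz; rewrite (_ : 2 * _ = 2 * (w (tsub z y) * w y) * (`|h (tsub z y)| * `|k y|)); last by ring.
  by rewrite ler_wpM2r// mulr_ge0.
have cv0 z : (0 <= cv A B z)%E by exact: cv_ge0.
have mcv := measurable_cv mA mB.
have b1 : (\int[mu]_z `|w z * conv h k z|%:E <= 2%:E * ((norm1 (fun x => w x * h x))%:E * (norm1 (fun x => w x * k x))%:E))%E.
  rewrite -!n1E// -(integral_cv mA mB A0 B0) -ge0_integralZl//.
  apply: ge0_le_integral => //.
  - by apply: mEFin; exact: measurableT_comp.
  - exact: emeasurable_funM.
have B2 : (\int[mu]_x (B x * B x) = sqn (fun x => w x * k x)%R)%E.
  by apply: eq_integral => x _; rewrite /B -EFinM -expr2 real_normK// num_real.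
have b2 : (sqn (fun z => w z * conv h k z)%R <=
    ((2 * (norm1 (fun x => w x * h x) * n2 (fun x => w x * k x))) ^+ 2)%:E)%E.
  apply: (@le_trans _ _ (\int[mu]_z (4%:E * (cv A B z * cv A B z)))%E).
    apply: ge0_le_integral => //.
    - by move=> z _; rewrite lee_fin sqr_ge0.
    - by apply: mEFin; exact: measurable_funX.
    - by apply: emeasurable_funM => //; exact: emeasurable_funM.
    move=> z _; rewrite -real_normK ?num_real// expr2 EFinM.
    rewrite (_ : 4%:E * _ = (2%:E * cv A B z) * (2%:E * cv A B z))%E; last first.
      by rewrite muleACA -EFinM; congr (_%:E * _)%E; ring.
    by apply: lee_pmul; rewrite ?lee_fin.
  rewrite ge0_integralZl//; last 2 first.
  - exact: emeasurable_funM.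
  - by move=> z _; exact: mule_ge0.
  have := integral_cv_sqr mA mB A0 B0; rewrite B2 sqnE// n1E// => b2.
  apply: le_trans (lee_wpmul2l _ b2) _ => //.
  by rewrite -!EFinM lee_fin le_eqVlt; apply/orP; left; apply/eqP; ring.
have c1 : L1 (fun z => w z * conv h k z).
  apply/integrableP; split; first exact: mEFin.
  by apply: le_lt_trans b1 _; rewrite -!EFinM ltry.
have c2 : L2 (fun z => w z * conv h k z).
  by apply/L2P; split => //; apply: le_lt_trans b2 _; rewrite ltry.
split; first by split.
have n1le : norm1 (fun z => w z * conv h k z) <= 2 * (norm1 (fun x => w x * h x) * norm1 (fun x => w x * k x)).
  by rewrite -lee_fin -n1E// !EFinM.
have n2le : n2 (fun z => w z * conv h k z) <= 2 * (norm1 (fun x => w x * h x) * n2 (fun x => w x * k x)).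
  rewrite -(@ler_pXn2r _ 2)// ?nnegrE ?n2_ge0// ?mulr_ge0 ?n1_ge0 ?n2_ge0//.
  by rewrite -lee_fin -sqnE.
have := n1_ge0 (fun x => w x * h x); have := n1_ge0 (fun x => w x * k x).
have := n2_ge0 mu (fun x => w x * h x); have := n2_ge0 mu (fun x => w x * k x).
move: n1le n2le; rewrite /Nw.
move: (norm1 _) (norm1 _) (norm1 _) (n2 _) (n2 _) (n2 _) => a1 a2 a3 a4 a5 a6 *; nra.
Qed.

Let c : R := (2 * pi) ^+ n.
Let c0 : 0 < c. Proof. by rewrite exprn_gt0// mulr_gt0// pi_gt0. Qed.
Definition algebra_const : R := 4 / c.
Local Notation K := algebra_const.

Lemma algebra_const_gt0 : 0 < K. Proof. by rewrite divr_gt0. Qed.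

(** [u] is in the algebra, with transform [h]. *)
Definition Y u h := is_hart u h /\ Gv h.

Lemma Y0 : Y (fun=> 0) (fun=> 0).
Proof. by split; [exact: is_hart0|exact: Gv0]. Qed.

Lemma YD u v h k : Y u h -> Y v k -> Y (fun x => u x + v x) (fun x => h x + k x).
Proof. by move=> [? ?] [? ?]; split; [exact: is_hartD|exact: GvD]. Qed.

Lemma YB u v h k : Y u h -> Y v k -> Y (fun x => u x - v x) (fun x => h x - k x).
Proof. by move=> [? ?] [? ?]; split; [exact: is_hartB|exact: GvB]. Qed.

(** The transform is integrable, so inversion recovers the function from
    [hart]. Products in the algebra are computed through this formula. *)
Lemma Y_hart u h : Y u h -> {ae mu, forall x, hart h x = c * u x}.
Proof.
move=> [uh hG]; have [h1 h2] := Gv_L1L2 hG.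
exact: (is_hart_unique (is_hart_L1 h1 h2) (is_hartK uh) (aeW _ (fun=> erefl))).
Qed.

(** By [hart_conv], [hart h * hart k] is the transform of a combination [m] of
    the convolutions of [h] and [k] and of their reflections; inversion turns
    [m] into the transform of the product. *)
Lemma YM u v h k : Y u h -> Y v k ->
  exists l, Y (fun x => u x * v x) l /\ Nw l <= K * (Nw h * Nw k).
Proof.
move=> uh vk; have [uH hG] := uh; have [vH kG] := vk.
pose h' := h \o @tneg R n; pose k' := k \o @tneg R n.
have h'G : Gv h' by exact: Gv_tneg. have k'G : Gv k' by exact: Gv_tneg.
have [G1 N1] := Gv_conv hG kG; have [G2 N2] := Gv_conv hG k'G.
have [G3 N3] := Gv_conv h'G kG; have [G4 N4] := Gv_conv h'G k'G.
rewrite !Nw_tneg// in N2 N3 N4.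
pose m x := 2^-1 * (((conv h k x + conv h k' x) + conv h' k x) - conv h' k' x).
have G12 := GvD G1 G2; have G123 := GvD G12 G3; have G1234 := GvB G123 G4.
have mG : Gv m by exact: GvZ.
have mN : Nw m <= 4 * (Nw h * Nw k).
  rewrite NwZ// ger0_norm//.
  have := NwD G123 (GvZ (-1) G4); rewrite NwZ// normrN1 mul1r.
  under eq_fun do rewrite mulN1r.
  have := NwD G12 G3; have := NwD G1 G2.
  set a1 := Nw (conv h k) in N1 *; set a2 := Nw (conv h k') in N2 *.
  set a3 := Nw (conv h' k) in N3 *; set a4 := Nw (conv h' k') in N4 *.
  set b1 := Nw _; set b2 := Nw _; set b3 := Nw _.
  by move=> e1 e2 e3; move: N1 N2 N3 N4; set N := Nw h * Nw k => *; lra.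
have [h1 h2] := Gv_L1L2 hG; have [k1 k2] := Gv_L1L2 kG.
have [h1' h2'] := Gv_L1L2 h'G; have [k1' k2'] := Gv_L1L2 k'G.
have [m1 m2] := Gv_L1L2 mG.
have hm x : hart m x = hart h x * hart k x.
  have [? _] := Gv_L1L2 G1; have [? _] := Gv_L1L2 G2; have [? _] := Gv_L1L2 G3.
  have [? _] := Gv_L1L2 G4; have [? _] := Gv_L1L2 G12; have [? _] := Gv_L1L2 G123.
  rewrite hartZ//; last exact: L1B.
  rewrite hartB// hartD// hartD// !hart_conv//.
  have hh y : hart h' y = hart h (tneg y) by apply: hart_tneg; case: hG.
  have kk y : hart k' y = hart k (tneg y) by apply: hart_tneg; case: kG.
  rewrite /evenp /oddp !hh !kk !tnegK.
  by field.
have mh : is_hart (hart m) (fun x => c * m x) by exact: is_hartK (is_hart_L1 m1 m2).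
exists (fun x => c ^- 2 * (c * m x)); split; last first.
  rewrite (NwZ _ (GvZ c mG)) (NwZ _ mG) (_ : `|c ^- 2| = c ^- 2); last by rewrite ger0_norm// invr_ge0 sqr_ge0.
  rewrite (ger0_norm (ltW c0)) mulrA.
  have cc : 0 <= c ^- 2 * c by apply: mulr_ge0; [rewrite invr_ge0 sqr_ge0|exact: (ltW c0)].
  apply: le_trans (ler_wpM2l cc mN) _.
  rewrite le_eqVlt; apply/orP; left; apply/eqP; rewrite /K; field; exact: lt0r_neq0.
split; last by do 2 apply: GvZ.
apply: (is_hart_ae (is_hartZ (c ^- 2) mh)).
- have [uL _ _] := uH; have [vL _ _] := vH.
  by apply: measurable_funM; [exact: (L2_measurable uL)|exact: (L2_measurable vL)].
- by do 2 apply: measurable_funM => //; case: mG.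
- apply: filterS2 (Y_hart uh) (Y_hart vk) => x; rewrite hm => -> ->.
  field; exact: lt0r_neq0.
- exact: aeW.
Qed.

Lemma Y_pow u h q : Y u h -> exists l, Y (fun x => u x ^+ q.+1) l.
Proof.
move=> uh; elim: q => [|q [l IH]]; first by exists h.
by have [k [Yk _]] := YM uh IH; exists k; under eq_fun do rewrite exprS.
Qed.

(** The difference is factored as
    u^(q+2) - v^(q+2) = u (u^(q+1) - v^(q+1)) + (u - v) v^(q+1),
    and the case v = 0 bounds the powers themselves. *)
Lemma Y_powB q u v h k (A D : R) : Y u h -> Y v k -> Nw h <= A -> Nw k <= A ->
  Nw (fun x => h x - k x) <= D ->
  exists l, Y (fun x => u x ^+ q.+1 - v x ^+ q.+1) l /\ Nw l <= (2 * K) ^+ q * A ^+ q * D.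
Proof.
have K0 := ltW algebra_const_gt0.
elim: q u v h k D => [|q IH] u v h k D uh vk hA kA hkD.
  exists (fun x => h x - k x); split; last by rewrite !expr0 !mul1r.
  by under eq_fun do rewrite !expr1; exact: YB.
have [l1 [Y1 N1]] := IH _ _ _ _ _ uh vk hA kA hkD.
have A0 : 0 <= A := le_trans (Nw_ge0 h) hA.
have [l2 [Y2 N2]] : exists l, Y (fun x => v x ^+ q.+1) l /\ Nw l <= (2 * K) ^+ q * A ^+ q * A.
  have N0 : Nw (fun=> 0) <= A.
    have := NwZ 0 vk.2; under eq_fun do rewrite mul0r.
    by rewrite normr0 mul0r => ->.
  have kA' : Nw (fun x => k x - 0) <= A by under eq_fun do rewrite subr0.
  have [l [Yl Nl]] := IH _ _ _ _ _ vk Y0 kA N0 kA'; exists l; split => //.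
  by move: Yl; under eq_fun do rewrite expr0n subr0.
have [l3 [Y3 N3]] := YM uh Y1.
have [l4 [Y4 N4]] := YM (YB uh vk) Y2.
exists (fun x => l3 x + l4 x); split.
  have := YD Y3 Y4; congr (Y _ _); apply/funext => x.
  by rewrite !exprS; ring.
apply: le_trans (NwD Y3.2 Y4.2) _.
have D0 := le_trans (Nw_ge0 _) hkD.
pose P : R := (2 * K) ^+ q * A ^+ q.
have P0 : 0 <= P by rewrite mulr_ge0// exprn_ge0// mulr_ge0.
have h3 : Nw l3 <= K * (A * (P * D)).
  apply: le_trans N3 _; rewrite ler_wpM2l//.
  by apply: ler_pM => //; exact: Nw_ge0.
have h4 : Nw l4 <= K * (D * (P * A)).
  apply: le_trans N4 _; rewrite ler_wpM2l//.
  by apply: ler_pM => //; exact: Nw_ge0.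
apply: le_trans (lerD h3 h4) _; rewrite le_eqVlt; apply/orP; left; apply/eqP.
by rewrite /P !exprS; ring.
Qed.

End weighted_algebra.

(** * The weight and the symbol *)

Section weights.
Variable R : realType.
Local Open Scope ring_scope.

Lemma cosh_ge1 (t : R) : 1 <= cosh t.
Proof.
rewrite /cosh ler_pdivlMr// mul1r; have := sqr_ge0 (expR (t / 2) - expR (- (t / 2))).
rewrite sqrrB -!expRM_natl -expRD subrr expR0.
rewrite (_ : 2%:R * (t / 2) = t); last by field.
rewrite (_ : 2%:R * - (t / 2) = - t); last by field.
rewrite (_ : 1 *+ 2 = 2 :> R)//; lra.
Qed.

Lemma coshD_le (s t : R) : cosh (s + t) <= 2 * (cosh s * cosh t).
Proof.
have E : 2 * (cosh s * cosh t) = cosh (s + t) + cosh (s - t).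
  by rewrite /cosh !opprD opprK !expRD; field.
by rewrite E lerDl (le_trans _ (cosh_ge1 _)).
Qed.

Lemma ler_cosh (s t : R) : 0 <= s -> s <= t -> cosh s <= cosh t.
Proof.
move=> s0 st; rewrite /cosh ler_pM2r ?invr_gt0//.
have -> : expR t = expR s * expR (t - s) by rewrite -expRD; congr expR; ring.
have -> : expR (- t) = expR (- s) / expR (t - s) by rewrite -expRN -expRD; congr expR; ring.
have a1 : expR (- s) <= 1 by rewrite -expR0 ler_expR oppr_le0.
have b1 : 1 <= expR s by rewrite -expR0 ler_expR.
have d1 : 1 <= expR (t - s) by rewrite -expR0 ler_expR subr_ge0.
have d0 : 0 < expR (t - s) := expR_gt0 _.
move: (expR_gt0 (- s)) a1 b1 d1 d0; move: (expR (- s)) (expR s) (expR (t - s)) => a b d a0 a1 b1 d1 d0.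
rewrite -subr_ge0 (_ : _ - _ = (d - 1) * (b - a / d)); last by field; rewrite gt_eqF.
rewrite mulr_ge0// subr_ge0//.
by rewrite ler_pdivrMr// (le_trans a1)// -[1]mul1r ler_pM.
Qed.

Variable n : nat.
Implicit Types x y xi : Rn R n.

Lemma dot_ge0 x : 0 <= dot x x.
Proof. by apply: sumr_ge0 => i _; rewrite -expr2 sqr_ge0. Qed.

Lemma enorm_ge0 x : 0 <= enorm x. Proof. exact: sqrtr_ge0. Qed.

Lemma enorm_sqr x : enorm x ^+ 2 = dot x x.
Proof. by rewrite sqr_sqrtr// dot_ge0. Qed.

Lemma dot_le_enorm x y : dot x y <= enorm x * enorm y.
Proof.
have dot0 (z z' : Rn R n) : enorm z = 0 -> dot z z' = 0.
  move=> z0; have /eqP : dot z z = 0 by rewrite -enorm_sqr z0 expr0n.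
  rewrite psumr_eq0; last by move=> i _; rewrite -expr2 sqr_ge0.
  move=> /allP h; apply: big1 => i _; have := h i (mem_index_enum i).
  by rewrite mulf_eq0 orbb => /eqP ->; rewrite mul0r.
have [x0|x0] := eqVneq (enorm x) 0; first by rewrite dot0// x0 mul0r.
have [y0|y0] := eqVneq (enorm y) 0; first by rewrite dotC dot0// y0 mulr0.
have xp : 0 < enorm x by rewrite lt_def x0 enorm_ge0.
have yp : 0 < enorm y by rewrite lt_def y0 enorm_ge0.
have : 0 <= \sum_(i < n) ((tnth x i : R) * enorm y - (tnth y i : R) * enorm x) ^+ 2.
  by apply: sumr_ge0 => i _; exact: sqr_ge0.
have -> : \sum_(i < n) ((tnth x i : R) * enorm y - (tnth y i : R) * enorm x) ^+ 2 =
    2 * (enorm x * enorm y) * (enorm x * enorm y - dot x y).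
  transitivity (dot x x * enorm y ^+ 2 + dot y y * enorm x ^+ 2 - 2 * (enorm x * enorm y) * dot x y).
    rewrite /dot !mulr_suml mulr_sumr -big_split /= -sumrB.
    by apply: eq_bigr => i _; ring.
  by rewrite -!enorm_sqr; ring.
by rewrite pmulr_rge0 ?subr_ge0// !mulr_gt0.
Qed.

Lemma enormD x y : enorm (tadd x y) <= enorm x + enorm y.
Proof.
rewrite -(@ler_pXn2r _ 2)// ?nnegrE ?addr_ge0 ?enorm_ge0//.
rewrite enorm_sqr dotDl !dotDr sqrrD !enorm_sqr [dot y x]dotC.
have := dot_le_enorm x y; rewrite mulr2n; lra.
Qed.

Variable s : R.
Hypothesis s0 : 0 < s.
Definition cw xi : R := cosh (s * enorm xi).

Lemma measurable_cw : measurable_fun setT cw.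
Proof.
apply: (measurableT_comp (@measurable_cosh R)); apply: measurable_funM => //.
exact: measurable_enorm.
Qed.

Lemma cw_ge1 xi : 1 <= cw xi. Proof. exact: cosh_ge1. Qed.
Lemma cw_gt0 xi : 0 < cw xi. Proof. exact: lt_le_trans (cw_ge1 xi). Qed.
Lemma cwN xi : cw (tneg xi) = cw xi. Proof. by rewrite /cw enormN. Qed.

Lemma cwD x y : cw (tadd x y) <= 2 * (cw x * cw y).
Proof.
apply: le_trans (coshD_le _ _); rewrite -mulrDr; apply: ler_cosh.
  by rewrite mulr_ge0 ?enorm_ge0// ltW.
by rewrite ler_pM2l// enormD.
Qed.

End weights.

Section symbol.
Variable R : realType.
Local Open Scope ring_scope.

Let q (x : R) : R := 1 + x ^+ 2.
Let q0 x : 0 < q x. Proof. by rewrite ltr_pwDl// sqr_ge0. Qed.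

Let dq (x : R) : is_derive x (1 : R) q (2 * x).
Proof.
rewrite /q; apply: is_derive_eq; rewrite /GRing.scale/=.
by ring.
Qed.

Lemma powR_cvg_pinfty (a : R) : 0 < a -> (x `^ (- a)) @[x --> +oo] --> 0.
Proof.
move=> a0; have h : (fun x : R => x^-1 `^ a) x @[x --> +oo] --> 0.
  apply: (@cvg_comp _ _ _ (fun x : R => x^-1) (fun y => y `^ a) _ 0^'+); last exact: powR_cvg0.
  move=> A [e /= e0 eA]; exists e^-1; split; first by rewrite num_real.
  move=> x ex; have x0 : 0 < x by rewrite (lt_trans _ ex)// invr_gt0.
  apply: eA; last by rewrite /= invr_gt0.
  by rewrite /ball/= sub0r normrN gtr0_norm ?invr_gt0// -[e]invrK ltf_pV2// posrE invr_gt0.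
apply: cvg_trans h; apply: near_eq_cvg; near=> x.
have x0 : 0 < x by near: x; exact: nbhs_pinfty_gt.
by rewrite -powR_inv1 ?ltW// -powRrM mulN1r.
Unshelve. all: by end_near.
Qed.

(** For large [x] the summand [`|x| * q x `^ (- (7 / 6))] is comparable with
    [q x `^ (- (2 / 3))], and it has an explicit antiderivative. *)
Definition majorant (x : R) : R := 2 * (`|x| * q x `^ (- (7 / 6))) + 2 / q x.

Lemma majorant_ge0 x : 0 <= majorant x.
Proof. by rewrite addr_ge0// ?mulr_ge0// ?powR_ge0// invr_ge0 ltW. Qed.

Lemma majorantP x : q x `^ (- (2 / 3)) <= majorant x.
Proof.
have q1 : 1 <= q x by rewrite lerDl sqr_ge0.
have [x1|x1] := leP `|x| 1.
  apply: (@le_trans _ _ (2 / q x)); last by rewrite lerDr !mulr_ge0// powR_ge0.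
  apply: (@le_trans _ _ 1); first by rewrite -[leRHS](powRr0 (q x)) ler_powR// oppr_le0 divr_ge0.
  have := exprn_ile1 2 (normr_ge0 x) x1; rewrite real_normK ?num_real// => x2.
  by rewrite ler_pdivlMr// mul1r /q; lra.
apply: (@le_trans _ _ (2 * (`|x| * q x `^ (- (7 / 6))))); last by rewrite lerDl divr_ge0// ltW.
have -> : q x `^ (- (2 / 3)) = q x `^ (2^-1) * q x `^ (- (7 / 6)).
  rewrite -powRD; last by rewrite (gt_eqF (q0 x)) implybT.
  by rewrite (_ : 2^-1 + - (7 / 6) = - (2 / 3))//; field.
rewrite mulrA ler_wpM2r ?powR_ge0// powR12_sqrt ?(ltW (q0 x))//.
rewrite -(ger0_norm (_ : 0 <= 2 * `|x|)) ?mulr_ge0// -sqrtr_sqr ler_wsqrtr//.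
rewrite exprMn real_normK ?num_real// /q.
have : 1 <= x ^+ 2 by rewrite -real_normK ?num_real// exprn_ege1// ltW.
by move: (x ^+ 2) => y; lra.
Qed.

Lemma measurable_majorant : measurable_fun setT majorant.
Proof.
have mq : measurable_fun setT q by apply: measurable_funD => //; exact: measurable_funX.
have -> : majorant = fun x => 2 * (`|x| * q x `^ (- (7 / 6))) + 2 * q x `^ (- 1).
  by apply/funext => x; rewrite /majorant powR_inv1// ltW.
have mp a : measurable_fun setT (fun x => q x `^ a) by exact: (measurableT_comp (measurable_powR _) mq).
apply: measurable_funD; apply: measurable_funM => //.
by apply: measurable_funM => //; exact: measurableT_comp.
Qed.

Lemma continuous_q_powR (a : R) : continuous (fun x => q x `^ a).
Proof.
move=> x; apply/differentiable_continuous/derivable1_diffP.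
by have [] := is_derive1_comp (is_derive1_powR a (q0 x)) (dq x).
Qed.

Lemma integral_majorant : (\int[lebesgue_measure]_x (majorant x)%:E < +oo)%E.
Proof.
pose F (x : R) := -6 * q x `^ (- (1 / 6)) + 2 * atan x.
pose g (x : R) := 2 * (x * q x `^ (- (7 / 6))) + 2 / q x.
have dF x : is_derive x (1 : R) F (g x).
  have d1 := is_derive1_comp (is_derive1_powR (- (1 / 6)) (q0 x)) (dq x).
  have d2 := is_derive1_atan x.
  have d3 : is_derive x (1 : R) F (-6 * ((- (1 / 6) * q x `^ (- (1 / 6) - 1)) * (2 * x)) + 2 * (1 + x ^+ 2)^-1).
    rewrite /F; apply: is_deriveD; apply: is_deriveZ.
  move: d3; congr (is_derive _ _ _ _); rewrite /g /q.
  rewrite (_ : - (1 / 6) - 1 = - (7 / 6)); last by field.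
  by field; rewrite gt_eqF// q0.
rewrite (@ge0_integral_even _ majorant g F pi) ?ltry//.
- exact: majorant_ge0.
- move=> x; apply: cvgD; apply: cvgM; try exact: cvg_cst.
    apply: cvgM; [exact: norm_continuous|exact: continuous_q_powR].
  apply: cvgV; first by rewrite gt_eqF.
  by apply: cvgD; [exact: cvg_cst|exact: exprn_continuous].
- by move=> x; rewrite /majorant /q normrN sqrrN.
- by move=> x x0; rewrite /majorant ger0_norm.
- by move=> x; rewrite derive1E; have [_ ->] := dF x.
- rewrite (_ : pi = -6 * 0 + 2 * (pi / 2) :> R); last by field.
  apply: cvgD; apply: cvgM; try exact: cvg_cst; last exact: cvgy_atan.
  apply: (@cvg_comp _ _ _ q (fun y => y `^ (- (1 / 6))) _ +oo); last by apply: powR_cvg_pinfty; rewrite divr_gt0.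
  apply: (@ger_cvgy _ _ _ _ id); last exact: cvg_id.
  near=> x; rewrite /= /q; have := sqr_ge0 (x - 1); rewrite sqrrB; nra.
Unshelve. all: by end_near.
Qed.

End symbol.

Section beam_symbol.
Variables (R : realType) (n : nat) (m : R).
Hypotheses (hn : (n <= 3)%N) (hm : 0 < m).
Local Notation mu := (lebesgueRn R n).
Implicit Types xi : Rn R n.

Definition om xi : R := beam_symbol m xi.

Lemma measurable_om : measurable_fun setT om.
Proof.
apply: (measurableT_comp (continuous_measurable_fun (@sqrt_continuous R))).
apply: measurable_funD => //; apply: measurable_funX; exact: measurable_enorm.
Qed.

Lemma omN xi : om (tneg xi) = om xi. Proof. by rewrite /om /beam_symbol enormN. Qed.

Lemma om_sqr xi : om xi ^+ 2 = m + enorm xi ^+ 4.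
Proof. by rewrite sqr_sqrtr// addr_ge0 ?exprn_even_ge0// ltW. Qed.

Lemma om_gt0 xi : 0 < om xi.
Proof. by rewrite sqrtr_gt0 ltr_pwDl// exprn_even_ge0. Qed.

Let m1 : R := Num.min m 1.
Let m1_gt0 : 0 < m1. Proof. by rewrite lt_min hm ltr01. Qed.

(** The symbol is comparable with [japanese ^+ 2], with these constants. *)
Definition om_lb : R := Num.sqrt (m1 / 2).
Definition om_ub : R := Num.sqrt (m + 1).

Lemma om_lb_gt0 : 0 < om_lb. Proof. by rewrite sqrtr_gt0 divr_gt0. Qed.
Lemma om_ub_gt0 : 0 < om_ub. Proof. by rewrite sqrtr_gt0 addr_gt0. Qed.

Lemma japanese_sqr xi : japanese xi ^+ 2 = 1 + enorm xi ^+ 2.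
Proof. by rewrite sqr_sqrtr// addr_ge0// sqr_ge0. Qed.

Lemma japanese_ge1 xi : 1 <= japanese xi.
Proof. by rewrite -sqrtr1 ler_wsqrtr// lerDl sqr_ge0. Qed.

Lemma om_ge xi : om_lb * japanese xi ^+ 2 <= om xi.
Proof.
have l0 : 0 <= om_lb * japanese xi ^+ 2 by rewrite mulr_ge0 ?sqr_ge0 ?(ltW om_lb_gt0).
rewrite -(@ler_pXn2r _ 2)// ?nnegrE// ?(ltW (om_gt0 _))//.
rewrite om_sqr exprMn japanese_sqr sqr_sqrtr ?(ltW (divr_gt0 _ _))//.
have a1 : m1 <= m by rewrite ge_min lexx.
have b1 : m1 <= 1 by rewrite ge_min lexx orbT.
have -> : enorm xi ^+ 4 = (enorm xi ^+ 2) ^+ 2 by rewrite -exprM.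
move: (sqr_ge0 (enorm xi)) a1 b1 m1_gt0; move: (enorm xi ^+ 2) => e e0 a1 b1 c1.
apply: (@le_trans _ _ (m1 * (1 + e ^+ 2))); last first.
  by rewrite mulrDr mulr1 lerD// ler_piMl// sqr_ge0.
rewrite -mulrA ler_pM2l//; have := sqr_ge0 (e - 1); rewrite !expr2; nra.
Qed.

Lemma om_le xi : om xi <= om_ub * japanese xi ^+ 2.
Proof.
have l0 : 0 <= om_ub * japanese xi ^+ 2 by rewrite mulr_ge0 ?sqr_ge0 ?(ltW om_ub_gt0).
rewrite -(@ler_pXn2r _ 2)// ?nnegrE// ?(ltW (om_gt0 _))//.
rewrite om_sqr exprMn japanese_sqr sqr_sqrtr ?addr_ge0 ?(ltW hm)//.
have -> : enorm xi ^+ 4 = (enorm xi ^+ 2) ^+ 2 by rewrite -exprM.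
move: (sqr_ge0 (enorm xi)); move: (enorm xi ^+ 2) => e e0.
rewrite sqrrD expr1n mulrDl mul1r lerD//.
  by rewrite ler_peMr ?(ltW hm)//; have := sqr_ge0 e; lra.
by lra.
Qed.

Lemma om_ge_lb xi : om_lb <= om xi.
Proof.
apply: le_trans (om_ge xi); rewrite ler_pMr ?om_lb_gt0//.
by rewrite exprn_ege1// japanese_ge1.
Qed.

(** In dimension at most 3, each factor of the product is at least J^(-2/3),
    where J = 1 + |xi|^2, so the product is at least J^(-2). *)
Lemma japanese_majorant xi :
  (japanese xi ^+ 4)^-1 <= \prod_(i < n) majorant (tnth xi i).
Proof.
pose J : R := 1 + enorm xi ^+ 2.
have J1 : 1 <= J by rewrite lerDl sqr_ge0.
have J0 : 0 < J by exact: lt_le_trans J1.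
have -> : japanese xi ^+ 4 = J ^+ 2 by rewrite /J -japanese_sqr -exprM.
pose b := J `^ (- (2 / 3)).
have b0 : 0 <= b by exact: powR_ge0.
have b1 : b <= 1 by rewrite -[leRHS](powRr0 J) ler_powR// oppr_le0 divr_ge0.
have b3 : (J ^+ 2)^-1 = b ^+ 3.
  rewrite -[RHS]powR_mulrn// /b -powRrM (_ : _ * _ = - 2%:R); last by field.
  by rewrite powRN powR_mulrn// ltW.
rewrite b3; apply: (@le_trans _ _ (b ^+ n)); first by rewrite ler_wiXn2l.
rewrite -[X in b ^+ X](card_ord n) -prodr_const; apply: ler_prod => i _.
rewrite b0/=; apply: le_trans (majorantP _).
rewrite /b !powRN lef_pV2 ?posrE ?powR_gt0// ?ltr_pwDl ?sqr_ge0//.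
apply: ge0_ler_powR => //; rewrite ?nnegrE ?addr_ge0 ?sqr_ge0 ?divr_ge0//.
rewrite /J lerD2l enorm_sqr /dot (bigD1 i)//= -expr2 lerDl.
by apply: sumr_ge0 => j _; rewrite -expr2 sqr_ge0.
Qed.

(** By [om_ge], the square is at most a multiple of (1 + |xi|^2)^(-2), which
    is integrable in dimension at most 3. *)
Lemma L2_om_inv : (fun xi => (om xi)^-1) \in Lfun mu 2%:E.
Proof.
have mo : measurable_fun setT (fun xi => (om xi)^-1).
  have -> : (fun xi => (om xi)^-1) = (fun xi => om xi `^ (- 1)).
    by apply/funext => x; rewrite powR_inv1// ltW// om_gt0.
  exact: (measurableT_comp (measurable_powR _) measurable_om).
apply/L2P; split => //.
apply: (@le_lt_trans _ _ (\int[mu]_xi ((om_lb ^- 2)%:E * (\prod_(i < n) majorant (tnth xi i))%:E))%E).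
  have mp : measurable_fun setT (fun xi => \prod_(i < n) majorant (tnth xi i)).
    apply: measurable_prod => i _.
    exact: (measurableT_comp (@measurable_majorant R) (@measurable_coord R n i)).
  apply: ge0_le_integral => //.
  - by move=> x _; rewrite lee_fin sqr_ge0.
  - by apply: mEFin; exact: measurable_funX.
  - by apply: emeasurable_funM => //; exact: mEFin.
  move=> xi _; rewrite -EFinM lee_fin.
  apply: le_trans (ler_wpM2l _ (japanese_majorant xi)); last by rewrite invr_ge0 sqr_ge0.
  rewrite -invfM exprVn lef_pV2 ?posrE ?mulr_gt0 ?exprn_gt0 ?om_gt0 ?om_lb_gt0 ?(lt_le_trans ltr01 (japanese_ge1 _))//.
  rewrite (_ : japanese xi ^+ 4 = (japanese xi ^+ 2) ^+ 2); last by rewrite -exprM.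
  rewrite -exprMn; have l0 : 0 <= om_lb * japanese xi ^+ 2 by rewrite mulr_ge0 ?sqr_ge0 ?(ltW om_lb_gt0).
  by rewrite ler_pXn2r// ?nnegrE ?(ltW (om_gt0 _))// om_ge.
have mp : measurable_fun setT (fun xi => \prod_(i < n) majorant (tnth xi i)).
  apply: measurable_prod => i _.
  exact: (measurableT_comp (@measurable_majorant R) (@measurable_coord R n i)).
rewrite ge0_integralZl//; last 3 first.
- exact: mEFin.
- by move=> xi _; rewrite lee_fin prodr_ge0// => i _; exact: majorant_ge0.
- by rewrite lee_fin invr_ge0 sqr_ge0.
rewrite (ge0_integral_prod_coord (f := fun _ => @majorant R)); last 2 first.
- by move=> _ x; exact: majorant_ge0.
- by move=> _; exact: measurable_majorant.
have := integral_majorant R; have : (0 <= \int[lebesgue_measure]_x (majorant x : R)%:E)%E.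
  by apply: integral_ge0 => x _; rewrite lee_fin majorant_ge0.
case: (integral _ _ _) => [r||]//= _ _.
by rewrite prod_EFin -EFinM ltry.
Qed.

End beam_symbol.

(** * Ordinary differential equations in a complete seminormed space *)

(** Square-integrable functions that agree almost everywhere are not
    identified, so [nm] is a seminorm, and two curves are the same when their
    distance is 0. The integral of a curve is replaced by its primitives,
    which the mean value inequality characterizes. *)
Section ode.
Variables (R : realType) (V : lmodType R) (nm : V -> R).
Hypothesis nmD : forall x y, nm (x + y) <= nm x + nm y.
Hypothesis nmZ : forall a x, nm (a *: x) = `|a| * nm x.
Hypothesis nm_complete : forall v : nat -> V, (forall k, nm (v k.+1 - v k) <= 2^-1 ^+ k) ->
  exists f, forall k, nm (v k - f) <= 4 * 2^-1 ^+ k.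
Implicit Types (s t r e h : R) (F G H : R -> V).

Lemma nm0 : nm 0 = 0.
Proof. by rewrite -(scale0r 0) nmZ normr0 mul0r. Qed.

Lemma nmN x : nm (- x) = nm x.
Proof. by rewrite -scaleN1r nmZ normrN1 mul1r. Qed.

Lemma nmBC x y : nm (x - y) = nm (y - x).
Proof. by rewrite -nmN opprB. Qed.

Lemma nm_ge0 x : 0 <= nm x.
Proof.
have := nmD x (- x); rewrite subrr nm0 nmN => h.
by rewrite -(@pmulrn_lge0 _ _ 2)// mulr2n.
Qed.

Lemma nmB x y : nm (x - y) <= nm x + nm y.
Proof. by rewrite -(nmN y) nmD. Qed.

Lemma nm_tri y x z : nm (x - z) <= nm (x - y) + nm (y - z).
Proof. by rewrite -[x in leLHS](subrK y) -addrA nmD. Qed.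

Lemma nm_sum (I : finType) (f : I -> V) : nm (\sum_i f i) <= \sum_i nm (f i).
Proof.
elim/big_ind2: _ => [|x a y b xa yb|//]; first by rewrite nm0.
exact: le_trans (nmD _ _) (lerD xa yb).
Qed.

Lemma le_geometric (x y c : R) : (forall k, x <= y + c * 2^-1 ^+ k) -> x <= y.
Proof.
move=> h; have c0 : y + c * 2^-1 ^+ k @[k --> \oo] --> y.
  rewrite -[X in _ --> X]addr0 -[X in _ --> y + X](mulr0 c).
  apply: cvgD; first exact: cvg_cst.
  apply: cvgM; first exact: cvg_cst.
  by apply: cvg_expr; rewrite ger0_norm// invf_lt1// ltr1n.
rewrite -(cvg_lim (@Rhausdorff R) c0); apply: limr_ge; first by apply: cvgP c0.
exact: nearW.
Qed.

(** A local Lipschitz bound adds up along a fine subdivision. *)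
Lemma chain H (d eta C : R) : 0 < eta ->
  (forall s t, 0 <= s -> s <= t -> t <= d -> t - s <= eta -> nm (H t - H s) <= (t - s) * C) ->
  forall t, 0 <= t -> t <= d -> nm (H t - H 0) <= t * C.
Proof.
move=> eta0 h t t0 td.
pose M := (Num.bound (t / eta)).+1.
have M0 : 0 < M%:R :> R by rewrite ltr0n.
have tM : t / M%:R <= eta.
  rewrite ler_pdivrMr// mulrC -ler_pdivrMr//.
  apply: le_trans (ltW (archi_boundP _)) _; first by rewrite divr_ge0// ltW.
  by rewrite ler_nat.
suff : forall j, (j <= M)%N -> nm (H (j%:R * (t / M%:R)) - H 0) <= j%:R * (t / M%:R) * C.
  by move=> /(_ M (leqnn M)); rewrite mulrCA divff ?mulr1// gt_eqF.
elim=> [|j IH] jM; first by rewrite !mul0r subrr nm0.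
apply: le_trans (nm_tri (H (j%:R * (t / M%:R))) _ _) _.
have tM0 : 0 <= t / M%:R by rewrite divr_ge0// ltW.
have E : j.+1%:R * (t / M%:R) - j%:R * (t / M%:R) = t / M%:R.
  by rewrite -mulrBl -natr1 addrAC subrr add0r mul1r.
rewrite addrC (_ : j.+1%:R * _ * C = j%:R * (t / M%:R) * C + t / M%:R * C); last first.
  by rewrite -{2}E; ring.
apply: lerD; first exact: IH (ltnW jM).
rewrite -{3}E; apply: h.
- by rewrite mulr_ge0.
- by rewrite ler_wpM2r// ler_nat.
- apply: le_trans td; rewrite mulrCA ler_piMr// ler_pdivrMr// mul1r ler_nat//.
- by rewrite E.
Qed.

Definition unif F := forall e, 0 < e -> exists2 eta, 0 < eta &
  forall s t, `|s - t| <= eta -> nm (F s - F t) <= e.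

(** A primitive of [F] on [0, d]: the estimate with [v = F s] is the mean
    value inequality. Any [v] is allowed, so that the estimate can be used
    with the value of [F], or of a limit, at any point of the interval. *)
Definition prim (d : R) F G := G 0 = 0 /\
  forall (v : V) (B s t : R), 0 <= s -> s <= t -> t <= d ->
    (forall r, s <= r -> r <= t -> nm (F r - v) <= B) ->
    nm (G t - G s - (t - s) *: v) <= (t - s) * B.

Section polygon.
Variables (F : R -> V) (h : R).
Hypothesis h0 : 0 < h.

(** The length of the part of [j h, (j + 1) h] that lies to the left of [t]. *)
Let lam (j : nat) t : R := Num.min (Num.max (t - j%:R * h) 0) h.

Let lam_sum N t : \sum_(j < N) lam j t = Num.min (Num.max t 0) (N%:R * h).
Proof.
elim: N => [|N IH]; first by rewrite big_ord0 mul0r min_r// le_max lexx orbT.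
rewrite big_ord_recr/= IH /lam -natr1 mulrDl mul1r.
have N0 : 0 <= N%:R * h by rewrite mulr_ge0// ltW.
move: (N%:R * h) N0 h0 => a a0 b0; rewrite /Num.min /Num.max.
by case: (ltP t 0) => ?; case: (ltP (t - a) 0) => ?; do ![case: ltP => ?]; lra.
Qed.

Let lam_mono j s t : s <= t -> lam j s <= lam j t.
Proof.
move=> st; rewrite /lam; move: (j%:R * h) h0 => a b0.
rewrite /Num.min /Num.max.
by case: (ltP (s - a) 0) => ?; case: (ltP (t - a) 0) => ?; do ![case: ltP => ?]; lra.
Qed.

Let lam_const j s t : s <= t -> ~ (s - h <= j%:R * h <= t) -> lam j s = lam j t.
Proof.
move=> st; rewrite /lam; move: (j%:R * h) h0 => a b0 n.
have {n} : a < s - h \/ t < a.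
  by have [|?] := ltP a (s - h); [left|right; rewrite ltNge; apply/negP => ?; apply: n; apply/andP].
rewrite /Num.min /Num.max.
by move=> [?|?]; case: (ltP (s - a) 0) => ?; case: (ltP (t - a) 0) => ?; do ![case: ltP => ?]; lra.
Qed.

(** The primitive of the step function with the values of [F] at the nodes. *)
Definition polygon (N : nat) t : V := \sum_(j < N) lam j t *: F (j%:R * h).

Lemma polygon0 N : polygon N 0 = 0.
Proof.
apply: big1 => j _; rewrite (_ : lam j 0 = 0) ?scale0r//.
rewrite /lam; have : 0 <= j%:R * h by rewrite mulr_ge0// ltW.
move: (j%:R * h) h0 => a b0 a0.
rewrite /Num.min /Num.max.
by case: (ltP (0 - a) 0) => ?; do ![case: ltP => ?]; lra.
Qed.

Lemma polygonP N (v : V) (B s t : R) : 0 <= s -> s <= t -> t <= N%:R * h ->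
  (forall r, s - h <= r -> r <= t -> nm (F r - v) <= B) ->
  nm (polygon N t - polygon N s - (t - s) *: v) <= (t - s) * B.
Proof.
move=> s0 st tN FB.
have tE r : 0 <= r -> r <= N%:R * h -> r = \sum_(j < N) lam j r.
  by move=> r0 rN; rewrite lam_sum max_l// min_l.
have dE : t - s = \sum_(j < N) (lam j t - lam j s).
  rewrite sumrB; congr (_ - _); apply: tE => //; first exact: le_trans st.
  exact: le_trans tN.
rewrite {1 2}dE -sumrB scaler_suml -sumrB mulr_suml.
apply: le_trans (nm_sum _) _; apply: ler_sum => j _.
rewrite -scalerBl -scalerBr nmZ ger0_norm ?subr_ge0 ?lam_mono//.
have [/andP[a b]|c] := pselect (is_true (s - h <= j%:R * h <= t)).
  by rewrite ler_wpM2l ?subr_ge0 ?lam_mono// FB.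
by rewrite (lam_const st c) subrr !mul0r.
Qed.

End polygon.

(** The polygons of mesh [h k] form a Cauchy sequence. *)
Lemma primitive_exists (d : R) F : 0 < d -> unif F -> exists G, prim d F G.
Proof.
move=> d0 uF; pose e k : R := 2^-1 ^+ k / (2 * (d + 1)).
have d1 : 0 < 2 * (d + 1) by rewrite mulr_gt0// addr_gt0.
have e0 k : 0 < e k by rewrite divr_gt0// exprn_gt0// invr_gt0.
have ek k : e k <= 2^-1 ^+ k.
  by rewrite ler_pdivrMr// ler_peMr ?exprn_ge0 ?invr_ge0//; move: d0; lra.
have /choice[eta etaP] k : exists eta, 0 < eta /\ forall s t, `|s - t| <= eta -> nm (F s - F t) <= e k.
  by have [eta ? ?] := uF _ (e0 k); exists eta.
pose h k := eta k / 2; have h0 k : 0 < h k by rewrite divr_gt0//; have [] := etaP k.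
pose N k := Num.bound (d / h k).
have Nh k : d <= (N k)%:R * h k.
  rewrite -ler_pdivrMr//; apply: ltW; apply: archi_boundP; rewrite divr_ge0// ltW//.
pose P k := polygon F (h k) (N k).
have Pstep k s t : 0 <= s -> s <= t -> t <= d -> t - s <= h k ->
    nm (P k t - P k s - (t - s) *: F s) <= (t - s) * e k.
  move=> s0 st td ts; apply: polygonP => //; first exact: le_trans (Nh k).
  move=> r sr rt; apply: (etaP k).2; rewrite ler_norml; move: sr rt ts; rewrite /h; lra.
have cauchy t k : 0 <= t -> t <= d -> nm (P k.+1 t - P k t) <= 2^-1 ^+ k.
  move=> t0 td.
  have := @chain (fun r => P k.+1 r - P k r) d (Num.min (h k) (h k.+1)) (e k + e k.+1) _ _ t t0 td.
  rewrite /P !polygon0// !subr0 => /(_ _ _)/le_trans; apply.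
  - by rewrite lt_min !h0.
  - move=> s r s0 sr rd; rewrite le_min => /andP[a b].
    have := Pstep k.+1 s r s0 sr rd b; have := Pstep k s r s0 sr rd a; rewrite -/(P k) -/(P k.+1).
    set A := P k r; set B := P k s; set A' := P k.+1 r; set B' := P k.+1 s; set v := _ *: _ => x y.
    rewrite (_ : A' - A - (B' - B) = (A' - B' - v) - (A - B - v)); last first.
      by rewrite !opprD !opprK !addrA [RHS](ACl (1*4*2*5*6*3))/= addrK.
    by rewrite mulrDr; apply: le_trans (nmB _ _) _; rewrite addrC lerD.
  - rewrite (_ : e k.+1 = e k / 2); last by rewrite /e exprS -mulrA mulrC.
    have dd : t * (e k + e k / 2) <= (d + 1) * (2 * e k).
      apply: ler_pM => //; [by rewrite addr_ge0// ?divr_ge0// ltW//|by move: td; lra|].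
      by have := e0 k; lra.
    apply: (le_trans dd); rewrite /e le_eqVlt; apply/orP; left; apply/eqP; field.
    by rewrite gt_eqF// addr_gt0.
have /choice[G GP] t : exists g, 0 <= t -> t <= d -> forall k, nm (P k t - g) <= 4 * 2^-1 ^+ k.
  case: (pselect (0 <= t /\ t <= d)) => [[t0 td]|ntd]; last by exists 0 => t0 td; case: ntd.
  by have [g ?] := nm_complete (fun k => cauchy t k t0 td); exists g.
exists (fun t => G t - G 0); split; first by rewrite subrr.
move=> v B s t s0 st td FB; apply: (@le_geometric _ _ ((t - s) + 8)) => k.
have tP := GP t (le_trans s0 st) td k; have sP := GP s s0 (le_trans st td) k.
rewrite (_ : G t - G 0 - (G s - G 0) - (t - s) *: v =
   (P k t - P k s - (t - s) *: v) - (P k t - G t) + (P k s - G s)); last first.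
  move: (P k t) (P k s) (G t) (G s) (G 0) (_ *: v) => a b x y z u.
  by rewrite !opprD !opprK !addrA [LHS](ACl (1*3*5*4*2))/= [RHS](ACl (5*7*3*6*2*1*4))/= !addrK.
apply: le_trans (nmD _ _) _; rewrite (_ : _ + _ * _ = (t - s) * (B + 2^-1 ^+ k) + 4 * 2^-1 ^+ k + 4 * 2^-1 ^+ k); last by ring.
rewrite lerD//; apply: le_trans (nmB _ _) _; rewrite lerD//.
apply: polygonP => //; first exact: le_trans (Nh k).
move=> r sr rt; have k0 : 0 <= 2^-1 ^+ k :> R by rewrite exprn_ge0// invr_ge0.
have [sr'|rs] := leP s r; first by rewrite (le_trans (FB r sr' rt))// lerDl.
apply: le_trans (nm_tri (F s) _ _) _; rewrite addrC lerD//; first exact: FB.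
apply: le_trans (ek k); apply: (etaP k).2.
by move: sr rs (etaP k).1; rewrite /h ler_norml => *; lra.
Qed.

(** On a fine subdivision both functions are nearly constant; [chain] adds up
    the local estimates. *)
Lemma prim_diff d F1 F2 G1 G2 (C : R) : unif F1 -> unif F2 -> prim d F1 G1 -> prim d F2 G2 ->
  (forall t, 0 <= t -> t <= d -> nm (F1 t - F2 t) <= C) ->
  forall t, 0 <= t -> t <= d -> nm (G1 t - G2 t) <= t * C.
Proof.
move=> u1 u2 [G10 p1] [G20 p2] FC t t0 td.
apply: (@le_geometric _ _ (t * 2)) => k.
have k0 : 0 < 2^-1 ^+ k :> R by rewrite exprn_gt0// invr_gt0.
have [e1 e10 h1] := u1 _ k0; have [e2 e20 h2] := u2 _ k0.
have := @chain (fun r => G1 r - G2 r) d (Num.min e1 e2) (C + 2 * 2^-1 ^+ k) _ _ t t0 td.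
rewrite G10 G20 !subr0 mulrDr mulrA; apply; first by rewrite lt_min e10.
move=> s r s0 sr rd; rewrite le_min => /andP[a b].
have q1 : nm (G1 r - G1 s - (r - s) *: F1 s) <= (r - s) * 2^-1 ^+ k.
  by apply: p1 => // x sx xr; apply: h1; rewrite ger0_norm ?subr_ge0//; lra.
have q2 : nm (G2 r - G2 s - (r - s) *: F2 s) <= (r - s) * 2^-1 ^+ k.
  by apply: p2 => // x sx xr; apply: h2; rewrite ger0_norm ?subr_ge0//; lra.
have rs0 : 0 <= r - s by rewrite subr_ge0.
have q3 : nm ((r - s) *: (F1 s - F2 s)) <= (r - s) * C.
  by rewrite nmZ ger0_norm// ler_wpM2l// FC// (le_trans sr).
move: q1 q2 q3; rewrite scalerBr.
move: (G1 r) (G1 s) (G2 r) (G2 s) (_ *: F1 s) (_ *: F2 s) => a1 b1 a2 b2 c1 c2 q1 q2 q3.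
rewrite (_ : a1 - a2 - (b1 - b2) = (a1 - b1 - c1) - (a2 - b2 - c2) + (c1 - c2)); last first.
  by rewrite !opprD !opprK !addrA [RHS](ACl (1*4*2*5*7*3*8*6)) /= subrK addrK.
apply: le_trans (nmD _ _) _; rewrite mulrDr addrC lerD//.
apply: le_trans (nmB _ _) _; apply: le_trans (lerD q1 q2) _.
by rewrite le_eqVlt; apply/orP; left; apply/eqP; ring.
Qed.

(** Each cell is split at its tag, where the derivative is taken. *)
Lemma riemann (X f : R -> V) (d e eta : R) :
  (forall s t, 0 <= s -> s <= d -> 0 <= t -> t <= d -> `|t - s| <= eta ->
     nm (X t - X s - (t - s) *: f s) <= `|t - s| * e) ->
  forall (N : nat) (tau theta : nat -> R), tau 0%N = 0 -> tau N <= d ->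
    (forall i, (i < N)%N -> tau i <= theta i <= tau i.+1 /\ tau i.+1 - tau i < eta) ->
    nm (X (tau N) - X 0 - \sum_(i < N) (tau i.+1 - tau i) *: f (theta i)) <= tau N * e.
Proof.
move=> Xf N tau theta tau0; elim: N => [|N IH] td tt.
  by rewrite big_ord0 tau0 subrr subr0 nm0 mul0r.
have tt' i : (i < N)%N -> tau i <= theta i <= tau i.+1 /\ tau i.+1 - tau i < eta.
  by move=> iN; apply: tt; exact: ltnW.
have tau_ge0 j : (j <= N.+1)%N -> 0 <= tau j.
  elim: j => [|j IHj] jN; first by rewrite tau0.
  have [/andP[a b] _] := tt j jN; apply: le_trans (IHj (ltnW jN)) (le_trans a b).
have [/andP[a b] c] := tt N (ltnSn N).
have N0 := tau_ge0 N (leqnSn N); have NS0 := tau_ge0 N.+1 (leqnn _).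
have IH' := IH (le_trans (le_trans a b) td) tt'.
have h0 := le_trans N0 a; have hd := le_trans b td.
have g1 := Xf (theta N) (tau N.+1) h0 hd NS0 td.
have g2 := Xf (theta N) (tau N) h0 hd N0 (le_trans (le_trans a b) td).
rewrite ger0_norm ?subr_ge0// in g1; rewrite ler0_norm ?subr_le0// opprB in g2.
have {}g1 := g1 ltac:(lra); have {}g2 := g2 ltac:(lra).
rewrite big_ord_recr/=.
move: g1 g2 IH'; set y := X (tau N.+1); set x := X (tau N); set z := X (theta N); set v := f (theta N).
set S := bigop _ _ _; move=> g1 g2 IH'.
have -> : y - X 0 - (S + (tau N.+1 - tau N) *: v) = (y - z - (tau N.+1 - theta N) *: v)
    - (x - z - (tau N - theta N) *: v) + (x - X 0 - S).
  have -> : (tau N.+1 - tau N) *: v = (tau N.+1 - theta N) *: v - (tau N - theta N) *: v.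
    by rewrite -scalerBl opprB addrA subrK.
  move: (X 0) (_ *: v) (_ *: v) => o v1 v2; rewrite !opprD !opprK !addrA.
  by rewrite [RHS](ACl (1*8*9*3*6*5*2*7*4))/= !addrK.
apply: le_trans (nmD _ _) _; apply: le_trans (lerD (nmB _ _) (lexx _)) _.
by move: g1 g2 IH'; lra.
Qed.

Section picard.
Variables (d M L : R) (x0 : V) (Phi : R -> V -> V).
Hypotheses (d0 : 0 < d) (L0 : 0 <= L) (dL : d * L <= 2^-1) (x0M : 2 * nm x0 <= M).
Hypothesis lip : forall t x y, 0 <= t -> t <= d -> nm x <= M -> nm y <= M ->
  nm (Phi t x - Phi t y) <= L * nm (x - y).
Hypothesis bnd : forall t x, 0 <= t -> t <= d -> nm x <= M -> nm (Phi t x) <= L * M.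
Hypothesis cnt : forall t x e, 0 <= t -> t <= d -> nm x <= M -> 0 < e ->
  exists2 eta, 0 < eta & forall s, 0 <= s -> s <= d -> `|s - t| < eta ->
    nm (Phi s x - Phi t x) <= e.

(** Clamping extends curves on [0, d] to the line by constants, so that
    uniform continuity can be stated without reference to the interval. *)
Definition clamp t : R := Num.max 0 (Num.min t d).

Lemma clamp_itv t : 0 <= clamp t /\ clamp t <= d.
Proof. by rewrite /clamp /Num.max /Num.min; case: (ltP t d) => ?; do ![case: ltP => ?]; split; move: d0 => ?; lra. Qed.

Lemma clamp_id t : 0 <= t -> t <= d -> clamp t = t.
Proof. by rewrite /clamp /Num.max /Num.min => ? ?; case: (ltP t d) => ?; do ![case: ltP => ?]; move: d0 => ?; lra. Qed.

Lemma clamp_lip s t : `|clamp s - clamp t| <= `|s - t|.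
Proof.
wlog st : s t / s <= t => [h|].
  by have [/h//|/ltW/h] := leP s t; rewrite distrC (distrC t).
rewrite distrC (distrC s) (ger0_norm (_ : 0 <= t - s)) ?subr_ge0// ler_norml.
rewrite /clamp /Num.max /Num.min; move: d0 => ?.
by case: (ltP t d) => ?; case: (ltP s d) => ?; do ![case: ltP => ?]; apply/andP; split; lra.
Qed.

(** The Heine-Cantor theorem, by compactness of [0, d]. *)
Lemma heine (f : R -> V) :
  (forall t e, 0 <= t -> t <= d -> 0 < e -> exists2 eta, 0 < eta &
     forall s, 0 <= s -> s <= d -> `|s - t| < eta -> nm (f s - f t) <= e) ->
  unif (f \o clamp).
Proof.
move=> fc e e0; have e20 : 0 < e / 2 by rewrite divr_gt0.
pose P (eta t : R) := 0 <= t -> t <= d ->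
  forall s, 0 <= s -> s <= d -> `|s - t| <= eta -> nm (f s - f t) <= e.
have H t : `[0, d]%classic t -> \forall x' \near t & i \near 0^'+, P i x'.
  rewrite /= in_itv/= => /andP[t0 td].
  have [eta eta0 h] := fc t (e / 2) t0 td e20.
  exists (ball t (eta / 2), [set y | y < eta / 2]).
    split; first by apply: nbhsx_ballx; rewrite divr_gt0.
    by apply: nbhs_right_lt; rewrite divr_gt0.
  move=> [t' y] /= [tt' yeta] t'0 t'd s s0 sd st'.
  have tt : `|t' - t| < eta / 2 by rewrite distrC.
  have st : `|s - t| < eta.
    by apply: le_lt_trans (ler_distD t' _ _) _; move: tt yeta st'; lra.
  apply: le_trans (nm_tri (f t) _ _) _; rewrite [nm (f t - _)]nmBC.
  have := h s s0 sd st; have : nm (f t' - f t) <= e / 2.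
    by apply: h => //; move: tt eta0; lra.
  by lra.
have C : near_covering (`[0, d]%classic : set R) by apply/compact_near_coveringP; exact: segment_compact.
have [eta /= eta0 etaP] := C R 0^'+ P _ H.
exists (eta / 2); first by rewrite divr_gt0.
move=> s t st; have [s0 sd] := clamp_itv s; have [t0 td] := clamp_itv t.
have eta2 : 0 < eta / 2 by rewrite divr_gt0.
apply: (etaP (eta / 2) _ eta2 (clamp t) _ t0 td) => //.
- by rewrite /ball/= sub0r normrN gtr0_norm//; lra.
- by rewrite /= in_itv/= t0 td.
- exact: le_trans (clamp_lip _ _) st.
Qed.

Lemma bounded_curve (f : R -> V) :
  (forall t e, 0 <= t -> t <= d -> 0 < e -> exists2 eta, 0 < eta &
     forall s, 0 <= s -> s <= d -> `|s - t| < eta -> nm (f s - f t) <= e) ->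
  exists B, forall t, 0 <= t -> t <= d -> nm (f t) <= B.
Proof.
move=> fc; pose P (B t : R) := 0 <= t -> t <= d -> nm (f t) <= B.
have H t : `[0, d]%classic t -> \forall x' \near t & i \near +oo, P i x'.
  rewrite /= in_itv/= => /andP[t0 td].
  have [eta eta0 h] := fc t 1 t0 td ltr01.
  exists (ball t eta, [set y | nm (f t) + 1 < y]).
    split; first exact: nbhsx_ballx.
    by exists (nm (f t) + 1); split; rewrite ?num_real.
  move=> [t' y] /= [tt' yt] t'0 t'd; apply: le_trans (ltW yt).
  rewrite /ball/= distrC in tt'; have a := h t' t'0 t'd tt'.
  by have := nm_tri (f t') (f t) 0; have := nm_tri (f t) (f t') 0; rewrite !subr0; lra.
have C : near_covering (`[0, d]%classic : set R) by apply/compact_near_coveringP; exact: segment_compact.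
have [B [_ BP]] := C R +oo P _ H.
exists (B + 1) => t t0 td; apply: (BP (B + 1) _ t) => //; first by rewrite ltrDl.
by rewrite /= in_itv/= t0 td.
Qed.

Let M0 : 0 <= M.
Proof. by apply: le_trans x0M; rewrite mulr_ge0// nm_ge0. Qed.

(** The curves among which the iteration takes place; the Lipschitz bound
    keeps [field] uniformly continuous. *)
Definition good (x : R -> V) :=
  (forall t, 0 <= t -> t <= d -> nm (x t) <= M) /\
  (forall s t, 0 <= s -> s <= t -> t <= d -> nm (x t - x s) <= (t - s) * (L * M)).

Definition field (x : R -> V) t := Phi (clamp t) (x (clamp t)).

Lemma unif_field x : good x -> unif (field x).
Proof.
move=> [xM xL]; apply: (@heine (fun t => Phi t (x t))) => t e t0 td e0.
have e20 : 0 < e / 2 by rewrite divr_gt0.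
have LM : 0 <= L * (L * M) by rewrite !mulr_ge0.
have [eta eta0 h] := cnt t0 td (xM t t0 td) e20.
pose k : R := L * (L * M) + 1; have k0 : 0 < k by rewrite ltr_wpDl.
exists (Num.min eta (e / 2 / k)); first by rewrite lt_min eta0 divr_gt0.
move=> s s0 sd; rewrite lt_min => /andP[s1]; rewrite ltr_pdivlMr// => s2.
apply: le_trans (nm_tri (Phi s (x t)) _ _) _.
have a1 := h s s0 sd s1.
have a2 : nm (Phi s (x s) - Phi s (x t)) <= L * (`|s - t| * (L * M)).
  apply: le_trans (lip s0 sd (xM s s0 sd) (xM t t0 td)) _; rewrite ler_wpM2l//.
  have [st|ts] := leP s t; first by rewrite distrC nmBC ger0_norm ?subr_ge0// xL.
  by rewrite ger0_norm ?subr_ge0 ?(ltW ts)// xL// ltW.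
have a3 : L * (`|s - t| * (L * M)) <= `|s - t| * k.
  by rewrite mulrCA ler_wpM2l// lerDl.
lra.
Qed.

Lemma field_id x t : 0 <= t -> t <= d -> field x t = Phi t (x t).
Proof. by move=> t0 td; rewrite /field clamp_id. Qed.

Lemma prim_bound x G s t : good x -> prim d (field x) G -> 0 <= s -> s <= t -> t <= d ->
  nm (G t - G s) <= (t - s) * (L * M).
Proof.
move=> [xM _] [_ GP] s0 st td; have := GP 0 (L * M) s t s0 st td.
rewrite scaler0 subr0; apply => r sr rt; rewrite subr0 field_id ?bnd ?xM//.
- exact: le_trans sr.
- exact: le_trans rt td.
- exact: le_trans sr.
- exact: le_trans rt td.
- exact: le_trans sr.
- exact: le_trans rt td.
Qed.

Lemma picard_step x : exists y, good x ->
  good y /\ exists2 G, prim d (field x) G & y = (fun t => x0 + G t).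
Proof.
have [gx|?] := pselect (good x); last by exists x.
have [G GP] := primitive_exists d0 (unif_field gx); exists (fun t => x0 + G t) => _.
split; last by exists G.
have Gb s t := @prim_bound x G s t gx GP.
split=> [t t0 td|s t s0 st td].
  apply: le_trans (nmD _ _) _; have := Gb 0 t (lexx 0) t0 td.
  rewrite GP.1 !subr0 => Gt; have : t * (L * M) <= 2^-1 * M.
    rewrite mulrA ler_wpM2r// (le_trans _ dL)// ler_wpM2r//.
  by move: x0M; lra.
by rewrite opprD addrACA subrr add0r; exact: Gb.
Qed.

Lemma complete_scaled (K : R) (v : nat -> V) : 0 < K ->
  (forall k, nm (v k.+1 - v k) <= K * 2^-1 ^+ k) ->
  exists f, forall k, nm (v k - f) <= 4 * K * 2^-1 ^+ k.
Proof.
move=> K0 vK; have [k|f fP] := nm_complete (v := fun k => K^-1 *: v k).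
  by rewrite -scalerBr nmZ gtr0_norm ?invr_gt0// ler_pdivrMl.
exists (K *: f) => k; have -> : v k - K *: f = K *: (K^-1 *: v k - f).
  by rewrite scalerBr scalerA divff ?scale1r// gt_eqF.
by rewrite nmZ gtr0_norm// [4 * K]mulrC -mulrA ler_pM2l.
Qed.

(** Picard iteration; as [d * L <= 1 / 2], each step halves the distance. The
    derivative is uniform in time, which is what [riemann] requires. *)
Theorem picard : exists X : R -> V,
  [/\ nm (X 0 - x0) = 0,
      forall t, 0 <= t -> t <= d -> nm (X t) <= M,
      forall s t, 0 <= s -> s <= t -> t <= d -> nm (X t - X s) <= (t - s) * (L * M) &
      forall e, 0 < e -> exists2 eta, 0 < eta & forall s t, 0 <= s -> s <= d -> 0 <= t -> t <= d ->
        `|t - s| <= eta -> nm (X t - X s - (t - s) *: Phi s (X s)) <= `|t - s| * e].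
Proof.
have [T TP] := choice picard_step.
pose x k := iter k T (fun=> x0).
have gx k : good (x k).
  elim: k => [|k IH]; last by have [] := TP _ IH.
  split=> [t _ _|s t s0 st td].
    by apply: le_trans x0M; have := nm_ge0 x0; lra.
  by rewrite subrr nm0 mulr_ge0 ?subr_ge0// mulr_ge0.
have xS k : exists2 G, prim d (field (x k)) G & x k.+1 = (fun t => x0 + G t).
  by have [] := TP _ (gx k).
have xc k t : 0 <= t -> t <= d -> nm (x k.+1 t - x k t) <= (M + 1) * 2^-1 ^+ k.
  elim: k t => [|k IH] t t0 td.
    have [G GP ->] := xS 0%N; rewrite /= addrAC subrr add0r expr0 mulr1.
    have := prim_bound (gx 0%N) GP (lexx 0) t0 td; rewrite GP.1 !subr0 => /le_trans; apply.
    have : t * (L * M) <= 2^-1 * M.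
      rewrite mulrA ler_wpM2r// (le_trans _ dL)// ler_wpM2r//.
    by move: M0; lra.
  have [G1 GP1 ->] := xS k.+1; have [G2 GP2 ->] := xS k.
  rewrite opprD addrACA subrr add0r.
  have := prim_diff (unif_field (gx k.+1)) (unif_field (gx k)) GP1 GP2 (C := L * ((M + 1) * 2^-1 ^+ k)) _ t0 td.
  move=> /(_ _)/le_trans; apply.
    move=> r r0 rd; rewrite !field_id//; have [? _] := gx k; have [? _] := gx k.+1.
    by apply: le_trans (lip _ _ _ _) _ => //; rewrite ?ler_wpM2l ?IH//; auto.
  rewrite mulrA exprS [leRHS]mulrCA ler_wpM2r ?(le_trans _ dL) ?ler_wpM2r//.
  by rewrite mulr_ge0 ?exprn_ge0 ?invr_ge0 ?addr_ge0.
have K0 : 0 < M + 1 by rewrite ltr_wpDl.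
have /choice[X XP] t : exists f, 0 <= t -> t <= d -> forall k, nm (x k t - f) <= 4 * (M + 1) * 2^-1 ^+ k.
  case: (pselect (0 <= t /\ t <= d)) => [[t0 td]|ntd]; last by exists 0 => t0 td; case: ntd.
  by have [g ?] := complete_scaled K0 (fun k => xc k t t0 td); exists g.
have gX : good X.
  split=> [t t0 td|s t s0 st td]; apply: (@le_geometric _ _ (8 * (M + 1))) => k.
    have := XP t t0 td k; have := (gx k).1 t t0 td; have := nm_tri (x k t) (X t) 0.
    rewrite !subr0 [nm (X t - _)]nmBC.
    have : 0 <= (M + 1) * 2^-1 ^+ k by rewrite mulr_ge0 ?exprn_ge0 ?invr_ge0 ?addr_ge0.
    by rewrite -!mulrA; lra.
  have b1 := XP t (le_trans s0 st) td k; have b2 := XP s s0 (le_trans st td) k.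
  have b3 := (gx k).2 s t s0 st td; have b4 := nm_tri (x k t) (X t) (X s).
  have b5 := nm_tri (x k s) (x k t) (X s); rewrite [nm (X t - x _ _)]nmBC in b4.
  by move: b1 b2 b3 b4 b5; rewrite -!mulrA; lra.
exists X; split.
- have h : nm (X 0 - x0) <= 0.
    apply: (@le_geometric _ _ (8 * (M + 1))) => k; have := XP 0 (lexx 0) (ltW d0) k.+1.
    have [G [G0 _] ->] := xS k; rewrite G0 addr0 nmBC add0r => /le_trans; apply.
    rewrite exprS -!mulrA; have : 0 <= (M + 1) * 2^-1 ^+ k by rewrite mulr_ge0 ?exprn_ge0 ?invr_ge0 ?addr_ge0.
    by lra.
  by apply/eqP; rewrite eq_le h nm_ge0.
- exact: gX.1.
- exact: gX.2.
move=> e e0; have [eta eta0 etaP] := unif_field gX e0.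
exists eta => // s t s0 sd t0 td st.
(* The base point [s] may be either end of the interval, so that the
   estimate holds on both sides in time. *)
have key a b : 0 <= a -> a <= b -> b <= d -> (forall r, a <= r -> r <= b -> `|r - s| <= eta) ->
    nm (X b - X a - (b - a) *: Phi s (X s)) <= (b - a) * e.
  move=> a0 ab bd near_s; have a0' := le_trans ab bd; have b0 := le_trans a0 ab.
  pose c : R := (b - a) * (L * (4 * (M + 1))) + 8 * (M + 1).
  apply: (@le_geometric _ _ c) => k.
  have [G [_ GP] xk] := xS k.
  have := GP (Phi s (X s)) (e + L * (4 * (M + 1) * 2^-1 ^+ k)) a b a0 ab bd.
  have K1 : 0 <= (M + 1) * 2^-1 ^+ k by rewrite mulr_ge0 ?exprn_ge0 ?invr_ge0 ?addr_ge0.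
  move=> /(_ _) GP'; have {}GP' : nm (G b - G a - (b - a) *: Phi s (X s)) <= (b - a) * (e + L * (4 * (M + 1) * 2^-1 ^+ k)).
    apply: GP' => r ar rb; have r0 := le_trans a0 ar; have rd := le_trans rb bd.
    apply: le_trans (nm_tri (field X r) _ _) _; rewrite addrC lerD//.
      by have := etaP r s (near_s r ar rb); rewrite [field X s]field_id.
    rewrite !field_id//; apply: le_trans (lip r0 rd ((gx k).1 r r0 rd) (gX.1 r r0 rd)) _.
    by rewrite ler_wpM2l// XP.
  have b1 := XP b b0 bd k.+1; have b2 := XP a a0 a0' k.+1.
  have xG : x k.+1 b - x k.+1 a = G b - G a by rewrite xk opprD addrACA subrr add0r.
  rewrite (_ : X b - X a - _ = (X b - x k.+1 b) + (x k.+1 b - x k.+1 a - (b - a) *: Phi s (X s)) +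
    (x k.+1 a - X a)); last by rewrite !addrA subrK [RHS](ACl (1*5*3*4*2))/= addrK.
  apply: le_trans (nmD _ _) _; apply: le_trans (lerD (nmD _ _) (lexx _)) _.
  rewrite xG nmBC; move: GP' b1 b2; rewrite /c exprS; move: K1.
  set z1 := nm _; set z2 := nm _; set z3 := nm _.
  move: (2^-1 ^+ k) z1 z2 z3 => q z3 z1 z2 K1 GP' b1 b2.
  have : z1 + z3 + z2 <= 4 * (M + 1) * (2^-1 * q) + (b - a) * (e + L * (4 * (M + 1) * q)) + 4 * (M + 1) * (2^-1 * q) by lra.
  move=> /le_trans; apply; rewrite -subr_ge0.
  rewrite (_ : _ - _ = 4 * ((M + 1) * q)); last by field.
  by rewrite mulr_ge0.
have [ts|ts] := leP s t.
  rewrite ger0_norm ?subr_ge0//; apply: key => // r sr rt.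
  by rewrite ger0_norm ?subr_ge0// (le_trans _ st)// ger0_norm ?subr_ge0// lerD2r.
rewrite ltr0_norm ?subr_lt0// opprB.
have -> : X t - X s - (t - s) *: Phi s (X s) = - (X s - X t - (s - t) *: Phi s (X s)).
  by rewrite opprD opprK opprB -[in LHS]scaleNr opprB.
rewrite nmN; apply: key => //; first exact: ltW.
move=> r tr rs; rewrite ler0_norm ?subr_le0// opprB (le_trans _ st)//.
by rewrite ltr0_norm ?subr_lt0// opprB lerD2l lerN2.
Qed.

End picard.
End ode.

(** A form of [psi t <= c * int_0^t psi] in terms of Riemann sums. With the
    weight exp (l t) and l > 2 c, each application of the hypothesis halves
    the bound. *)
Lemma gronwall (R : realType) (d c B : R) (psi : R -> R) : 0 <= c ->
  (forall t, 0 <= t -> t <= d -> psi t <= B) ->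
  (forall t e, 0 <= t -> t <= d -> 0 < e -> exists2 N : nat, (0 < N)%N &
     psi t <= e + c * \sum_(i < N) t / N%:R * psi (i%:R * (t / N%:R))) ->
  forall t, 0 <= t -> t <= d -> psi t <= 0.
Proof.
move=> c0 psiB H; pose l := 2 * c + 1; have l0 : 0 < l by rewrite ltr_wpDl// mulr_ge0.
have claim j : forall t, 0 <= t -> t <= d -> psi t <= `|B| * 2^-1 ^+ j * expR (l * t).
  elim: j => [|j IH] t t0 td.
    rewrite mulr1; apply: le_trans (psiB t t0 td) _; apply: le_trans (ler_norm _) _.
    by rewrite ler_peMr// -expR0 ler_expR mulr_ge0// ltW.
  have A0 : 0 <= `|B| * 2^-1 ^+ j by rewrite mulr_ge0// exprn_ge0// invr_ge0.
  move: IH; rewrite exprS [_ * (2^-1 * _)]mulrCA; move: (_ * _ ^+ j) A0 => A A0 IH.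
  apply/ler_addgt0Pl => e e0; have [N N0 psiN] := H t e t0 td e0.
  apply: le_trans psiN _; rewrite lerD2l.
  have NR0 : 0 < N%:R :> R by rewrite ltr0n.
  pose h := t / N%:R; have h0 : 0 <= h by rewrite divr_ge0// ltW.
  have hN : N%:R * h = t by rewrite mulrC divfK// gt_eqF.
  have S : l * \sum_(i < N) h * psi (i%:R * h) <= A * expR (l * t).
    have : l * \sum_(i < N) h * psi (i%:R * h) <= A * (expR (l * (N%:R * h)) - expR (l * (0%:R * h))).
      have -> : expR (l * (N%:R * h)) - expR (l * (0%:R * h)) = \sum_(i < N) (expR (l * (i.+1%:R * h)) - expR (l * (i%:R * h))).
        by rewrite -(big_mkord xpredT (fun i => expR (l * (i.+1%:R * h)) - expR (l * (i%:R * h)))) telescope_sumr.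
      rewrite !mulr_sumr; apply: ler_sum => i _.
      have ih : i%:R * h <= d.
        apply: le_trans td; rewrite -hN ler_wpM2r// ler_nat; exact: ltnW.
      apply: (@le_trans _ _ (l * (h * (A * expR (l * (i%:R * h)))))).
        by rewrite ler_wpM2l ?(ltW l0)// ler_wpM2l// IH// mulr_ge0.
      rewrite (_ : _ * (h * _) = A * (l * h * expR (l * (i%:R * h)))); last by ring.
      rewrite ler_wpM2l// (_ : l * (i.+1%:R * h) = l * h + l * (i%:R * h)); last by rewrite -natr1; ring.
      rewrite expRD -[X in _ <= _ - X]mul1r -mulrBl ler_wpM2r ?expR_ge0//.
      by rewrite lerBrDl expR_ge1Dx.
    move=> /le_trans; apply; rewrite hN mul0r mulr0 expR0 ler_wpM2l// lerBlDr lerDl//.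
  have Sl : \sum_(i < N) h * psi (i%:R * h) <= A * expR (l * t) / l by rewrite ler_pdivlMr// mulrC.
  apply: le_trans (ler_wpM2l c0 Sl) _; rewrite -[leRHS]mulrA.
  rewrite (_ : c * (A * expR (l * t) / l) = c / l * (A * expR (l * t))); last by ring.
  rewrite ler_wpM2r ?mulr_ge0 ?expR_ge0// ler_pdivrMr// /l; move: c0; lra.
move=> t t0 td; apply: (@le_geometric _ _ _ (`|B| * expR (l * t))) => k.
by rewrite add0r mulrAC; exact: claim.
Qed.

(** * Reading the function spaces on the transform side *)

Section transfer.
Variables (R : realType) (n : nat).
Local Notation T := (Rn R n).
Local Notation mu := (lebesgueRn R n).
Local Notation L2 f := (f \in Lfun mu 2%:E).
Local Notation n2 := (norm2 mu).
Local Notation sqn := (sqnorm mu).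
Local Open Scope complex_scope.
Implicit Types (f g h k u v : T -> R) (F G : T -> R[i]) (x xi : T) (s r : R).

(** [F] is real almost everywhere, with Hartley transform [h]. *)
Definition Hr F h := is_hart (Ref F) h /\ is_hart (Imf F) (fun=> 0).

Lemma Hr_cplx v h : is_hart v h -> Hr (cplx v) h.
Proof. by move=> vh; split => //; exact: is_hart0. Qed.

Lemma HrB F G h k : Hr F h -> Hr G k -> Hr (F \- G)%R (fun xi => h xi - k xi).
Proof.
move=> [a b] [c e]; split; first by rewrite Ref_sub; exact: is_hartB.
rewrite Imf_sub; have := is_hartB b e.
by under [X in is_hart _ X]eq_fun do rewrite subrr.
Qed.

Lemma HrD F G h k : Hr F h -> Hr G k -> Hr (fun x => F x + G x) (fun xi => h xi + k xi).
Proof.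
move=> [a b] [c e]; split.
- have := is_hartD a c; congr (is_hart _ _); apply/funext => x.
  by rewrite /Ref; case: (F x) (G x) => p q [p' q'].
- have := is_hartD b e; rewrite -[X in is_hart _ X -> _]/(fun xi => 0 + 0); under [X in is_hart _ X -> _]eq_fun do rewrite addr0.
  congr (is_hart _ _); apply/funext => x.
  by rewrite /Imf; case: (F x) (G x) => p q [p' q'].
Qed.

Lemma HrZ (a : R) F h : Hr F h -> Hr (fun x => a%:C * F x) (fun xi => a * h xi).
Proof.
move=> [p q]; split.
- have := is_hartZ a p; congr (is_hart _ _); apply/funext => x.
  by rewrite /Ref; case: (F x) => b c /=; rewrite mul0r subr0.
- have := is_hartZ a q; under [X in is_hart _ X -> _]eq_fun do rewrite mulr0.
  congr (is_hart _ _); apply/funext => x.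
  by rewrite /Imf; case: (F x) => b c /=; rewrite mul0r addr0.
Qed.

Lemma Hr0 : Hr (fun=> 0) (fun=> 0).
Proof. by split; exact: is_hart0. Qed.

Lemma Hr_sum N (F : 'I_N -> T -> R[i]) (h : 'I_N -> T -> R) : (forall i, Hr (F i) (h i)) ->
  Hr (fun x => \sum_(i < N) F i x) (fun xi => \sum_(i < N) h i xi).
Proof.
elim: N F h => [|N IH] F h Fh.
  by under eq_fun do rewrite big_ord0; under [X in Hr _ X]eq_fun do rewrite big_ord0; exact: Hr0.
under eq_fun do rewrite big_ord_recr; under [X in Hr _ X]eq_fun do rewrite big_ord_recr.
exact: HrD (IH (fun i => F (widen_ord (leqnSn N) i)) (fun i => h (widen_ord (leqnSn N) i)) (fun i => Fh _)) (Fh _).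
Qed.

Lemma Hr_multiplier (a : T -> R) F h M : measurable_fun setT a ->
  (forall xi, `|a xi| <= M) -> (forall xi, a (tneg xi) = a xi) ->
  Hr F h -> Hr (multiplier a F) (fun xi => a xi * h xi).
Proof.
move=> ma aM aN [p q]; have [p' q'] := multiplier_hart ma aM aN p q.
by split => //; move: q'; under [X in is_hart _ X -> _]eq_fun do rewrite mulr0.
Qed.

Lemma poweR_half_lty (a : \bar R) : (0 <= a)%E -> (a `^ 2^-1 < +oo)%E -> (a < +oo)%E.
Proof.
case: a => [a _ _|_|//]; first exact: ltry.
by rewrite poweRyr// invr_eq0.
Qed.

Lemma in_H_in_Lp s r F : in_H s r F -> in_Lp 2 F.
Proof. by move=> [[g []]]. Qed.

Lemma normH_lty s r F h : is_hart (Ref F) h -> in_Lp 2 F -> (normH s r F < +oo)%E ->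
  L2 (fun xi => wt s r xi * h xi) /\ ((n2 (fun xi => wt s r xi * h xi))%:E <= normH s r F)%E.
Proof.
move=> Fh [F1 F2]; have [k Fk] := is_hart_exists F2; rewrite (normHE s r Fh Fk).
set A := sqn _; set B := sqn _.
have A0 : (0 <= A)%E by exact: sqn_ge0.
have B0 : (0 <= B)%E by exact: sqn_ge0.
move=> fin; have ABo := poweR_half_lty (adde_ge0 A0 B0) fin.
have Ao : (A < +oo)%E by apply: le_lt_trans ABo; rewrite leeDl.
have Bo : (B < +oo)%E by apply: le_lt_trans ABo; rewrite leeDr.
have hL : L2 (fun xi => wt s r xi * h xi).
  apply/L2P; split => //; apply: measurable_funM; first exact: measurable_wt.
  by have [_ hL _] := Fh; exact: (L2_measurable hL).
split => //; rewrite n2_sqrt -/A.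
move: A B A0 B0 Ao Bo {fin ABo} => [a||]// [b||]// a0 b0 _ _.
rewrite -EFinD poweR_EFin powR12_sqrt ?lee_fin/= ?addr_ge0//.
by rewrite ler_wsqrtr// lerDl.
Qed.

Lemma normH_Hr s r F h : Hr F h -> L2 (fun xi => wt s r xi * h xi) ->
  normH s r F = (n2 (fun xi => wt s r xi * h xi))%:E.
Proof.
move=> [p q] hL; rewrite (normHE s r p q).
under [X in (_ + sqn X)%E]eq_fun do rewrite mulr0.
have -> : sqn (fun=> 0) = 0%E by rewrite sqnE ?L2_0// n2_0 expr0n.
by rewrite adde0 sqnE// poweR_EFin powR12_sqrt ?sqr_ge0// sqrtr_sqr ger0_norm ?n2_ge0.
Qed.

Lemma in_H_Hr s r F h : Hr F h -> L2 (fun xi => wt s r xi * h xi) -> in_H s r F.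
Proof.
move=> Fh hL; split; last by rewrite (normH_Hr Fh hL) ltry.
by exists (four h (fun=> 0)); apply: is_fourier_four; case: Fh.
Qed.

Lemma wt0 s xi : wt s 0 xi = cw s xi.
Proof. by rewrite /wt powRr0 mulr1. Qed.

Lemma wt2 s xi : wt s 2 xi = cw s xi * japanese xi ^+ 2.
Proof. by rewrite /wt -powR_mulrn// (le_trans ler01 (japanese_ge1 _)). Qed.

Lemma hart_inj u v h k : is_hart u h -> is_hart v k -> {ae mu, forall xi, h xi = k xi} ->
  {ae mu, forall x, u x = v x}.
Proof.
move=> uh vk hk; have := is_hart_unique (is_hartK uh) (is_hartK vk) hk.
apply: filterS => x /mulfI; apply.
by rewrite expf_neq0// mulf_neq0// gt_eqF// pi_gt0.
Qed.

(** Otherwise the conclusion would fail along a sequence tending to [t],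
    against dominated convergence. *)
Lemma strong_cvg0 (a : R -> T -> R) (B t : R) v : (forall s, measurable_fun setT (a s)) ->
  (forall s xi, `|a s xi| <= B) ->
  (forall xi e, 0 < e -> exists2 eta, 0 < eta & forall s, s != t -> `|s - t| < eta -> `|a s xi| <= e) ->
  L2 v -> forall e, 0 < e -> exists2 eta, 0 < eta &
    forall s, s != t -> `|s - t| < eta -> n2 (fun xi => a s xi * v xi) <= e.
Proof.
move=> ma aB a0 vL e e0; apply: contrapT => H.
have : forall k : nat, exists s, s != t /\ (`|s - t| < k.+1%:R^-1 /\ e < n2 (fun xi => a s xi * v xi)).
  move=> k; apply: contrapT => /forallNP K; apply: H; exists k.+1%:R^-1; first by rewrite invr_gt0.
  by move=> s st sk; rewrite leNgt; apply/negP => h; apply: (K s).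
move=> /choice[s sP].
have : n2 (fun xi => a (s k) xi * v xi - 0) @[k --> \oo] --> 0.
  have := @n2_dominated R n (fun (k : nat) xi => a (s k) xi * v xi) (fun _ : T => 0 : R) (fun xi => B * v xi).
  apply.
  - by move=> k; apply: measurable_funM => //; exact: (L2_measurable vL).
  - by [].
  - exact: L2Z.
  - by move=> k xi; rewrite subr0 !normrM ler_wpM2r// (le_trans (aB _ _))// ler_norm.
  apply: aeW => xi; apply/cvgr0Pnorm_le => d d0.
  have vd : 0 < d / (`|v xi| + 1) by rewrite divr_gt0// ltr_wpDl.
  have [eta eta0 h] := a0 xi _ vd; near=> k.
  have [sk [sk1 _]] := sP k; rewrite normrM.
  apply: (@le_trans _ _ (d / (`|v xi| + 1) * `|v xi|)).
    rewrite ler_wpM2r// h// (lt_trans sk1)//; near: k; exact: near_infty_natSinv_lt (PosNum eta0).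
  by rewrite mulrAC ler_pdivrMr ?ltr_wpDl// ler_pM2l// lerDl.
move=> /cvgr0Pnorm_lt/(_ e e0) [N _ /(_ N (leqnn N))].
have [_ [_ eN]] := sP N; under eq_fun do rewrite subr0.
rewrite ger0_norm ?n2_ge0// => eN'; by move: (lt_trans eN eN'); rewrite ltxx.
Unshelve. all: by end_near.
Qed.

End transfer.

(** * The equation on the transform side *)

Section trigonometry.
Variable R : realType.
Implicit Types (a b : R) (f df : R -> R).

Lemma mvt f df a b : (forall x, is_derive x (1 : R) f (df x)) ->
  exists2 c, `|c - a| <= `|b - a| & f b - f a = df c * (b - a).
Proof.
move=> fd; have cf x : {for x, continuous f}.
  by apply/differentiable_continuous/derivable1_diffP; have [] := fd x.
have [ab|/ltW ba] := leP a b.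
  have [c] := @MVT_segment R f df a b ab (fun x _ => fd x) (continuous_subspaceT cf).
  rewrite in_itv/= => /andP[ac cb] e; exists c => //.
  by rewrite !ger0_norm ?subr_ge0// lerD2r.
have [c] := @MVT_segment R f df b a ba (fun x _ => fd x) (continuous_subspaceT cf).
rewrite in_itv/= => /andP[bc ca] e; exists c.
  by rewrite !ler0_norm ?subr_le0// lerN2 lerD2r.
by rewrite -opprB e -mulrN opprB.
Qed.

Lemma sin_lip a b : `|sin b - sin a| <= `|b - a|.
Proof.
have [c _ ->] := mvt a b (fun x => is_derive_sin x).
by rewrite normrM ler_piMl// cos_max.
Qed.

Lemma cos_lip a b : `|cos b - cos a| <= `|b - a|.
Proof.
have [c _ ->] := mvt a b (fun x => is_derive_cos x).
by rewrite normrM ler_piMl// normrN sin_max.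
Qed.

Lemma sin_taylor a b : `|sin b - sin a - (b - a) * cos a| <= `|b - a| ^+ 2.
Proof.
have [c ca ->] := mvt a b (fun x => is_derive_sin x).
rewrite [(b - a) * _]mulrC -mulrBl normrM expr2 ler_wpM2r//.
exact: le_trans (cos_lip _ _) ca.
Qed.

Lemma cos_taylor a b : `|cos b - cos a + (b - a) * sin a| <= `|b - a| ^+ 2.
Proof.
have [c ca ->] := mvt a b (fun x => is_derive_cos x).
rewrite mulNr [(b - a) * _]mulrC addrC -mulrBl normrM expr2 ler_wpM2r// distrC.
exact: le_trans (sin_lip _ _) ca.
Qed.

End trigonometry.

Section state_space.
Variables (R : realType) (n : nat) (m sigma : R) (q : nat).
Hypotheses (hn : (n <= 3)%N) (hm : 0 < m) (s0 : 0 < sigma).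
Local Notation T := (Rn R n).
Local Notation mu := (lebesgueRn R n).
Local Notation L2 f := (f \in Lfun mu 2%:E).
Local Notation n2 := (norm2 mu).
Local Notation w := (@cw R n sigma).
Local Notation o := (@om R n m).
Implicit Types (f g h u v : T -> R) (xi : T) (s t : R).

Lemma two_ge1 : (1 <= 2%:E :> \bar R)%E.
Proof. by rewrite lee_fin ler1n. Qed.

(** Elements of [V] are weighted transforms: [b] stands for the function with
    Hartley transform [unweight b], in such a way that the norm of [b] is
    comparable with that of the function in H^{sigma,2}. *)
Definition V := LfunType mu two_ge1.
Implicit Types (b : V).

Definition nmV (x : V) : R := n2 x.

Lemma V_L2 (x : V) : L2 (x : T -> R).
Proof. exact: LfunP. Qed.

Lemma addVE (x y : V) : (x + y : V) = (fun xi => x xi + y xi) :> (T -> R).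
Proof. by []. Qed.

Lemma subVE (x y : V) : (x - y : V) = (fun xi => x xi - y xi) :> (T -> R).
Proof. by []. Qed.

Lemma scaleVE (c : R) (x : V) : (c *: x : V) = (fun xi => c * x xi) :> (T -> R).
Proof. by []. Qed.

Lemma nmVD (x y : V) : nmV (x + y) <= nmV x + nmV y.
Proof. by rewrite /nmV addVE; exact: n2D (V_L2 x) (V_L2 y). Qed.

Lemma nmVZ (c : R) (x : V) : nmV (c *: x) = `|c| * nmV x.
Proof. by rewrite /nmV scaleVE; exact: n2Z (V_L2 x). Qed.

Definition toV f : V := if pselect (L2 f) is left fL then Lfun_Sub two_ge1 fL else 0.

Lemma toVE f : L2 f -> toV f = f :> (T -> R).
Proof. by move=> fL; rewrite /toV; case: pselect => // fL'. Qed.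

Lemma nmV_complete (v : nat -> V) : (forall k : nat, nmV (v k.+1 - v k) <= 2^-1 ^+ k) ->
  exists f : V, forall k : nat, nmV (v k - f) <= 2 * 2^-1 ^+ k.
Proof.
move=> vc; have [f [fL _ fv]] := L2_complete_geometric (fun k => V_L2 (v k)) vc.
by exists (toV f) => k; rewrite /nmV subVE toVE.
Qed.

Lemma V_eq (x y : V) : (forall xi, x xi = y xi) -> x = y.
Proof. by move=> xy; apply/LfuneqP. Qed.

Definition cosV t (x : V) : V := toV (fun xi => cos (t * o xi) * x xi).
Definition sinV t (x : V) : V := toV (fun xi => sin (t * o xi) * x xi).

Lemma measurable_cos_om t : measurable_fun setT (fun xi => cos (t * o xi)).
Proof.
apply: (measurableT_comp (@measurable_cos R)); apply: measurable_funM => //.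
exact: measurable_om.
Qed.

Lemma measurable_sin_om t : measurable_fun setT (fun xi => sin (t * o xi)).
Proof.
apply: (measurableT_comp (@measurable_sin R)); apply: measurable_funM => //.
exact: measurable_om.
Qed.

Lemma CE t (x : V) : cosV t x = (fun xi => cos (t * o xi) * x xi) :> (T -> R).
Proof.
apply: toVE; apply: (L2_bounded_mul (measurable_cos_om t) (M := 1)); last exact: V_L2.
by move=> xi; exact: cos_max.
Qed.

Lemma SE t (x : V) : sinV t x = (fun xi => sin (t * o xi) * x xi) :> (T -> R).
Proof.
apply: toVE; apply: (L2_bounded_mul (measurable_sin_om t) (M := 1)); last exact: V_L2.
by move=> xi; exact: sin_max.
Qed.

Opaque cosV sinV.

Lemma CB t (x y : V) : cosV t (x - y) = cosV t x - cosV t y.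
Proof. by apply: V_eq => xi; rewrite CE subVE !subVE !CE mulrBr. Qed.

Lemma SB t (x y : V) : sinV t (x - y) = sinV t x - sinV t y.
Proof. by apply: V_eq => xi; rewrite SE subVE !subVE !SE mulrBr. Qed.

Lemma nmC t (x : V) : nmV (cosV t x) <= nmV x.
Proof.
apply: n2_le => [||xi]; [exact: (L2_measurable (V_L2 _))|exact: V_L2|].
by rewrite CE normrM ler_piMl// cos_max.
Qed.

Lemma nmS t (x : V) : nmV (sinV t x) <= nmV x.
Proof.
apply: n2_le => [||xi]; [exact: (L2_measurable (V_L2 _))|exact: V_L2|].
by rewrite SE normrM ler_piMl// sin_max.
Qed.

Lemma small_mul (c e : R) : 0 < c -> 0 < e -> exists2 eta, 0 < eta &
  forall r : R, `|r| < eta -> `|r| * c <= e.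
Proof.
move=> c0 e0; exists (e / c); first by rewrite divr_gt0.
by move=> r /ltW; rewrite ler_pdivlMr.
Qed.

Lemma trig_cont (f : R -> R) (x : V) t : measurable_fun setT f -> (forall a, `|f a| <= 1) ->
  (forall a a', `|f a' - f a| <= `|a' - a|) ->
  forall e, 0 < e -> exists2 eta, 0 < eta & forall s, `|s - t| < eta ->
    n2 (fun xi => (f (s * o xi) - f (t * o xi)) * x xi) <= e.
Proof.
move=> mf f1 flip e e0.
have [||xi d d0|eta eta0 h] := @strong_cvg0 R n (fun s xi => f (s * o xi) - f (t * o xi)) 2 t x _ _ _ (V_L2 x) e e0.
- move=> s; have mo r : measurable_fun setT (fun xi => f (r * o xi)).
    apply: (measurableT_comp mf); apply: measurable_funM => //; exact: measurable_om.
  exact: measurable_funB.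
- by move=> s xi; apply: le_trans (ler_normB _ _) _; apply: lerD.
- have [eta eta0 h] := small_mul (om_gt0 hm xi) d0; exists eta => // s _ st.
  apply: le_trans (flip _ _) _; rewrite -mulrBl normrM (gtr0_norm (om_gt0 hm xi)).
  exact: h.
exists eta => // s st; have [->|st'] := eqVneq s t; last exact: h.
by under eq_fun do rewrite subrr mul0r; rewrite n2_0 ltW.
Qed.

Lemma C_cont (x : V) t e : 0 < e -> exists2 eta, 0 < eta & forall s, `|s - t| < eta ->
  nmV (cosV s x - cosV t x) <= e.
Proof.
move=> e0; have [eta eta0 h] := trig_cont x t (@measurable_cos R) (@cos_max R) (@cos_lip R) e0.
exists eta => // s /h; rewrite /nmV subVE !CE.
by under [in X in _ -> X]eq_fun do rewrite -mulrBl.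
Qed.

Lemma S_cont (x : V) t e : 0 < e -> exists2 eta, 0 < eta & forall s, `|s - t| < eta ->
  nmV (sinV s x - sinV t x) <= e.
Proof.
move=> e0; have [eta eta0 h] := trig_cont x t (@measurable_sin R) (@sin_max R) (@sin_lip R) e0.
exists eta => // s /h; rewrite /nmV subVE !SE.
by under [in X in _ -> X]eq_fun do rewrite -mulrBl.
Qed.

(** The norm of the embedding of H^{sigma,2} in the algebra, measured with
    [unweight]. *)
Definition kappa : R := n2 (fun xi => (o xi)^-1) + (om_lb m)^-1.

Lemma kappa_ge0 : 0 <= kappa.
Proof. by rewrite addr_ge0 ?n2_ge0// invr_ge0 ltW// om_lb_gt0. Qed.

Lemma kappa_gt0 : 0 < kappa.
Proof. by rewrite ltr_wpDl ?n2_ge0// invr_gt0 om_lb_gt0. Qed.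

Lemma measurable_om_inv : measurable_fun setT (fun xi => (o xi)^-1).
Proof. exact: L2_measurable (L2_om_inv hn hm). Qed.

Lemma om_inv_le xi : `|(o xi)^-1| <= (om_lb m)^-1.
Proof. by rewrite gtr0_norm ?invr_gt0 ?om_gt0// lef_pV2 ?posrE ?om_gt0 ?om_lb_gt0// om_ge_lb. Qed.

Definition unweight f xi : R := f xi / (w xi * o xi).

Lemma unweightK f xi : w xi * unweight f xi = (o xi)^-1 * f xi.
Proof.
rewrite /unweight; field.
by rewrite !gt_eqF ?om_gt0// cw_gt0.
Qed.

Lemma measurable_unweight f : measurable_fun setT f -> measurable_fun setT (unweight f).
Proof.
move=> mf; rewrite (_ : unweight f = fun xi => f xi * (w xi `^ (- 1) * (o xi)^-1)).
  apply: measurable_funM => //; apply: measurable_funM; last exact: measurable_om_inv.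
  exact: (measurableT_comp (measurable_powR _) (@measurable_cw R n sigma)).
by apply/funext => xi; rewrite /unweight powR_inv1 ?invfM// ltW// cw_gt0.
Qed.

(** Since 1 / o is square-integrable in dimension at most 3, the energy space
    is contained in the algebra. *)
Lemma Gv_unweight f : L2 f -> Gv w (unweight f) /\ Nw w (unweight f) <= kappa * n2 f.
Proof.
move=> fL; have oL := L2_om_inv hn hm; have mf := L2_measurable fL.
have b2 : L2 (fun xi => (o xi)^-1 * f xi) := L2_bounded_mul measurable_om_inv om_inv_le fL.
have b1 := L2_mul_integrable oL fL.
split; first by split; [exact: measurable_unweight|under eq_fun do rewrite unweightK..].
rewrite /Nw (_ : (fun xi => w xi * unweight f xi) = fun xi => (o xi)^-1 * f xi); last first.
  by apply/funext => xi; rewrite unweightK.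
rewrite mulrDl; apply: lerD.
  by rewrite -lee_fin -n1E//; exact: cauchy_schwarz.
have l0 : 0 <= (om_lb m)^-1 by rewrite invr_ge0 ltW// om_lb_gt0.
rewrite -{1}(ger0_norm l0) -n2Z//; apply: n2_le => [||xi].
- exact: (L2_measurable b2).
- exact: L2Z.
- by rewrite !normrM ler_wpM2r// (ger0_norm l0) om_inv_le.
Qed.

Local Notation Y := (@Y R n w).
Local Notation K := (algebra_const R n).
Let mw := @measurable_cw R n sigma.
Let w1 := @cw_ge1 R n sigma.
Let wN := @cwN R n sigma.
Let wD := @cwD R n sigma s0.

(** The Lipschitz constant of the nonlinearity on the unit ball. It does not
    depend on [sigma], because the constant of the algebra is the same for all
    the weights. *)
Definition Lam : R := (2 * K) ^+ q * kappa ^+ q.+1.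

Lemma Lam_gt0 : 0 < Lam.
Proof. by rewrite mulr_gt0// exprn_gt0 ?kappa_gt0// mulr_gt0// algebra_const_gt0. Qed.

(** The algebra provides some transform of the difference of the powers; it
    agrees almost everywhere with [h - k]. *)
Lemma pow_lip u v f g h (k : T -> R) (M : R) : L2 f -> L2 g ->
  is_hart u (unweight f) -> is_hart v (unweight g) ->
  is_hart (fun x => u x ^+ q.+1) h -> is_hart (fun x => v x ^+ q.+1) k ->
  n2 f <= M -> n2 g <= M ->
  L2 (fun xi => w xi * (h xi - k xi)) /\
  n2 (fun xi => w xi * (h xi - k xi)) <= Lam * M ^+ q * n2 (fun xi => f xi - g xi).
Proof.
move=> fL gL uf vg uh vk fM gM.
have [Gf Nf] := Gv_unweight fL; have [Gg Ng] := Gv_unweight gL.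
have [Gfg Nfg] := Gv_unweight (L2B fL gL).
have k0 := kappa_ge0.
have [l [[lH [ml l1 l2]] lN]] := @Y_powB R n w mw w1 wN wD q u v (unweight f) (unweight g)
  (kappa * M) (kappa * n2 (fun xi => f xi - g xi)) (conj uf Gf) (conj vg Gg)
  (le_trans Nf (ler_wpM2l k0 fM)) (le_trans Ng (ler_wpM2l k0 gM))
  ltac:(by move: Nfg; congr (Nw _ _ <= _); apply/funext => xi; rewrite /unweight mulrBl).
have hk := is_hartB uh vk; have [_ hkL _] := hk.
have e : {ae mu, forall xi, l xi = h xi - k xi}.
  exact: is_hart_unique lH hk (aeW _ (fun=> erefl)).
have mhk : measurable_fun setT (fun xi => w xi * (h xi - k xi)).
  by apply: measurable_funM => //; exact: (L2_measurable hkL).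
have e' : {ae mu, forall xi, w xi * l xi = w xi * (h xi - k xi)}.
  by apply: filterS e => xi ->.
split; first exact: L2_ae e'.
rewrite -(n2_ae (L2_measurable l2) mhk e').
apply: (@le_trans _ _ (Nw w l)); first by rewrite /Nw lerDr n1_ge0.
apply: le_trans lN _; rewrite le_eqVlt; apply/orP; left; apply/eqP.
rewrite /Lam (exprMn _ kappa) (exprS kappa).
by move: ((2 * K) ^+ q) (kappa ^+ q) (M ^+ q) (n2 _) => a1 a2 a3 a4; ring.
Qed.

Lemma is_hart_pow0 : is_hart (fun _ : T => 0 ^+ q.+1 : R) (fun=> 0).
Proof. by under eq_fun do rewrite expr0n; exact: is_hart0. Qed.

Lemma unweight0 : unweight (fun=> 0) = (fun=> 0).
Proof. by apply/funext => xi; rewrite /unweight mul0r. Qed.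

Lemma pow_bound u f h (M : R) : L2 f -> is_hart u (unweight f) ->
  is_hart (fun x => u x ^+ q.+1) h -> n2 f <= M ->
  L2 (fun xi => w xi * h xi) /\ n2 (fun xi => w xi * h xi) <= Lam * M ^+ q * n2 f.
Proof.
move=> fL uf uh fM; have M0 : 0 <= M := le_trans (n2_ge0 _ _) fM.
have u0 : is_hart (fun _ : T => 0 : R) (unweight (fun=> 0)) by rewrite unweight0; exact: is_hart0.
have := pow_lip fL (L2_0 mu) uf u0 uh is_hart_pow0 fM.
rewrite n2_0 => /(_ M0); under eq_fun do rewrite subr0.
have E : (fun xi => f xi - 0) = f by apply/funext => xi; rewrite subr0.
by rewrite E.
Qed.

Lemma state_exists b : exists p : (T -> R) * (T -> R),
  is_hart p.1 (unweight b) /\ is_hart (fun x => p.1 x ^+ q.+1) p.2.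
Proof.
have [Gb _] := Gv_unweight (V_L2 b); have [_ b2] := Gv_L1L2 mw w1 Gb.
have [u ub] := is_hart_surj b2.
have [l [ul _]] := Y_pow mw w1 wN wD q (conj ub Gb).
by exists (u, l).
Qed.

(** The function of state [b], and the transform of its power. *)
Definition U b : T -> R := (sval (cid (state_exists b))).1.
Definition Upow b : T -> R := (sval (cid (state_exists b))).2.

Lemma U_hart b : is_hart (U b) (unweight b).
Proof. by rewrite /U; case: cid => p []. Qed.

Lemma Upow_hart b : is_hart (fun x => U b x ^+ q.+1) (Upow b).
Proof. by rewrite /U /Upow; case: cid => p []. Qed.

Definition NV b : V := toV (fun xi => w xi * Upow b xi).

Lemma NVE b : NV b = (fun xi => w xi * Upow b xi) :> (T -> R).
Proof. exact: toVE (pow_bound (V_L2 b) (U_hart b) (Upow_hart b) (lexx _)).1. Qed.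

Lemma NV_bound b (M : R) : nmV b <= M -> nmV (NV b) <= Lam * M ^+ q * nmV b.
Proof.
by move=> bM; rewrite /nmV NVE; exact: (pow_bound (V_L2 b) (U_hart b) (Upow_hart b) bM).2.
Qed.

Lemma NV_lip (a : V) b (M : R) : nmV a <= M -> nmV b <= M ->
  nmV (NV a - NV b) <= Lam * M ^+ q * nmV (a - b).
Proof.
move=> aM bM; have := (pow_lip (V_L2 a) (V_L2 b) (U_hart a) (U_hart b) (Upow_hart a) (Upow_hart b) aM bM).2.
rewrite /nmV !subVE !NVE.
by under eq_fun do rewrite mulrBr.
Qed.

(** The rotated system: the position [b = cosV t x + sinV t y] and the
    velocity [a = cosV t y - sinV t x] are the weighted transforms of [A u]
    and of [u_t], and the equation for [(x, y)] contains no unbounded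
    operator. *)
Definition Z : lmodType R := (V * V)%type.
Definition nmZ (z : Z) : R := nmV z.1 + nmV z.2.
Definition pos t (z : Z) : V := cosV t z.1 + sinV t z.2.
Definition vel t (z : Z) : V := cosV t z.2 - sinV t z.1.
Definition Phi t (z : Z) : Z := (sinV t (NV (pos t z)), - cosV t (NV (pos t z))).

Lemma nmV_ge0 (x : V) : 0 <= nmV x. Proof. exact: n2_ge0. Qed.

Lemma nmVN (x : V) : nmV (- x) = nmV x.
Proof. by rewrite -scaleN1r nmVZ normrN1 mul1r. Qed.

Lemma nmZD (z z' : Z) : nmZ (z + z') <= nmZ z + nmZ z'.
Proof. by rewrite /nmZ addrACA lerD// nmVD. Qed.

Lemma nmZZ (c : R) (z : Z) : nmZ (c *: z) = `|c| * nmZ z.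
Proof. by rewrite /nmZ !nmVZ mulrDr. Qed.

Lemma nmZ_complete (v : nat -> Z) : (forall k : nat, nmZ (v k.+1 - v k) <= 2^-1 ^+ k) ->
  exists f : Z, forall k : nat, nmZ (v k - f) <= 4 * 2^-1 ^+ k.
Proof.
move=> vc.
have [x xP] : exists f : V, forall k : nat, nmV ((v k).1 - f) <= 2 * 2^-1 ^+ k.
  by apply: nmV_complete => k; apply: le_trans (vc k); rewrite /nmZ lerDl nmV_ge0.
have [y yP] : exists f : V, forall k : nat, nmV ((v k).2 - f) <= 2 * 2^-1 ^+ k.
  by apply: nmV_complete => k; apply: le_trans (vc k); rewrite /nmZ lerDr nmV_ge0.
exists (x, y) => k; rewrite /nmZ/=; have := xP k; have := yP k; lra.
Qed.

Lemma pos_le t z : nmV (pos t z) <= nmZ z.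
Proof. by apply: le_trans (nmVD _ _) _; apply: lerD; [exact: nmC|exact: nmS]. Qed.

Lemma posB t z z' : pos t (z - z') = pos t z - pos t z'.
Proof. by rewrite /pos CB SB opprD addrACA. Qed.

Definition lipc (M : R) : R := 2 * (Lam * M ^+ q).

Lemma Phi_lip t z z' (M : R) : nmZ z <= M -> nmZ z' <= M ->
  nmZ (Phi t z - Phi t z') <= lipc M * nmZ (z - z').
Proof.
move=> zM z'M; have M0 : 0 <= M by apply: le_trans zM; rewrite addr_ge0// nmV_ge0.
have L0 : 0 <= Lam * M ^+ q by rewrite mulr_ge0 ?(ltW Lam_gt0)// exprn_ge0.
have h : nmV (NV (pos t z) - NV (pos t z')) <= Lam * M ^+ q * nmZ (z - z').
  apply: le_trans (NV_lip (le_trans (pos_le _ _) zM) (le_trans (pos_le _ _) z'M)) _.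
  by rewrite ler_wpM2l// -posB pos_le.
have -> : nmZ (Phi t z - Phi t z') = nmV (sinV t (NV (pos t z) - NV (pos t z'))) +
    nmV (cosV t (NV (pos t z) - NV (pos t z'))).
  by rewrite /nmZ/= -SB -opprD -CB nmVN.
rewrite /lipc -mulrA mulr_natl [leRHS]mulr2n.
by apply: lerD; [apply: le_trans (nmS _ _) h|apply: le_trans (nmC _ _) h].
Qed.

Lemma Phi_bound t z (M : R) : nmZ z <= M -> nmZ (Phi t z) <= lipc M * M.
Proof.
move=> zM; have M0 : 0 <= M by apply: le_trans zM; rewrite addr_ge0// nmV_ge0.
have L0 : 0 <= Lam * M ^+ q by rewrite mulr_ge0 ?(ltW Lam_gt0)// exprn_ge0.
have h : nmV (NV (pos t z)) <= Lam * M ^+ q * M.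
  apply: le_trans (NV_bound (le_trans (pos_le _ _) zM)) _.
  by rewrite ler_wpM2l// (le_trans (pos_le _ _) zM).
rewrite /nmZ/= nmVN /lipc -mulrA mulr_natl mulr2n.
by apply: lerD; [apply: le_trans (nmS _ _) h|apply: le_trans (nmC _ _) h].
Qed.

Lemma pos_cont t z e : 0 < e -> exists2 eta, 0 < eta & forall s, `|s - t| < eta ->
  nmV (pos s z - pos t z) <= e.
Proof.
move=> e0; have e2 : 0 < e / 2 by rewrite divr_gt0.
have [e1 e10 h1] := C_cont z.1 t e2; have [e2' e20 h2] := S_cont z.2 t e2.
exists (Num.min e1 e2'); first by rewrite lt_min e10.
move=> s; rewrite lt_min => /andP[/h1 a /h2 b]; rewrite /pos opprD addrACA.
by apply: le_trans (nmVD _ _) _; lra.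
Qed.

Lemma Phi_cont t z (M e : R) : nmZ z <= M -> 0 < e ->
  exists2 eta, 0 < eta & forall s, `|s - t| < eta -> nmZ (Phi s z - Phi t z) <= e.
Proof.
move=> zM e0; have M0 : 0 <= M by apply: le_trans zM; rewrite addr_ge0// nmV_ge0.
have L0 : 0 <= Lam * M ^+ q by rewrite mulr_ge0 ?(ltW Lam_gt0)// exprn_ge0.
pose k := Lam * M ^+ q + 1; have k0 : 0 < k by rewrite ltr_wpDl.
have e4 : 0 < e / 4 by rewrite divr_gt0.
set N := NV (pos t z).
have [e1 e10 h1] := pos_cont t z (divr_gt0 e4 k0).
have [e2 e20 h2] := C_cont N t e4; have [e3 e30 h3] := S_cont N t e4.
exists (Num.min e1 (Num.min e2 e3)); first by rewrite !lt_min e10 e20.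
move=> s; rewrite !lt_min => /and3P[/h1 a /h2 b /h3 c].
have hN : nmV (NV (pos s z) - N) <= e / 4.
  apply: le_trans (NV_lip (le_trans (pos_le _ _) zM) (le_trans (pos_le _ _) zM)) _.
  apply: le_trans (ler_wpM2l L0 a) _; rewrite mulrCA ler_piMr ?(ltW e4)//.
  by rewrite ler_pdivrMr// mul1r lerDl.
have hS1 : nmV (sinV s (NV (pos s z)) - sinV s N) <= e / 4.
  by rewrite -(SB s (NV (pos s z)) N); apply: le_trans (nmS _ _) hN.
have hC1 : nmV (cosV s (NV (pos s z)) - cosV s N) <= e / 4.
  by rewrite -(CB s (NV (pos s z)) N); apply: le_trans (nmC _ _) hN.
have hS := nm_tri nmVD (sinV s N) (sinV s (NV (pos s z))) (sinV t N).
have hC := nm_tri nmVD (cosV s N) (cosV s (NV (pos s z))) (cosV t N).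
have -> : nmZ (Phi s z - Phi t z) = nmV (sinV s (NV (pos s z)) - sinV t N) + nmV (cosV s (NV (pos s z)) - cosV t N).
  by rewrite {1}/nmZ [X in _ + nmV X](_ : _ = - (cosV s (NV (pos s z)) - cosV t N)) ?nmVN//= opprD.
apply: le_trans (lerD (le_trans hS (lerD hS1 c)) (le_trans hC (lerD hC1 b))) _.
by rewrite (_ : e / 4 + e / 4 + (e / 4 + e / 4) = e)//; field.
Qed.

Lemma picard_Phi (d M : R) (z0 : Z) : 0 < d -> d * lipc M <= 2^-1 -> 2 * nmZ z0 <= M ->
  exists X : R -> Z,
  [/\ nmZ (X 0 - z0) = 0,
      forall t, 0 <= t -> t <= d -> nmZ (X t) <= M,
      forall s t, 0 <= s -> s <= t -> t <= d -> nmZ (X t - X s) <= (t - s) * (lipc M * M) &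
      forall e, 0 < e -> exists2 eta, 0 < eta & forall s t, 0 <= s -> s <= d -> 0 <= t -> t <= d ->
        `|t - s| <= eta -> nmZ (X t - X s - (t - s) *: Phi s (X s)) <= `|t - s| * e].
Proof.
move=> d0 dL zM.
have M0 : 0 <= M by apply: le_trans zM; rewrite mulr_ge0// addr_ge0// nmV_ge0.
have L0 : 0 <= lipc M by rewrite mulr_ge0// mulr_ge0 ?exprn_ge0// ltW// Lam_gt0.
apply: (picard nmZD nmZZ nmZ_complete d0 L0 dL zM).
- by move=> t z z' _ _; exact: Phi_lip.
- by move=> t z _ _; exact: Phi_bound.
- move=> t z e _ _ zM' e0; have [eta eta0 h] := Phi_cont t zM' e0.
  by exists eta => // s _ _; exact: h.
Qed.

Lemma w_inv_le xi : `|(w xi)^-1| <= 1.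
Proof. by rewrite gtr0_norm ?invr_gt0 ?cw_gt0// invf_le1 ?cw_gt0// cw_ge1. Qed.

Lemma measurable_w_inv : measurable_fun setT (fun xi => (w xi)^-1).
Proof.
rewrite (_ : (fun xi => _) = fun xi => w xi `^ (- 1)).
  exact: (measurableT_comp (measurable_powR _) (@measurable_cw R n sigma)).
by apply/funext => xi; rewrite powR_inv1// ltW// cw_gt0.
Qed.

Lemma L2_div_w f : L2 f -> L2 (fun xi => (w xi)^-1 * f xi).
Proof. exact: L2_bounded_mul measurable_w_inv w_inv_le. Qed.

Lemma velocity_exists (a : V) : exists v, is_hart v (fun xi => (w xi)^-1 * a xi).
Proof. exact: is_hart_surj (L2_div_w (V_L2 a)). Qed.

Definition Vel (a : V) : T -> R := sval (cid (velocity_exists a)).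

Lemma Vel_hart (a : V) : is_hart (Vel a) (fun xi => (w xi)^-1 * a xi).
Proof. by rewrite /Vel; case: cid. Qed.

(** [jo] compares the norm of states with that of H^{sigma,2}; its inverse
    [oj] serves for the converse. *)
Definition jo xi : R := japanese xi ^+ 2 * (o xi)^-1.

Lemma jo_le xi : `|jo xi| <= (om_lb m)^-1.
Proof.
rewrite /jo ger0_norm; last by rewrite mulr_ge0 ?sqr_ge0// invr_ge0 ltW// om_gt0.
by rewrite ler_pdivrMr ?om_gt0// ler_pdivlMl ?om_lb_gt0// om_ge.
Qed.

Lemma measurable_jo : measurable_fun setT jo.
Proof.
apply: measurable_funM; last exact: measurable_om_inv.
by apply: measurable_funX; exact: measurable_japanese.
Qed.

Lemma n2_bounded_mul (a : T -> R) f (B : R) : 0 <= B -> measurable_fun setT a ->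
  (forall xi, `|a xi| <= B) -> L2 f -> n2 (fun xi => a xi * f xi) <= B * n2 f.
Proof.
move=> B0 ma aB fL; rewrite -[in leRHS](ger0_norm B0) -n2Z//; apply: n2_le => [||xi].
- by apply: measurable_funM => //; exact: (L2_measurable fL).
- exact: L2Z.
- by rewrite !normrM ler_wpM2r// (ger0_norm B0).
Qed.

Lemma lb_inv_ge0 : 0 <= (om_lb m)^-1.
Proof. by rewrite invr_ge0 ltW// om_lb_gt0. Qed.

Lemma wt2_unweight f : (fun xi => wt sigma 2 xi * unweight f xi) = (fun xi => jo xi * f xi).
Proof.
apply/funext => xi; rewrite wt2 /unweight /jo; field.
by rewrite !gt_eqF ?om_gt0// cw_gt0.
Qed.

Lemma L2_wt2 f : L2 f -> L2 (fun xi => wt sigma 2 xi * unweight f xi).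
Proof. by rewrite wt2_unweight; exact: L2_bounded_mul measurable_jo jo_le. Qed.

Lemma n2_wt2 f : L2 f -> n2 (fun xi => wt sigma 2 xi * unweight f xi) <= (om_lb m)^-1 * n2 f.
Proof. by rewrite wt2_unweight; exact: n2_bounded_mul lb_inv_ge0 measurable_jo jo_le. Qed.

Lemma wt0_div (a : V) : (fun xi => wt sigma 0 xi * ((w xi)^-1 * a xi)) = a :> (T -> R).
Proof. by apply/funext => xi; rewrite wt0 mulrA divff ?mul1r// gt_eqF// cw_gt0. Qed.

Lemma cvg_within_e (D : set R) (F : R -> \bar R) (phi : R -> R) t :
  (forall r, D r -> F r = (phi r)%:E) -> (forall r, 0 <= phi r) ->
  (forall e, 0 < e -> exists2 eta, 0 < eta & forall r, D r -> `|r - t| < eta -> phi r <= e) ->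
  F r @[r --> within D (nbhs t)] --> 0%E.
Proof.
move=> Fphi phi0 H.
have h : (phi r)%:E @[r --> within D (nbhs t)] --> 0%E.
  apply: cvg_EFin; first exact: nearW.
  apply/cvgr0Pnorm_le => e e0; have [eta eta0 h] := H e e0.
  near=> r; rewrite ger0_norm//; apply: h.
    by near: r; exact: withinT.
  near: r; apply: cvg_within; apply/nbhs_ballP; exists eta => //= s.
  by rewrite /ball/= distrC.
apply: cvg_trans h; apply: near_eq_cvg; near=> r; rewrite Fphi//.
by near: r; exact: withinT.
Unshelve. all: by end_near.
Qed.

(** * Existence *)

Section trajectory.
Variables (d M : R) (X : R -> Z).
Hypothesis d0 : 0 < d.
Hypothesis M0 : 0 <= M.
Hypothesis XL : forall s t, 0 <= s -> s <= t -> t <= d -> nmZ (X t - X s) <= (t - s) * (lipc M * M).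
Hypothesis XD : forall e, 0 < e -> exists2 eta, 0 < eta &
  forall s t, 0 <= s -> s <= d -> 0 <= t -> t <= d ->
    `|t - s| <= eta -> nmZ (X t - X s - (t - s) *: Phi s (X s)) <= `|t - s| * e.

Definition bt t : V := pos t (X t).
Definition at_ t : V := vel t (X t).

Lemma X_cont t e : 0 <= t -> t <= d -> 0 < e -> exists2 eta, 0 < eta &
  forall s, 0 <= s -> s <= d -> `|s - t| < eta -> nmZ (X s - X t) <= e.
Proof.
move=> t0 td e0; have LM : 0 <= lipc M * M.
  by rewrite mulr_ge0// mulr_ge0// mulr_ge0 ?exprn_ge0// ltW// Lam_gt0.
have k0 : 0 < lipc M * M + 1 by rewrite ltr_wpDl.
have [eta eta0 h] := small_mul k0 e0; exists eta => // s s0' sd /h; apply: le_trans.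
apply: (@le_trans _ _ (`|s - t| * (lipc M * M))); last by rewrite ler_wpM2l// lerDl.
have [st|ts] := leP s t; last by rewrite ger0_norm ?subr_ge0 ?(ltW ts)// XL// ltW.
by rewrite (nmBC nmZZ) distrC ger0_norm ?subr_ge0// XL.
Qed.

Lemma bt_cont t e : 0 <= t -> t <= d -> 0 < e -> exists2 eta, 0 < eta &
  forall s, 0 <= s -> s <= d -> `|s - t| < eta -> nmV (bt s - bt t) <= e.
Proof.
move=> t0 td e0; have e2 : 0 < e / 2 by rewrite divr_gt0.
have [e1 e10 h1] := X_cont t0 td e2; have [e3 e30 h3] := pos_cont t (X t) e2.
exists (Num.min e1 e3); first by rewrite lt_min e10.
move=> s s0' sd; rewrite lt_min => /andP[/(h1 s s0' sd) a /h3 b].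
apply: le_trans (nm_tri nmVD (pos s (X t)) _ _) _.
rewrite [e]splitr; apply: lerD b; rewrite /bt -(posB s (X s) (X t)).
exact: le_trans (pos_le _ _) a.
Qed.

Lemma vel_pos t z : vel t z = pos t (z.2, - z.1).
Proof.
rewrite /vel /pos /=; congr (_ + _); apply: V_eq => xi.
rewrite SE -(scaleN1r (sinV t z.1)) -(scaleN1r z.1) !scaleVE SE; ring.
Qed.

Lemma at_cont t e : 0 <= t -> t <= d -> 0 < e -> exists2 eta, 0 < eta &
  forall s, 0 <= s -> s <= d -> `|s - t| < eta -> nmV (at_ s - at_ t) <= e.
Proof.
move=> t0 td e0; have e2 : 0 < e / 2 by rewrite divr_gt0.
have [e1 e10 h1] := X_cont t0 td e2; have [e3 e30 h3] := pos_cont t ((X t).2, - (X t).1) e2.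
exists (Num.min e1 e3); first by rewrite lt_min e10.
move=> s s0' sd; rewrite lt_min => /andP[/(h1 s s0' sd) a /h3 b].
rewrite /at_ !vel_pos.
apply: le_trans (nm_tri nmVD (pos s ((X t).2, - (X t).1)) _ _) _.
rewrite [e]splitr; apply: lerD b; rewrite -(posB s _ _).
apply: le_trans (pos_le _ _) _; apply: le_trans a.
by rewrite /nmZ/= -opprD nmVN addrC.
Qed.

Definition ut t : T -> R := U (bt t).
Definition vt t : T -> R := Vel (at_ t).

Lemma unweightB f g xi : unweight f xi - unweight g xi = unweight (fun xi => f xi - g xi) xi.
Proof. by rewrite /unweight mulrBl. Qed.

Lemma HrU t s : Hr ((@cplx R n \o ut) s \- (@cplx R n \o ut) t)%R (unweight (fun xi => bt s xi - bt t xi)).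
Proof.
have := HrB (Hr_cplx (U_hart (bt s))) (Hr_cplx (U_hart (bt t))).
by under [X in Hr _ X]eq_fun do rewrite unweightB.
Qed.

Lemma continuous_ut : continuous_H sigma 2 d (@cplx R n \o ut).
Proof.
move=> t; rewrite in_itv/= => /andP[t0 td]; split.
  exact: in_H_Hr (Hr_cplx (U_hart (bt t))) (L2_wt2 (V_L2 (bt t))).
apply: (@cvg_within_e _ _ (fun r => n2 (fun xi => wt sigma 2 xi * unweight (fun xi => bt r xi - bt t xi) xi))).
- by move=> r _; apply: normH_Hr (HrU t r) _; exact: L2_wt2 (L2B (V_L2 _) (V_L2 _)).
- by move=> r; exact: n2_ge0.
move=> e e0; have el : 0 < e * om_lb m by rewrite mulr_gt0// om_lb_gt0.
have [eta eta0 h] := bt_cont t0 td el; exists eta => // r; rewrite /= in_itv/= => /andP[r0 rd] rt.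
apply: le_trans (n2_wt2 (L2B (V_L2 (bt r)) (V_L2 (bt t)))) _.
by rewrite ler_pdivrMl ?om_lb_gt0// mulrC; exact: h.
Qed.

Lemma HrV t s : Hr ((@cplx R n \o vt) s \- (@cplx R n \o vt) t)%R (fun xi => (w xi)^-1 * (at_ s - at_ t : V) xi).
Proof.
have := HrB (Hr_cplx (Vel_hart (at_ s))) (Hr_cplx (Vel_hart (at_ t))).
by under [X in Hr _ X]eq_fun do rewrite -mulrBr.
Qed.

Lemma continuous_vt : continuous_H sigma 0 d (@cplx R n \o vt).
Proof.
move=> t; rewrite in_itv/= => /andP[t0 td]; split.
  by apply: in_H_Hr (Hr_cplx (Vel_hart (at_ t))) _; rewrite wt0_div; exact: V_L2.
apply: (@cvg_within_e _ _ (fun r => nmV (at_ r - at_ t))).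
- by move=> r _; rewrite (normH_Hr (HrV t r)) wt0_div//; exact: V_L2.
- by move=> r; exact: nmV_ge0.
move=> e e0; have [eta eta0 h] := at_cont t0 td e0.
by exists eta => // r; rewrite /= in_itv/= => /andP[r0 rd] rt; exact: h.
Qed.

Lemma om_sin_le (r : R) xi : `|(o xi)^-1 * sin (r * o xi)| <= `|r|.
Proof.
have o0 := om_gt0 hm xi; rewrite normrM (gtr0_norm (_ : 0 < (o xi)^-1)) ?invr_gt0//.
rewrite ler_pdivrMl// [leRHS]mulrC.
by have := sin_lip 0 (r * o xi); rewrite sin0 !subr0 normrM (gtr0_norm o0).
Qed.

(** The errors in the difference quotients of the cosine and the sine
    propagators. *)
Definition quotC t s xi : R := (s - t)^-1 * (o xi)^-1 * (cos (s * o xi) - cos (t * o xi)) + sin (t * o xi).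
Definition quotS t s xi : R := (s - t)^-1 * (o xi)^-1 * (sin (s * o xi) - sin (t * o xi)) - cos (t * o xi).

Lemma quot_le t s xi (a b : R) : `|a| <= `|s * o xi - t * o xi| -> `|b| <= 1 ->
  `|(s - t)^-1 * (o xi)^-1 * a + b| <= 2.
Proof.
move=> al b1; apply: le_trans (ler_normD _ _) _; rewrite (_ : 2 = 1 + 1 :> R)//.
apply: lerD b1; have o0 := om_gt0 hm xi.
have [->|st] := eqVneq s t; first by rewrite subrr invr0 !mul0r normr0.
rewrite !normrM; apply: le_trans (ler_wpM2l _ al) _; first exact: mulr_ge0.
rewrite -mulrBl normrM !normfV mulrACA mulVf ?normr_eq0 ?subr_eq0// mul1r.
by rewrite mulVf// normr_eq0 gt_eqF.
Qed.

Lemma quot_small t s xi (a b : R) : s != t ->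
  `|a + (s * o xi - t * o xi) * b| <= `|s * o xi - t * o xi| ^+ 2 ->
  `|(s - t)^-1 * (o xi)^-1 * a + b| <= `|s - t| * o xi.
Proof.
move=> st ab; have o0 := om_gt0 hm xi; have st0 : s - t != 0 by rewrite subr_eq0.
have -> : (s - t)^-1 * (o xi)^-1 * a + b = (s - t)^-1 * (o xi)^-1 * (a + (s * o xi - t * o xi) * b).
  by field; rewrite st0 gt_eqF.
rewrite normrM; apply: le_trans (ler_wpM2l _ ab) _ => //.
rewrite -mulrBl !normrM !normfV (gtr0_norm o0) le_eqVlt; apply/orP; left; apply/eqP.
by field; rewrite gt_eqF// normr_eq0.
Qed.

Lemma measurable_quotC t s : measurable_fun setT (quotC t s).
Proof.
apply: measurable_funD; last exact: measurable_sin_om.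
apply: measurable_funM; first by apply: measurable_funM => //; exact: measurable_om_inv.
by apply: measurable_funB; exact: measurable_cos_om.
Qed.

Lemma measurable_quotS t s : measurable_fun setT (quotS t s).
Proof.
apply: measurable_funB; last exact: measurable_cos_om.
apply: measurable_funM; first by apply: measurable_funM => //; exact: measurable_om_inv.
by apply: measurable_funB; exact: measurable_sin_om.
Qed.

Lemma quotC_le t s xi : `|quotC t s xi| <= 2.
Proof. by apply: quot_le; [exact: cos_lip|exact: sin_max]. Qed.

Lemma quotS_le t s xi : `|quotS t s xi| <= 2.
Proof. by apply: quot_le; [exact: sin_lip|rewrite normrN; exact: cos_max]. Qed.

Lemma quotC_cvg t (x : V) e : 0 < e -> exists2 eta, 0 < eta &
  forall s, s != t -> `|s - t| < eta -> n2 (fun xi => quotC t s xi * x xi) <= e.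
Proof.
apply: (@strong_cvg0 R n (quotC t) 2 t x (measurable_quotC t) (quotC_le t) _ (V_L2 x)).
move=> xi r r0; have [eta eta0 h] := small_mul (om_gt0 hm xi) r0; exists eta => // s st /h.
by apply: le_trans; apply: quot_small => //; exact: cos_taylor.
Qed.

Lemma quotS_cvg t (x : V) e : 0 < e -> exists2 eta, 0 < eta &
  forall s, s != t -> `|s - t| < eta -> n2 (fun xi => quotS t s xi * x xi) <= e.
Proof.
apply: (@strong_cvg0 R n (quotS t) 2 t x (measurable_quotS t) (quotS_le t) _ (V_L2 x)).
move=> xi r r0; have [eta eta0 h] := small_mul (om_gt0 hm xi) r0; exists eta => // s st /h.
by apply: le_trans; apply: quot_small => //; rewrite mulrN; exact: sin_taylor.
Qed.

Lemma posE t z xi : pos t z xi = cos (t * o xi) * z.1 xi + sin (t * o xi) * z.2 xi.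
Proof. by rewrite /pos addVE CE SE. Qed.

Lemma velE t z xi : vel t z xi = cos (t * o xi) * z.2 xi - sin (t * o xi) * z.1 xi.
Proof. by rewrite /vel subVE CE SE. Qed.

Lemma oppVE (x : V) : (- x : V) = (fun xi => - x xi) :> (T -> R). Proof. by []. Qed.
Lemma Phi2 t z : (Phi t z).2 = - cosV t (NV (pos t z)) :> V. Proof. by []. Qed.
Lemma fstB (z z' : Z) : (z - z').1 = z.1 - z'.1 :> V. Proof. by []. Qed.
Lemma sndB (z z' : Z) : (z - z').2 = z.2 - z'.2 :> V. Proof. by []. Qed.
Lemma fstZ (c : R) (z : Z) : (c *: z).1 = c *: z.1 :> V. Proof. by []. Qed.
Lemma sndZ (c : R) (z : Z) : (c *: z).2 = c *: z.2 :> V. Proof. by []. Qed.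

(** The remainder of the state over the time step from [t] to [s]. *)
Definition rem t s : Z := X s - X t - (s - t) *: Phi t (X t).

(** The difference quotient of the position, minus the velocity, is split into
    the errors of the propagators, the remainder of the state, and the
    contribution of [Phi], where the sine makes it small with [s - t]. *)
Lemma bt_expand t s xi : s != t ->
  (s - t)^-1 * ((o xi)^-1 * (bt s xi - bt t xi)) - at_ t xi =
  quotC t s xi * (X t).1 xi + quotS t s xi * (X t).2 xi +
  ((s - t)^-1 * ((o xi)^-1 * pos s (rem t s) xi) -
   (o xi)^-1 * sin ((s - t) * o xi) * NV (bt t) xi).
Proof.
move=> st; have st0 : s - t != 0 by rewrite subr_eq0.
have o0 : o xi != 0 by rewrite gt_eqF// om_gt0.
have E1 : (rem t s).1 xi = (X s).1 xi - (X t).1 xi - (s - t) * (sin (t * o xi) * NV (bt t) xi).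
  by rewrite /rem !fstB fstZ !subVE scaleVE /= SE.
have E2 : (rem t s).2 xi = (X s).2 xi - (X t).2 xi + (s - t) * (cos (t * o xi) * NV (bt t) xi).
  by rewrite /rem !sndB sndZ !subVE scaleVE Phi2 oppVE CE; ring.
rewrite [bt s]/bt [bt t in LHS]/bt /at_ !posE velE E1 E2 /quotC /quotS (_ : (s - t) * o xi = s * o xi - t * o xi) ?sinB ?mulrBl//.
move: (NV (bt t) xi) (cos _) (cos _) (sin _) (sin _) ((X s).1 xi) ((X s).2 xi) ((X t).1 xi) ((X t).2 xi).
by move=> N c1 c2 s1 s2 x1 x2 y1 y2; field; rewrite ?st0 ?o0.
Qed.

Lemma n2_quotient t s e : s != t -> nmZ (rem t s) <= `|s - t| * e ->
  n2 (fun xi => (s - t)^-1 * ((o xi)^-1 * (bt s xi - bt t xi)) - at_ t xi) <=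
  n2 (fun xi => quotC t s xi * (X t).1 xi) + n2 (fun xi => quotS t s xi * (X t).2 xi) +
  ((om_lb m)^-1 * e + `|s - t| * nmV (NV (bt t))).
Proof.
move=> st Ee; have st0 : 0 < `|s - t| by rewrite normr_gt0 subr_eq0.
have q1 := L2_bounded_mul (measurable_quotC t s) (quotC_le t s) (V_L2 (X t).1).
have q2 := L2_bounded_mul (measurable_quotS t s) (quotS_le t s) (V_L2 (X t).2).
have oL := L2_bounded_mul measurable_om_inv om_inv_le (V_L2 (pos s (rem t s))).
have q3 := L2Z (s - t)^-1 oL.
have ms : measurable_fun setT (fun xi => (o xi)^-1 * sin ((s - t) * o xi)).
  by apply: measurable_funM; [exact: measurable_om_inv|exact: measurable_sin_om].
have q4 := L2_bounded_mul ms (om_sin_le (s - t)) (V_L2 (NV (bt t))).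
under eq_fun do rewrite bt_expand//.
apply: le_trans (n2D (L2D q1 q2) (L2B q3 q4)) _; apply: lerD; first exact: n2D.
apply: le_trans (n2B q3 q4) _; apply: lerD.
  rewrite (n2Z _ oL) normfV ler_pdivrMl//.
  apply: le_trans (n2_bounded_mul lb_inv_ge0 measurable_om_inv om_inv_le (V_L2 _)) _.
  rewrite mulrCA ler_wpM2l ?lb_inv_ge0//; exact: le_trans (pos_le _ _) Ee.
exact: n2_bounded_mul (normr_ge0 _) ms (om_sin_le _) (V_L2 _).
Qed.

Lemma derivative_ut : derivative_H sigma 0 d (@cplx R n \o ut) (@cplx R n \o vt).
Proof.
move=> t; rewrite in_itv/= => /andP[t0 td].
pose phi r := n2 (fun xi => (r - t)^-1 * ((o xi)^-1 * (bt r xi - bt t xi)) - at_ t xi).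
have phiL r : L2 (fun xi => (r - t)^-1 * ((o xi)^-1 * (bt r xi - bt t xi)) - at_ t xi).
  apply: L2B (V_L2 _); apply: L2Z.
  exact: L2_bounded_mul measurable_om_inv om_inv_le (L2B (V_L2 _) (V_L2 _)).
apply: (@cvg_within_e _ _ phi).
- move=> r [_ rt]; have rt0 : r != t by apply/eqP.
  have H := HrB (HrZ (r - t)^-1 (HrU t r)) (Hr_cplx (Vel_hart (at_ t))).
  have E : (fun xi => wt sigma 0 xi * ((r - t)^-1 * unweight (fun xi => bt r xi - bt t xi) xi - (w xi)^-1 * at_ t xi)) =
      fun xi => (r - t)^-1 * ((o xi)^-1 * (bt r xi - bt t xi)) - at_ t xi.
    apply/funext => xi; rewrite wt0 mulrBr mulrCA unweightK (mulrA (w xi)) divff ?mul1r//.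
    by rewrite gt_eqF// cw_gt0.
  by rewrite (normH_Hr H) E.
- by move=> r; exact: n2_ge0.
move=> e e0; have e4 : 0 < e / 4 by rewrite divr_gt0.
have [e1 e10 h1] := quotC_cvg t (X t).1 e4.
have [e2 e20 h2] := quotS_cvg t (X t).2 e4.
have el : 0 < e / 4 * om_lb m by rewrite mulr_gt0// om_lb_gt0.
have [e3 e30 h3] := XD el.
have k0 : 0 < nmV (NV (bt t)) + 1 by rewrite ltr_wpDl ?nmV_ge0.
have [e5 e50 h5] := small_mul k0 e4.
exists (Num.min (Num.min e1 e2) (Num.min e3 e5)); first by rewrite !lt_min e10 e20 e30.
move=> r [+ rt]; rewrite /= in_itv/= => /andP[r0 rd]; rewrite !lt_min => /andP[/andP[a1 a2] /andP[a3 a5]].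
have rt0 : r != t by apply/eqP.
apply: le_trans (n2_quotient rt0 (h3 t r t0 td r0 rd (ltW a3))) _.
have b1 := h1 r rt0 a1; have b2 := h2 r rt0 a2.
have b5 : `|r - t| * nmV (NV (bt t)) <= e / 4.
  by apply: le_trans (h5 _ a5); rewrite ler_wpM2l// lerDl.
have b3 : (om_lb m)^-1 * (e / 4 * om_lb m) = e / 4.
  by rewrite mulrCA mulVf ?mulr1// gt_eqF// om_lb_gt0.
apply: le_trans (lerD (lerD b1 b2) (lerD (le_refl _) b5)) _; rewrite b3.
by rewrite (_ : e / 4 + e / 4 + (e / 4 + e / 4) = e)//; field.
Qed.

Definition oj xi : R := o xi / japanese xi ^+ 2.

Lemma jap2_gt0 xi : 0 < japanese xi ^+ 2.
Proof. by rewrite exprn_gt0// (lt_le_trans ltr01)// japanese_ge1. Qed.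

Lemma oj_le xi : `|oj xi| <= om_ub m.
Proof.
have j0 := jap2_gt0 xi.
rewrite /oj ger0_norm; last by rewrite divr_ge0 ?sqr_ge0// ltW// om_gt0.
by rewrite ler_pdivrMr// om_le.
Qed.

Lemma measurable_oj : measurable_fun setT oj.
Proof.
rewrite (_ : oj = fun xi => o xi * (japanese xi ^+ 2) `^ (- 1)); last first.
  by apply/funext => xi; rewrite powR_inv1// sqr_ge0.
apply: measurable_funM; first exact: measurable_om.
apply: (measurableT_comp (measurable_powR _)).
by apply: measurable_funX; exact: measurable_japanese.
Qed.

Definition weight h xi : R := w xi * o xi * h xi.

Lemma weightE h xi : weight h xi = oj xi * (wt sigma 2 xi * h xi).
Proof.
rewrite /weight /oj wt2; field.
by rewrite -[X in X != 0]expr1 expf_neq0// gt_eqF// (lt_le_trans ltr01)// japanese_ge1.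
Qed.

Lemma weightK h : unweight (weight h) = h.
Proof.
apply/funext => xi; rewrite /unweight /weight; field.
by rewrite !gt_eqF ?om_gt0// cw_gt0.
Qed.

Lemma L2_weight h : L2 (fun xi => wt sigma 2 xi * h xi) -> L2 (weight h).
Proof.
move=> hL; rewrite (_ : weight h = fun xi => oj xi * (wt sigma 2 xi * h xi)); last first.
  by apply/funext => xi; exact: weightE.
exact: L2_bounded_mul measurable_oj oj_le hL.
Qed.

Lemma n2_weight h : L2 (fun xi => wt sigma 2 xi * h xi) ->
  n2 (weight h) <= om_ub m * n2 (fun xi => wt sigma 2 xi * h xi).
Proof.
move=> hL; rewrite (_ : weight h = fun xi => oj xi * (wt sigma 2 xi * h xi)); last first.
  by apply/funext => xi; exact: weightE.
exact: n2_bounded_mul (ltW (om_ub_gt0 hm)) measurable_oj oj_le hL.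
Qed.

Lemma nonlinearityE v : odd q.+1 -> nonlinearity q.+1 v = (fun x => v x ^+ q.+1).
Proof.
move=> /= qe; apply/funext => x; rewrite /nonlinearity /= exprSr; congr (_ * _).
by rewrite -normrX ger0_norm// exprn_even_ge0.
Qed.

Lemma pos_sum t N (c : 'I_N -> R) (z : 'I_N -> Z) xi :
  pos t (\sum_i c i *: z i) xi = \sum_i c i * pos t (z i) xi.
Proof.
elim: N c z => [|N IH] c z; first by rewrite !big_ord0 posE !mulr0 addr0.
have posDE (z1 z2 : Z) : pos t (z1 + z2) xi = pos t z1 xi + pos t z2 xi.
  rewrite !posE (_ : (z1 + z2).1 xi = z1.1 xi + z2.1 xi)// (_ : (z1 + z2).2 xi = z1.2 xi + z2.2 xi)//.
  by ring.
rewrite !big_ord_recr posDE IH; congr (_ + _).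
rewrite !posE fstZ sndZ !scaleVE; ring.
Qed.

Section initial_data.
Variables (u0 u1 h0 h1 : T -> R).
Hypothesis u0h : is_hart u0 h0.
Hypothesis u1h : is_hart u1 h1.
Hypothesis h0L : L2 (fun xi => wt sigma 2 xi * h0 xi).
Hypothesis h1L : L2 (fun xi => wt sigma 0 xi * h1 xi).

Let wh1E : (fun xi => wt sigma 0 xi * h1 xi) = (fun xi => w xi * h1 xi).
Proof. by apply/funext => xi; rewrite wt0. Qed.

Definition z0 : Z := (toV (weight h0), toV (fun xi => w xi * h1 xi)).

Lemma z0_1 : z0.1 = weight h0 :> (T -> R).
Proof. by rewrite /z0/= toVE//; exact: L2_weight. Qed.

Lemma z0_2 : z0.2 = (fun xi => w xi * h1 xi) :> (T -> R).
Proof. by rewrite /z0/= toVE// -wh1E. Qed.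

Lemma nm_z0 : nmZ z0 <= (om_ub m + 1) *
  (n2 (fun xi => wt sigma 2 xi * h0 xi) + n2 (fun xi => wt sigma 0 xi * h1 xi)).
Proof.
rewrite /nmZ /nmV z0_1 z0_2 wh1E mulrDr; apply: lerD.
  apply: le_trans (n2_weight h0L) _; rewrite ler_wpM2r ?n2_ge0//.
  by rewrite lerDl.
by rewrite ler_peMl ?n2_ge0// lerDr ltW// om_ub_gt0.
Qed.

Hypothesis X0 : nmZ (X 0 - z0) = 0.
Hypothesis hq : odd q.+1.

Lemma X0_ae : {ae mu, forall xi, (X 0).1 xi = weight h0 xi} /\
  {ae mu, forall xi, (X 0).2 xi = w xi * h1 xi}.
Proof.
move/eqP: X0; rewrite /nmZ paddr_eq0 ?nmV_ge0// => /andP[/eqP a /eqP b]; split.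
- have /(n2_eq0 (V_L2 _)) : n2 ((X 0).1 - z0.1 : V) = 0 by [].
  by rewrite subVE z0_1; apply: filterS => xi /eqP; rewrite subr_eq0 => /eqP.
- have /(n2_eq0 (V_L2 _)) : n2 ((X 0).2 - z0.2 : V) = 0 by [].
  by rewrite subVE z0_2; apply: filterS => xi /eqP; rewrite subr_eq0 => /eqP.
Qed.

Lemma ut0 : {ae mu, forall x, ut 0 x = u0 x}.
Proof.
apply: hart_inj (U_hart _) u0h _; apply: filterS X0_ae.1 => xi e.
rewrite -[h0]weightK /unweight; congr (_ / _).
by rewrite posE mul0r cos0 sin0 mul1r mul0r addr0.
Qed.

Lemma vt0 : {ae mu, forall x, vt 0 x = u1 x}.
Proof.
apply: hart_inj (Vel_hart _) u1h _; apply: filterS X0_ae.2 => xi e.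
rewrite velE mul0r cos0 sin0 mul1r mul0r subr0 e mulrA mulVf ?mul1r//.
by rewrite gt_eqF// cw_gt0.
Qed.

Lemma Hr_cosA t v h : is_hart v h -> Hr (cosA m t (cplx v)) (fun xi => cos (t * o xi) * h xi).
Proof.
move=> vh; apply: (@Hr_multiplier R n (fun xi => cos (t * o xi)) _ _ 1 (measurable_cos_om t)) (Hr_cplx vh).
- by move=> xi; exact: cos_max.
- by move=> xi; rewrite omN.
Qed.

Lemma Hr_sinA t v h : is_hart v h ->
  Hr (sinA_over_A m t (cplx v)) (fun xi => (o xi)^-1 * sin (t * o xi) * h xi).
Proof.
move=> vh; apply: (@Hr_multiplier R n (fun xi => (o xi)^-1 * sin (t * o xi)) _ _ `|t| _ (om_sin_le t)) (Hr_cplx vh).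
- by apply: measurable_funM; [exact: measurable_om_inv|exact: measurable_sin_om].
- by move=> xi; rewrite omN.
Qed.

Lemma sin_unweight t k xi : (o xi)^-1 * sin (t * o xi) * k xi =
  unweight (fun xi => sin (t * o xi) * (w xi * k xi)) xi.
Proof.
rewrite /unweight; field; by rewrite !gt_eqF ?om_gt0// cw_gt0.
Qed.

(** Given [ut], Duhamel's formula leaves no other choice for the integral. *)
Definition W t x : R[i] := (cosA m t (cplx u0) x + sinA_over_A m t (cplx u1) x - cplx (ut t) x)%C.

Lemma Hr_A t : Hr (fun x => cosA m t (cplx u0) x + sinA_over_A m t (cplx u1) x) (unweight (pos t z0)).
Proof.
have := HrD (Hr_cosA t u0h) (Hr_sinA t u1h).
congr (Hr _ _); apply/funext => xi; rewrite /unweight posE z0_1 z0_2 /weight; field.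
by rewrite !gt_eqF ?om_gt0// cw_gt0.
Qed.

Lemma Hr_W t : Hr (W t) (unweight (pos t z0 - bt t : V)).
Proof.
have := HrB (Hr_A t) (Hr_cplx (U_hart (bt t))).
by congr (Hr _ _); apply/funext => xi; rewrite unweightB subVE.
Qed.

(** The addition formula for the sine of [(t - s) o] expresses the Riemann
    sums of the Duhamel integral as images under [pos t] of Riemann sums of
    [Phi]. *)
Lemma duhamel_sum t N (tau theta : nat -> R) :
  (fun xi => \sum_(i < N) (tau i.+1 - tau i) *
     ((o xi)^-1 * sin ((t - theta i) * o xi) * Upow (bt (theta i)) xi)) =
  unweight (- pos t (\sum_(i < N) (tau i.+1 - tau i) *: Phi (theta i) (X (theta i))) : V).
Proof.
apply/funext => xi; rewrite oppVE /unweight pos_sum -sumrN mulr_suml.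
apply: eq_bigr => i _; rewrite sin_unweight /unweight posE.
rewrite -[(Phi _ _).1]/(sinV _ _) Phi2 oppVE SE CE -/(bt (theta i)) NVE (mulrBl (o xi) t) sinB.
ring.
Qed.

Lemma integral_W t : 0 <= t -> t <= d ->
  is_integral_H sigma 2 0 t
    (fun s => sinA_over_A m (t - s) (cplx (nonlinearity q.+1 (ut s)))) (W t).
Proof.
move=> t0 td.
have HF s : Hr (sinA_over_A m (t - s) (cplx (nonlinearity q.+1 (ut s))))
    (fun xi => (o xi)^-1 * sin ((t - s) * o xi) * Upow (bt s) xi).
  by rewrite nonlinearityE//; apply: Hr_sinA; exact: Upow_hart.
split.
- move=> s _; apply: in_H_Hr (HF s) _.
  have -> : (fun xi => wt sigma 2 xi * ((o xi)^-1 * sin ((t - s) * o xi) * Upow (bt s) xi)) =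
      (fun xi => wt sigma 2 xi * unweight (sinV (t - s) (NV (bt s))) xi).
    by apply/funext => xi; rewrite sin_unweight SE NVE.
  exact: L2_wt2 (V_L2 _).
- exact: in_H_Hr (Hr_W t) (L2_wt2 (V_L2 _)).
move=> e e0; pose e' := e * om_lb m / (d + 1).
have d1 : 0 < d + 1 by rewrite addr_gt0.
have e'0 : 0 < e' by rewrite divr_gt0// mulr_gt0// om_lb_gt0.
have [eta eta0 hX] := XD e'0; exists eta => // N tau theta tau0 tauN tt.
pose S' x : R[i] := \sum_(i < N) ((tau i.+1 - tau i)%:C *
  sinA_over_A m (t - theta i) (cplx (nonlinearity q.+1 (ut (theta i)))) x)%C.
suff : (normH sigma 2 (S' \- W t)%R < e%:E)%E by [].
have rs := riemann nmZD nmZZ hX tau0 (ltac:(by rewrite tauN) : tau N <= d) tt.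
rewrite tauN in rs.
set Sz : Z := \sum_(i < N) _ in rs.
have HS : Hr S' (unweight (- pos t Sz : V)).
  rewrite -duhamel_sum; apply: Hr_sum => i; exact: HrZ.
have H := HrB HS (Hr_W t).
have E : (fun xi => unweight (- pos t Sz : V) xi - unweight (pos t z0 - bt t : V) xi) =
    unweight (pos t (X t - z0 - Sz)).
  apply/funext => xi; rewrite unweightB; congr (unweight _ _); apply/funext => y.
  by rewrite !posB !subVE oppVE; ring.
rewrite E in H; rewrite (normH_Hr H (L2_wt2 (V_L2 _))) lte_fin.
apply: le_lt_trans (n2_wt2 (V_L2 _)) _.
have nmle : nmV (pos t (X t - z0 - Sz)) <= t * e'.
  apply: le_trans (pos_le _ _) _; apply: le_trans rs.
  rewrite (_ : X t - z0 - Sz = (X t - X 0 - Sz) + (X 0 - z0)); last first.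
    by rewrite !addrA [RHS](ACl (1*5*3*4*2))/= addrK.
  by apply: le_trans (nmZD _ _) _; rewrite X0 addr0.
rewrite ltr_pdivrMl ?om_lb_gt0//; apply: le_lt_trans nmle _.
rewrite /e' mulrA ltr_pdivrMr// mulrC [om_lb m * e]mulrC ltr_pM2l; last by rewrite mulr_gt0// om_lb_gt0.
by rewrite (le_lt_trans td)// ltrDl.
Qed.

Lemma solution_ut : solution m q.+1 sigma d u0 u1 ut.
Proof.
exists vt; split.
- exact: continuous_ut.
- exact: continuous_vt.
- exact: derivative_ut.
- by apply: filterS2 ut0 vt0 => x -> ->.
move=> t; rewrite in_itv/= => /andP[t0 td].
exists (W t); first exact: integral_W.
by apply: aeW => x; rewrite /W opprB addrC subrK.
Qed.

End initial_data.

End trajectory.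

(** * Uniqueness *)

Section uniqueness.
Variables (d : R) (u0 u1 h0 h1 : T -> R).
Hypothesis d0 : 0 < d.
Hypothesis u0h : is_hart u0 h0.
Hypothesis u1h : is_hart u1 h1.
Hypothesis h0L : L2 (fun xi => wt sigma 2 xi * h0 xi).
Hypothesis h1L : L2 (fun xi => wt sigma 0 xi * h1 xi).
Hypothesis hq : odd q.+1.
Local Notation z0 := (z0 h0 h1).

Lemma nmV_wt2 f : L2 f -> n2 f <= om_ub m * n2 (fun xi => wt sigma 2 xi * unweight f xi).
Proof.
move=> fL; have := n2_weight (L2_wt2 fL); congr (n2 _ <= _).
apply/funext => xi; rewrite /weight /unweight; field.
by rewrite !gt_eqF ?om_gt0// cw_gt0.
Qed.

(** [f t] is the state of [v t]. *)
Definition states (v : R -> T -> R) (f : R -> V) :=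
  forall t, 0 <= t -> t <= d -> is_hart (v t) (unweight (f t)).

Lemma states_exist (v : R -> T -> R) : solution m q.+1 sigma d u0 u1 v -> exists f : R -> V, states v f.
Proof.
move=> [vt [cv _ _ _ _]].
have /choice[f fP] t : exists f : V, 0 <= t -> t <= d -> is_hart (v t) (unweight f).
  case: (pselect (0 <= t /\ t <= d)) => [[t0 td]|ntd]; last by exists 0 => t0 td; case: ntd.
  have [inH _] := cv t ltac:(by rewrite in_itv/= t0).
  have LP := in_H_in_Lp inH; have [h vh] := is_hart_exists LP.1.
  have [hL _] := normH_lty (vh : is_hart (Ref (cplx (v t))) h) LP inH.2.
  by exists (toV (weight h)) => _ _; rewrite toVE ?weightK//; exact: L2_weight.
by exists f.
Qed.

Lemma states_cont (v : R -> T -> R) (f : R -> V) : solution m q.+1 sigma d u0 u1 v -> states v f ->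
  forall t e, 0 <= t -> t <= d -> 0 < e -> exists2 eta, 0 < eta &
    forall s, 0 <= s -> s <= d -> `|s - t| < eta -> nmV (f s - f t) <= e.
Proof.
move=> [vt [cv _ _ _ _]] fv t e t0 td e0.
have [_ ct] := cv t ltac:(by rewrite in_itv/= t0).
have e1 : 0 < e / om_ub m by rewrite divr_gt0// om_ub_gt0.
have E s : 0 <= s -> s <= d -> normH sigma 2 ((@cplx R n \o v) s \- (@cplx R n \o v) t)%R =
    (n2 (fun xi => wt sigma 2 xi * unweight (f s - f t : V) xi))%:E.
  move=> s0' sd; apply: normH_Hr; last exact: L2_wt2 (V_L2 _).
  have := HrB (Hr_cplx (fv s s0' sd)) (Hr_cplx (fv t t0 td)).
  by under [X in Hr _ X]eq_fun do rewrite unweightB.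
have := @fine_cvgP _ _ (within `[0, d] (nbhs t)) _ (fun r => normH sigma 2 ((@cplx R n \o v) r \- (@cplx R n \o v) t)%R) 0.
move=> [/(_ ct)[_ +] _] => /cvgr0Pnorm_le/(_ _ e1).
move=> /nbhs_ballP[eta /= eta0 h]; exists eta => // s s0' sd st.
have := h s _ _; rewrite /= in_itv/= s0' sd E// ger0_norm ?n2_ge0//.
rewrite /ball/= distrC => /(_ st isT); rewrite ler_pdivlMr ?om_ub_gt0// mulrC => h'.
by apply: le_trans h'; exact: (nmV_wt2 (V_L2 (f s - f t))).
Qed.

Lemma states_pow (v : R -> T -> R) (f : R -> V) t : states v f -> 0 <= t -> t <= d ->
  is_hart (fun x => v t x ^+ q.+1) (Upow (f t)).
Proof.
move=> fv t0 td; have vh := fv t t0 td.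
have e := hart_inj (U_hart (f t)) vh (aeW _ (fun=> erefl)).
have [vL _ _] := vh; have [_ UL _] := Upow_hart (f t).
apply: (is_hart_ae (Upow_hart (f t))).
- by apply: measurable_funX; exact: (L2_measurable vL).
- exact: (L2_measurable UL).
- by apply: filterS e => x ->.
- exact: aeW.
Qed.

(** The Duhamel integral of an arbitrary solution, evaluated on a uniform grid
    with tags at the left ends. *)
Lemma duhamel_approx (v : R -> T -> R) (f : R -> V) t e : solution m q.+1 sigma d u0 u1 v -> states v f ->
  0 <= t -> t <= d -> 0 < e -> exists2 eta, 0 < eta &
    forall N : nat, (0 < N)%N -> t / N%:R < eta ->
      nmV (\sum_(i < N) (t / N%:R) *: sinV (t - i%:R * (t / N%:R)) (NV (f (i%:R * (t / N%:R)))) -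
        (pos t z0 - f t)) <= e.
Proof.
move=> [vt [_ _ _ _ duh]] fv t0 td e0.
have [Wv [_ WvH Wint] Wae] := duh t ltac:(by rewrite in_itv/= t0).
have e1 : 0 < e / om_ub m by rewrite divr_gt0// om_ub_gt0.
have [eta eta0 hW] := Wint _ e1; exists eta => // N N0 tN.
have N0' : 0 < N%:R :> R by rewrite ltr0n.
pose tau (i : nat) : R := i%:R * (t / N%:R).
have dtau i : tau i.+1 - tau i = t / N%:R by rewrite /tau -mulrBl -natr1 addrAC subrr add0r mul1r.
have tN0 : 0 <= t / N%:R by rewrite divr_ge0// ltW.
have tau0 i : 0 <= tau i by rewrite mulr_ge0.
have taud i : (i < N)%N -> tau i <= d.
  move=> iN; apply: le_trans td; rewrite /tau mulrCA ler_piMr// ler_pdivrMr// mul1r ler_nat.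
  exact: ltnW.
pose S' x : R[i] := \sum_(i < N) ((tau i.+1 - tau i)%:C *
  sinA_over_A m (t - tau i) (cplx (nonlinearity q.+1 (v (tau i)))) x)%C.
have lt1 : (normH sigma 2 (S' \- Wv)%R < (e / om_ub m)%:E)%E.
  apply: (hW N tau tau).
  - by rewrite /tau mul0r.
  - by rewrite /tau mulrC divfK// gt_eqF.
  - by move=> i iN; rewrite lexx dtau -subr_ge0 dtau.
pose G : V := \sum_(i < N) (t / N%:R) *: sinV (t - tau i) (NV (f (tau i))).
have HS : Hr S' (unweight G).
  have -> : unweight G = fun xi => \sum_(i < N) (tau i.+1 - tau i) *
      ((o xi)^-1 * sin ((t - tau i) * o xi) * Upow (f (tau i)) xi).
    apply/funext => xi; rewrite /unweight.
    have -> : G xi = \sum_(i < N) (t / N%:R) * sinV (t - tau i) (NV (f (tau i))) xi.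
      by rewrite /G; elim/big_rec2: _ => // i y1 y2 _ <-.
    rewrite mulr_suml; apply: eq_bigr => i _.
    rewrite SE NVE dtau; field.
    by rewrite !gt_eqF ?om_gt0// cw_gt0.
  apply: Hr_sum => i; apply: HrZ; rewrite nonlinearityE//; apply: Hr_sinA.
  by apply: states_pow => //; exact: taud.
have HW : is_hart (Ref Wv) (unweight (pos t z0 - f t : V)).
  have HA := HrB (Hr_A u0h u1h h0L h1L t) (Hr_cplx (fv t t0 td)).
  have [_ hL _] := HA.1.
  apply: (is_hart_ae HA.1).
  - exact: (L2_measurable (in_H_in_Lp WvH).1).
  - apply: measurable_unweight; exact: (L2_measurable (V_L2 _)).
  - apply: filterS Wae => x; rewrite Ref_sub /Ref => ->.
    by case: (cosA _ _ _ _) (sinA_over_A _ _ _ _) (Wv x) => a b [a' b'] [a'' b''] /=; ring.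
  - by apply: aeW => xi; rewrite unweightB subVE.
have LS : in_Lp 2 S' by have [[? _ _] [? _ _]] := HS.
have LSW := in_LpB LS (in_H_in_Lp WvH).
have HSW : is_hart (Ref (S' \- Wv)%R) (unweight (G - (pos t z0 - f t) : V)).
  rewrite Ref_sub; have := is_hartB HS.1 HW.
  by under [X in is_hart _ X -> _]eq_fun do rewrite unweightB.
have [_ le1] := normH_lty HSW LSW (lt_trans lt1 (ltry _)).
have := le_lt_trans le1 lt1; rewrite lte_fin ltr_pdivlMr ?om_ub_gt0// mulrC => /ltW h'.
by apply: le_trans h'; exact: (nmV_wt2 (V_L2 (G - (pos t z0 - f t)))).
Qed.

Lemma sub_telescope (M : zmodType) (x y z a b : M) :
  x - y = ((a - (z - x)) - (b - (z - y))) - (a - b).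
Proof. by rewrite (opprB z x) (opprB z y) (opprD b) addrACA [RHS]addrAC subrr add0r (opprB y z) subrKA. Qed.

(** The Duhamel formulas of the two solutions are subtracted on a common grid;
    the nonlinearity is Lipschitz on the ball that contains both. *)
Lemma solution_unique (v v' : R -> T -> R) : solution m q.+1 sigma d u0 u1 v -> solution m q.+1 sigma d u0 u1 v' ->
  forall t, 0 <= t -> t <= d -> {ae mu, forall x, v t x = v' t x}.
Proof.
move=> sv sv'; have [f fv] := states_exist sv; have [g gv] := states_exist sv'.
have [B1 fB] := bounded_curve nmVD (states_cont sv fv).
have [B2 gB] := bounded_curve nmVD (states_cont sv' gv).
pose B := Num.max B1 B2.
have {}fB t : 0 <= t -> t <= d -> nmV (f t) <= B by move=> a b; rewrite le_max fB.
have {}gB t : 0 <= t -> t <= d -> nmV (g t) <= B by move=> a b; rewrite le_max gB ?orbT.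
have B0 : 0 <= B := le_trans (nmV_ge0 _) (fB 0 (lexx _) (ltW d0)).
have L0 : 0 <= Lam * B ^+ q by rewrite mulr_ge0 ?exprn_ge0// ltW// Lam_gt0.
pose psi t := nmV (f t - g t).
have psi0 : forall t, 0 <= t -> t <= d -> psi t <= 0.
  apply: (gronwall (B := B + B) L0) => [t t0 td|t e t0 td e0].
    by apply: le_trans (nmB nmVD nmVZ _ _) _; rewrite lerD ?fB ?gB.
  have e2 : 0 < e / 2 by rewrite divr_gt0.
  have [e1 e10 h1'] := duhamel_approx sv fv t0 td e2.
  have [e3 e30 h3] := duhamel_approx sv' gv t0 td e2.
  have e13 : 0 < Num.min e1 e3 by rewrite lt_min e10.
  pose N := (Num.bound (t / Num.min e1 e3)).+1; exists N => //.
  have N0 : 0 < N%:R :> R by rewrite ltr0n.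
  have tN : t / N%:R < Num.min e1 e3.
    rewrite ltr_pdivrMr// mulrC -ltr_pdivrMr//.
    apply: lt_le_trans (archi_boundP _) _; first by rewrite divr_ge0// ltW.
    by rewrite ler_nat.
  move: tN; rewrite lt_min => /andP[/(h1' N isT) a /(h3 N isT) b].
  pose k := t / N%:R; have k0 : 0 <= k by rewrite divr_ge0// ltW.
  set P1 := bigop _ _ _ in a; set P2 := bigop _ _ _ in b.
  have -> : psi t = nmV ((P1 - (pos t z0 - f t)) - (P2 - (pos t z0 - g t)) - (P1 - P2)).
    by congr nmV; exact: sub_telescope.
  apply: le_trans (nmB nmVD nmVZ _ _) _; apply: lerD.
    by apply: le_trans (nmB nmVD nmVZ _ _) _; rewrite [e]splitr lerD.
  rewrite /P1 /P2 -sumrB; apply: le_trans (nm_sum nmVD nmVZ _) _.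
  rewrite mulr_sumr; apply: ler_sum => i _.
  have ti : i%:R * k <= d.
    apply: le_trans td; rewrite /k mulrCA ler_piMr// ler_pdivrMr// mul1r ler_nat.
    exact: ltnW.
  have ti0 : 0 <= i%:R * k by rewrite mulr_ge0.
  rewrite -/k -scalerBr nmVZ (ger0_norm k0) (mulrCA _ k); apply: ler_wpM2l => //.
  rewrite -(SB (t - i%:R * k) (NV (f (i%:R * k))) (NV (g (i%:R * k)))).
  by apply: le_trans (nmS _ _) _; apply: NV_lip; [exact: fB|exact: gB].
move=> t t0 td; apply: hart_inj (fv t t0 td) (gv t t0 td) _.
have /(n2_eq0 (V_L2 _)) : n2 (f t - g t : V) = 0 by apply/eqP; rewrite eq_le n2_ge0 psi0.
by rewrite subVE; apply: filterS => xi /eqP; rewrite subr_eq0 /unweight => /eqP ->.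
Qed.

End uniqueness.

End state_space.

(** * Well-posedness *)

Section data.
Variables (R : realType) (n : nat) (m : R) (q : nat).
Hypotheses (hn : (n <= 3)%N) (hm : 0 < m).
Local Notation T := (Rn R n).
Local Notation mu := (lebesgueRn R n).
Local Notation L2 f := (f \in Lfun mu 2%:E).

Lemma in_H_hart sigma r (u : T -> R) : in_H sigma r (cplx u) ->
  exists h, [/\ is_hart u h, L2 (fun xi => wt sigma r xi * h xi) &
    fine (normH sigma r (cplx u)) = norm2 mu (fun xi => wt sigma r xi * h xi)].
Proof.
move=> uH; have LP := in_H_in_Lp uH; have [h uh] := is_hart_exists LP.1.
have [hL _] := normH_lty (uh : is_hart (Ref (cplx u)) h) LP uH.2.
by exists h; split => //; rewrite (normH_Hr (Hr_cplx uh) hL).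
Qed.

Lemma wt_gt0 sigma r (xi : T) : 0 < wt sigma r xi.
Proof.
rewrite /wt mulr_gt0 ?powR_gt0 ?(lt_le_trans _ (cosh_ge1 _))//.
exact: lt_le_trans (japanese_ge1 _).
Qed.

Lemma hart_norm0 sigma r (u h : T -> R) : is_hart u h ->
  L2 (fun xi => wt sigma r xi * h xi) -> norm2 mu (fun xi => wt sigma r xi * h xi) = 0 ->
  {ae mu, forall x, u x = 0}.
Proof.
move=> uh hL /(n2_eq0 hL) h0; apply: (hart_inj uh (is_hart0 R n)).
by apply: filterS h0 => xi /eqP; rewrite mulf_eq0 gt_eqF ?wt_gt0// => /eqP.
Qed.

(** From [d * lipc M <= 1 / 2] with [M = 2 (om_ub m + 1) E], where [E] is the
    sum of the norms of the data and the factor [om_ub m + 1] comes from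
    [nm_z0]. *)
Definition lifespan : R := (4 * Lam n m q * (2 * (om_ub m + 1)) ^+ q)^-1.

Lemma lifespan_gt0 : 0 < lifespan.
Proof.
have k0 : 0 < om_ub m + 1 by rewrite addr_gt0// om_ub_gt0.
have L0 := Lam_gt0 n q hm.
rewrite /lifespan invr_gt0; apply: mulr_gt0; first exact: mulr_gt0.
by apply: exprn_gt0; exact: mulr_gt0.
Qed.

Lemma well_posed sigma (u0 u1 : T -> R) : odd q.+1 -> 0 < sigma ->
  in_H sigma 2 (cplx u0) -> in_H sigma 0 (cplx u1) ->
  ~ {ae mu, forall x, u0 x = 0 /\ u1 x = 0} ->
  let delta := lifespan *
    (fine (normH sigma 2 (cplx u0)) + fine (normH sigma 0 (cplx u1))) ^- q in
  0 < delta /\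
  exists u : R -> T -> R,
    solution m q.+1 sigma delta u0 u1 u /\
    forall v : R -> T -> R, solution m q.+1 sigma delta u0 u1 v ->
      forall t : R, t \in `[0, delta] -> {ae mu, forall x, v t x = u t x}.
Proof.
move=> hq s0 /in_H_hart[h0 [u0h h0L ->]] /in_H_hart[h1 [u1h h1L ->]] nz.
set E := _ + _; move=> delta.
have E0 : 0 < E.
  rewrite lt_def addr_ge0 ?n2_ge0// andbT; apply/eqP => /eqP.
  rewrite paddr_eq0 ?n2_ge0// => /andP[/eqP a /eqP b]; apply: nz.
  by apply: filterS2 (hart_norm0 u0h h0L a) (hart_norm0 u1h h1L b).
have k0 : 0 < om_ub m + 1 by rewrite addr_gt0// om_ub_gt0.
have d0 : 0 < delta by rewrite mulr_gt0 ?lifespan_gt0// invr_gt0 exprn_gt0.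
split=> //; pose M := 2 * ((om_ub m + 1) * E).
have M0 : 0 <= M by rewrite !mulr_ge0// ltW.
have dM : delta * lipc n m q M <= 2^-1.
  have -> : delta * lipc n m q M = 2^-1; last exact: lexx.
  have L0 := lt0r_neq0 (Lam_gt0 n q hm).
  have := lt0r_neq0 E0; have := lt0r_neq0 k0.
  rewrite /delta /lifespan /lipc /M; move: (om_ub m + 1) (Lam n m q) L0 => k L L0 k1 E1.
  rewrite !exprMn; field; rewrite L0 !expf_neq0//=.
have zM : 2 * nmZ (z0 m sigma h0 h1) <= M by rewrite ler_pM2l// nm_z0.
have [X [X0 _ XL XD]] := picard_Phi hn hm s0 d0 dM zM.
exists (ut q hn hm s0 X); split.
  exact: (solution_ut d0 M0 XL XD u0h u1h h0L h1L X0 hq).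
move=> v vs t; rewrite in_itv/= => /andP[t0 td].
apply: (solution_unique hn hm s0 d0 u0h u1h h0L h1L hq vs _ t0 td).
exact: (solution_ut d0 M0 XL XD u0h u1h h0L h1L X0 hq).
Qed.

End data.

Theorem theorem2 (R : realType) (n : nat) (hn : (1 <= n <= 3)%N)
    (p : nat) (hp1 : (1 <= p)%N) (hp : odd p) (m : R) (hm : 0 < m) :
  exists2 c0 : R, 0 < c0 &
    forall (sigma : R) (u0 u1 : Rn R n -> R),
      0 < sigma ->
      in_H sigma 2 (cplx u0) -> in_H sigma 0 (cplx u1) ->
      ~ {ae lebesgueRn R n, forall x, u0 x = 0 /\ u1 x = 0} ->
      let delta := c0 *
        (fine (normH sigma 2 (cplx u0)) + fine (normH sigma 0 (cplx u1))) ^- p.-1 in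
      0 < delta /\
      exists u : R -> Rn R n -> R,
        solution m p sigma delta u0 u1 u /\
        forall v : R -> Rn R n -> R, solution m p sigma delta u0 u1 v ->
          forall t : R, t \in `[0, delta] ->
            {ae lebesgueRn R n, forall x, v t x = u t x}.
Proof.
case: p hp1 hp => [//|q] _ hq; have /andP[_ n3] := hn.
exists (lifespan n m q); first exact: lifespan_gt0.
by move=> sigma u0 u1 s0; exact: well_posed.
Qed.
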